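(* Let $K$ be a simplicial complex over the vertex set $[n]=\{1,\dots,n\}$, let $k\ge 0$ be an integer such that $K$ has $d_k\ge 1$ faces of dimension $k$, and let $\Delta_k$ be its $k$-th combinatorial Laplacian with $k$-th Betti number $\beta_k=\dim\ker(\Delta_k)$. Assume that in time $\mathrm{poly}(n)$ we can (i) draw a $k$-face of $K$ uniformly at random, and (ii) check whether a given subset of $[n]$ belongs to $K$. Suppose we are given an estimate $\hat\lambda\in\Theta(\lambda_{\max}(\Delta_k))$ and a lower bound $\gamma>0$ such that the spectral gap of $\Delta_k$ satisfies $\Gamma(\Delta_k)\ge\gamma\hat\lambda$. Then there exists a classical (randomized) algorithm that, for any $\varepsilon>0$, outputs with high probability an estimate $\tilde\nu_k$ satisfying $|\tilde\nu_k-\beta_k/d_k|\le\varepsilon$, and whose running time is $$n^{O\left(\frac{1}{\sqrt{\gamma}}\log\frac{1}{\varepsilon}\right)}$$ for a general simplicial complex, and $$\left(\frac{n}{\hat\lambda}\right)^{O\left(\frac{1}{\sqrt{\gamma}}\log\frac{1}{\varepsilon}\right)}\cdot\mathrm{poly}(n)$$ when $K$ is a clique complex. The algorithm has space complexity $\mathrm{poly}(n,1/\gamma,\log(1/\varepsilon))$.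
   Context: A simplicial complex $K$ over $[n]$ is a family of subsets of $[n]$ closed under taking subsets. A $k$-face is an element of $K$ of cardinality $k+1$; $C_k$ denotes the set of $k$-faces (in particular $C_{-1}=\{\emptyset\}$) and $d_k=|C_k|$. Each face $A=\{i_1,\dots,i_{k+1}\}$ is oriented with $i_1<\dots<i_{k+1}$ and associated with a basis vector $|A\rangle$ of the real vector space with orthonormal basis indexed by $C_k$. The boundary operator $\partial_k$ maps $|A\rangle\mapsto\sum_{\ell=1}^{k+1}(-1)^{\ell-1}|A\setminus\{i_\ell\}\rangle$, and the $k$-th combinatorial Laplacian is $\Delta_k=\partial_k^\dagger\partial_k+\partial_{k+1}\partial_{k+1}^\dagger$, a positive semidefinite $d_k\times d_k$ matrix. The $k$-th Betti number $\beta_k$ is the number of zero eigenvalues of $\Delta_k$, and $\beta_k/d_k$ is the normalized Betti number. The spectral gap $\Gamma(\Delta_k)$ is the smallest nonzero eigenvalue of $\Delta_k$, and $\lambda_{\max}(\Delta_k)$ its largest eigenvalue. The clique complex of a graph $G$ with vertex set $[n]$ is the simplicial complex whose faces are the vertex subsets inducing cliques in $G$.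
   Formalization: In the running time and space bounds 1/ε is read as max(2, 1/ε), and the base n/λ̂ as max(2, n/λ̂), since the literal bounds tend to 0 when n/λ̂ < 1 or ε > 1; the algorithm is told whether K is promised to be a clique complex. *)

(* Defs.v *)
From HB Require Import structures.
From mathcomp Require Import all_boot all_order all_algebra.
From mathcomp Require Import all_classical all_reals all_analysis.

Set Implicit Arguments.
Unset Strict Implicit.
Unset Printing Implicit Defensive.

Import Order.TTheory GRing.Theory Num.Theory.

Local Open Scope ring_scope.

(* The vertex set [n] is ['I_n], with vertices numbered from 0. *)

Definition simplicial_complex (n : nat) (K : {set {set 'I_n}}) : Prop :=
  forall A B : {set 'I_n}, A \in K -> B \subset A -> B \in K.

(* Indexed by cardinality, so that C_{-1} is [faces_card K 0]. *)
Definition faces_card (n : nat) (K : {set {set 'I_n}}) (m : nat) :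
    {set {set 'I_n}} :=
  [set A in K | #|A| == m].

Definition faces (n : nat) (K : {set {set 'I_n}}) (k : nat) :
    {set {set 'I_n}} :=
  faces_card K k.+1.

(* The entry <B| partial_k |A>; removing i = i_l from A = {i_1 < ... < i_(k+1)}
   carries the sign (-1)^(l-1), and l - 1 counts the elements of A below i. *)
Definition boundary (R : realType) (n : nat) (K : {set {set 'I_n}}) (k : nat) :
    'M[R]_(#|faces_card K k|, #|faces_card K k.+1|) :=
  \matrix_(p, q)
    let B : {set 'I_n} := enum_val p in
    let A : {set 'I_n} := enum_val q in
    \sum_(i in A | B == A :\ i) (-1) ^+ #|[set j in A | (j < i)%N]|.

Definition laplacian (R : realType) (n : nat) (K : {set {set 'I_n}})
    (k : nat) : 'M[R]_(#|faces K k|) :=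
  (boundary R K k)^T *m boundary R K k
  + boundary R K k.+1 *m (boundary R K k.+1)^T.

Definition betti (R : realType) (n : nat) (K : {set {set 'I_n}})
    (k : nat) : nat :=
  \rank (kermx (laplacian R K k)).

Definition is_largest_eigenvalue (R : realType) (d : nat) (M : 'M[R]_d)
    (l : R) : Prop :=
  eigenvalue M l /\ forall x : R, eigenvalue M x -> x <= l.

Definition is_spectral_gap (R : realType) (d : nat) (M : 'M[R]_d)
    (g : R) : Prop :=
  [/\ eigenvalue M g, g != 0 &
      forall x : R, eigenvalue M x -> x != 0 -> g <= x].

Definition clique_complex (n : nat) (e : rel 'I_n) : {set {set 'I_n}} :=
  [set A : {set 'I_n} |
    [forall x in A, forall y in A, (x != y) ==> e x y]].

Definition is_clique_complex (n : nat) (K : {set {set 'I_n}}) : Prop :=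
  exists e : rel 'I_n,
    [/\ symmetric e, irreflexive e & K = clique_complex e].

(* A finitely supported distribution is a weighted list of outcomes. *)

Definition dist (R : realType) (T : Type) : Type := seq (R * T).

Definition dret (R : realType) (T : Type) (x : T) : dist R T := [:: (1, x)].

Definition dbind (R : realType) (T U : Type) (D : dist R T)
    (f : T -> dist R U) : dist R U :=
  flatten [seq [seq (p.1 * q.1, q.2) | q <- f p.2] | p <- D].

Definition uniform (R : realType) (T : Type) (s : seq T) : dist R T :=
  [seq ((size s)%:R^-1, x) | x <- s].

Definition Pr (R : realType) (T : Type) (E : T -> bool) (D : dist R T) : R :=
  \sum_(p <- D | E p.2) p.1.

(* The model of computation is a randomized random-access machine with
   logarithmic cost: memory cells hold unbounded natural numbers, and every
   value that is read, computed or written is charged its bit length.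
   - [Rand d e] draws a uniform integer below max(1, e).
   - [SampleFace d] draws a uniform k-face of K and [Member d e] tests whether
     a subset of [n] is in K; subsets are exchanged as n-bit masks.
   - [Compare d p e1 e2] tests whether e1 <= e2 * x, where x is the real
     parameter named p.  The program has no other access to the reals lambda,
     gamma and epsilon, and pays for the precision at which it inspects them. *)

Inductive binop := OAdd | OSub | OMul | ODiv | OMod.

Inductive expr :=
  | Cst of nat
  | Cell of expr
  | Bin of binop & expr & expr.

Inductive param := PLambda | PGamma | PEpsilon.

(* The first expression of an assignment-like command is the address at which
   the result is stored. *)
Inductive cmd :=
  | Skip
  | Store of expr & expr
  | Seq of cmd & cmd
  | If of expr & cmd & cmd
  | While of expr & cmd
  | Rand of expr & expr
  | SampleFace of expr
  | Member of expr & expr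
  | Compare of expr & param & expr & expr.

Definition bits (v : nat) : nat := (trunc_log 2 v).+1.

(* OSub is truncated, and x / 0 = 0, x mod 0 = x. *)
Definition eval_binop (o : binop) (x y : nat) : nat :=
  match o with
  | OAdd => x + y
  | OSub => x - y
  | OMul => x * y
  | ODiv => x %/ y
  | OMod => x %% y
  end%N.

Fixpoint eval_expr (m : seq nat) (e : expr) : nat :=
  match e with
  | Cst c => c
  | Cell e1 => nth 0 m (eval_expr m e1)
  | Bin o e1 e2 => eval_binop o (eval_expr m e1) (eval_expr m e2)
  end%N.

Fixpoint eval_cost (m : seq nat) (e : expr) : nat :=
  match e with
  | Cst c => bits c
  | Cell e1 => eval_cost m e1 + bits (eval_expr m e)
  | Bin o e1 e2 => eval_cost m e1 + eval_cost m e2 + bits (eval_expr m e)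
  end%N.

(* Memory, elapsed time, peak space. *)
Definition state : Type := (seq nat * nat * nat)%type.

Definition memory (s : state) : seq nat := s.1.1.
Definition run_time (s : state) : nat := s.1.2.
Definition peak_space (s : state) : nat := s.2.

(* Cells are counted up to the highest address written so far. *)
Definition memory_size (m : seq nat) : nat := (\sum_(v <- m) (bits v).+1)%N.

Definition init_state (m : seq nat) : state := (m, 0%N, memory_size m).

(* The working space of a single step is bounded by its duration. *)
Definition step (s : state) (cost : nat) (m : seq nat) : state :=
  (m, (run_time s + cost.+1)%N, maxn (peak_space s) (memory_size m + cost.+1)).

Definition store (s : state) (cost : nat) (addr : expr) (v : nat) : state :=
  let m := memory s in
  step s (cost + eval_cost m addr + bits v)%N (set_nth 0%N m (eval_expr m addr) v).

Definition encode (n : nat) (A : {set 'I_n}) : nat := (\sum_(i in A) 2 ^ i)%N.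

Definition decode (n : nat) (v : nat) : {set 'I_n} :=
  [set i : 'I_n | odd (v %/ 2 ^ i)].

Record environment (R : realType) := Environment {
  env_n : nat;
  env_complex : {set {set 'I_env_n}};
  env_dim : nat;
  env_sample_cost : nat;
  env_member_cost : nat;
  env_param : param -> R
}.

(* [None] means that the fuel was exhausted before termination; fuel bounds the
   recursion depth and is unrelated to the running time. *)
Fixpoint exec (R : realType) (E : environment R) (fuel : nat) (c : cmd)
    (s : state) : dist R (option state) :=
  if fuel is fuel'.+1 then
    let m := memory s in
    let continue c' o := if o is Some s' then exec E fuel' c' s'
                         else dret R None in
    match c with
    | Skip => dret R (Some (step s 0 m))
    | Store d e => dret R (Some (store s (eval_cost m e) d (eval_expr m e)))
    | Seq c1 c2 => dbind (exec E fuel' c1 s) (continue c2)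
    | If e c1 c2 =>
        exec E fuel' (if eval_expr m e != 0%N then c1 else c2)
          (step s (eval_cost m e) m)
    | While e c1 =>
        let s' := step s (eval_cost m e) m in
        if eval_expr m e != 0%N then dbind (exec E fuel' c1 s') (continue c)
        else dret R (Some s')
    | Rand d e =>
        dbind (uniform R (iota 0 (maxn 1 (eval_expr m e)))) (fun v =>
          dret R (Some (store s (eval_cost m e) d v)))
    | SampleFace d =>
        dbind (uniform R (enum (faces (env_complex E) (env_dim E)))) (fun A =>
          dret R (Some (store s (env_sample_cost E) d (encode A))))
    | Member d e =>
        let answer := decode (env_n E) (eval_expr m e) \in env_complex E in
        dret R (Some (store s (eval_cost m e + env_member_cost E)%N d answer))
    | Compare d p e1 e2 =>
        let answer := (eval_expr m e1)%:R <= (eval_expr m e2)%:R * env_param E p in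
        dret R (Some (store s (eval_cost m e1 + eval_cost m e2)%N d answer))
    end
  else dret R None.

Definition parameters (R : realType) (lambda gamma epsilon : R) (p : param) :
    R :=
  match p with
  | PLambda => lambda
  | PGamma => gamma
  | PEpsilon => epsilon
  end.

(* The rational number whose numerator and denominator are in cells 0 and 1. *)
Definition output (R : realType) (s : state) : R :=
  (nth 0%N (memory s) 0)%:R / (nth 0%N (memory s) 1)%:R.

(* In the bounds below, 1/epsilon and n/lambda are replaced by 2 when they are
   smaller than 2: a literal reading of the O-notation would make the logarithm
   vanish or be negative for epsilon near or above 1, and would make
   (n/lambda)^O(_) constant or tend to 0 for lambda near or above n, although
   n/lambda is only determined up to a constant factor. *)

Definition log_inv (R : realType) (epsilon : R) : R :=
  ln (Num.max 2 epsilon^-1).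

Definition degree_bound (R : realType) (gamma epsilon : R) : R :=
  (Num.sqrt gamma)^-1 * log_inv epsilon.

Definition time_general (R : realType) (C n : nat) (gamma epsilon : R) : R :=
  C%:R * n%:R `^ (C%:R * degree_bound gamma epsilon).

Definition time_clique (R : realType) (C n : nat)
    (lambda gamma epsilon : R) : R :=
  Num.max 2 (n%:R / lambda) `^ (C%:R * degree_bound gamma epsilon)
  * (C%:R * n%:R ^+ C).

Definition space_bound (R : realType) (C n : nat) (gamma epsilon : R) : R :=
  C%:R * (n%:R + gamma^-1 + log_inv epsilon) ^+ C.

(* Main.v *)
(** Let V_m be the Chebyshev polynomial of the third kind.  With L of the order
    of lambda_max, D of the order of 1/gamma and y = 1 + 1/D, the matrix
    Y = y I - Delta_k / L has the eigenvalue y exactly on the kernel of Delta_k,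
    and all its other eigenvalues lie in [0, 1], where |V_m| <= 3/2.  As V_m(y)
    grows like exp(m / sqrt D), tr V_m(Y) / (d_k V_m(y)) is within epsilon of
    beta_k / d_k for some m = O(log (1/epsilon) / sqrt gamma).

    The trace is estimated by random walks: the recurrence
    V_(r+1) = 2 Y V_r - V_(r-1) is the action of a signed transition matrix on
    pairs of a face and a flag, so after m steps from a uniform face A the
    expected sign of the walks that return to A is tr V_m(Y) / d_k, divided by
    the m-th power of a normalization factor N.  In a row of Delta_k the swaps
    A - i + j with A + j in K cancel; in a clique complex at most one swap is
    left for each j, so that N = O(1 + n / L), whereas N = O(1 + n^2 / L) in
    general.  Chebyshev's inequality shows that N^(2 m) samples suffice, up to
    factors polynomial in n and exponential in m.

    The real parameters are only accessed by comparisons, hence L and D are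
    found by counting upwards, and the walk uses integer masses only. *)
Require Import Defs.
From HB Require Import structures.
From mathcomp Require Import all_boot all_order all_algebra.
From mathcomp Require Import all_classical all_reals all_analysis.
From mathcomp Require Import spectral sesquilinear complex ring lra zify.

Set Implicit Arguments.
Unset Strict Implicit.
Unset Printing Implicit Defensive.

Import Order.TTheory GRing.Theory Num.Theory.

Local Open Scope ring_scope.

(** * Chebyshev polynomials at symmetric matrices *)

(** The machine computes with natural numbers only, so the rescaling by V_m(y) must be rational and
    exact. This dictates D = 2 g (g + 1): then y = (x + 1/x) / 2 with x = (g + 1) / g, and V_m(y) is
    a quotient of integers whose numerator is a sum of two odd powers; no square root appears. The
    initial values V_0 = V_(-1) = 1 also suit the walk: the final test, being back at the starting
    face, is the same for both values of the flag.

    Distributions are lists, and the program logic asserts equality of lists, outcome by outcome, so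
    no notion of equivalent distributions is needed. The price is that the memory at the head of a
    loop must be a function of the state of the walk, which is why the program clears its scratch
    cells. Time is bounded by the number of steps times one uniform cost, computed from a bound b on
    the bit length of every cell; b is fixed beforehand and polynomial in n and m.

    For n = 1 the bound n^O(_) is constant, so this case is answered without sampling. *)

(* Chebyshev polynomials of the third kind: [chebV_pair y r] is the pair
   (V_r(y), V_(r-1)(y)), with V_0 = V_(-1) = 1. *)
Fixpoint chebV_pair (A : pzRingType) (y : A) (r : nat) : A * A :=
  if r is r'.+1 then
    let p := chebV_pair y r' in (y * p.1 *+ 2 - p.2, p.1)
  else (1, 1).

Definition chebV (A : pzRingType) (y : A) (r : nat) : A := (chebV_pair y r).1.

(** [B] selects the coordinates with a nonzero diagonal entry: it has full row rank and the row
    space of [diag_mx D]. *)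
Lemma rank_diag_mx (F : fieldType) (d : nat) (D : 'rV[F]_d) :
  \rank (diag_mx D) = #|[pred i | D 0 i != 0]|.
Proof.
set S := [pred i | _].
pose B : 'M[F]_(#|S|, d) := \matrix_(p, j) (enum_val p == j)%:R.
have rowB p : row p B = delta_mx 0 (enum_val p).
  by apply/rowP => j; rewrite !mxE eq_sym.
have rB : \rank B = #|S|.
  apply/eqP; rewrite -[_ == _]/(row_free B); apply/row_freeP; exists B^T.
  apply/matrixP => p q; rewrite !mxE (bigD1 (enum_val p)) //= !mxE eqxx mul1r.
  rewrite big1 ?addr0 => [|j /negPf jp]; first by rewrite (inj_eq enum_val_inj) eq_sym.
  by rewrite !mxE eq_sym jp mul0r.
rewrite -[RHS]rB; apply: eqmx_rank; apply/andP; split; apply/row_subP => i.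
  rewrite row_diag_mx; have [->|Di] := eqVneq (D 0 i) 0.
    by rewrite scale0r sub0mx.
  rewrite scalemx_sub //; have iS : i \in S by rewrite inE.
  by rewrite -(enum_rankK_in iS iS) -rowB row_sub.
rewrite rowB; have Di : D 0 (enum_val i) != 0 by have := enum_valP i; rewrite inE.
by rewrite -(eqmx_scale _ Di) -row_diag_mx row_sub.
Qed.

(** Over [R[i]] the matrix is Hermitian, hence unitarily diagonalizable with real eigenvalues. Rank,
    trace and the recurrence of [chebV] are compatible with conjugation, and the injection of [R]
    into [R[i]] reflects the resulting equalities. *)
Lemma spectral_real (R : realType) (d : nat) (M : 'M[R]_d) :
  M^T = M ->
  exists v : 'I_d -> R,
    [/\ forall i, eigenvalue M (v i),
        \rank (kermx M) = #|[pred i | v i == 0]|,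
        \tr M = \sum_i v i &
        forall (a c : R) (r : nat),
          \tr (chebV (a%:M - c *: M) r) = \sum_i chebV (a - c * v i) r].
Proof.
move=> Msym; pose f : {rmorphism R -> R[i]} := real_complex R; pose MC : 'M[R[i]]_d := map_mx f M.
have MCreal : MC \is a mxOver Num.real.
  apply/mxOverP => i j; rewrite mxE; apply/complex_realP; by exists (M i j).
have MCsym : MC \is symmetricmx.
  apply/is_hermitianmxP; rewrite expr0 scale1r.
  by apply/matrixP => i j; rewrite !mxE -[in LHS]Msym mxE.
have MCh := realsym_hermsym MCsym MCreal.
have /orthomx_spectralP := hermitian_normalmx MCh.
set P := spectralmx MC; set D := spectral_diag MC => MCE.
have Pu : P \in unitmx by exact: spectral_unit.
have Dreal := hermitian_spectral_diag_real MCh.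
have /fin_all_exists [v vE] i : exists x : R, D 0 i = f x.
  by apply/complex_realP; exact: (mxOverP Dreal).
have DE : D = map_mx f (\row_i v i) by apply/rowP => i; rewrite !mxE vE.
have conj_tr (X : 'M[R[i]]_d) : \tr (invmx P *m X *m P) = \tr X.
  by rewrite mxtrace_mulC mulmxA mulmxV // mul1mx.
exists v; split.
- move=> i; rewrite -(eigenvalue_map f) -/MC; apply/eigenvalueP.
  exists (row i P).
    rewrite MCE -!mulmxA !mulmxA -row_mul mulmxV // row1 -rowE row_diag_mx vE.
    by rewrite -scalemxAl -rowE.
  apply/eqP => Pi0.
  have : row i (P *m invmx P) = 0 by rewrite row_mul Pi0 mul0mx.
  by rewrite mulmxV // => /rowP /(_ i) /eqP; rewrite !mxE eqxx oner_eq0.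
- rewrite mxrank_ker -(mxrank_map f) -/MC MCE.
  rewrite mxrankMfree ?row_free_unit // -mxrank_tr trmx_mul tr_diag_mx.
  rewrite mxrankMfree ?row_free_unit ?unitmx_tr ?unitmx_inv //.
  rewrite rank_diag_mx; set S := [pred i | v i == 0]; set S' := [pred i | _ != _].
  suff e : (#|S| + #|S'| = d)%N.
    by apply: (@addIn #|S'|); rewrite subnK // -[leqRHS]e leq_addl.
  rewrite -[RHS]card_ord -(cardC S); congr (_ + _)%N.
  by apply: eq_card => i; rewrite !inE vE fmorph_eq0.
- apply: (fmorph_inj f); rewrite -trace_map_mx -/MC {1}MCE conj_tr mxtrace_diag.
  by rewrite rmorph_sum; apply: eq_bigr => i _; rewrite vE.
move=> a c r; apply: (fmorph_inj f); rewrite -trace_map_mx.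
pose E : 'rV[R[i]]_d := \row_i f (a - c * v i).
have HE : map_mx f (a%:M - c *: M) = invmx P *m diag_mx E *m P.
  rewrite map_mxB map_scalar_mx map_mxZ -/MC MCE.
  have -> : diag_mx E = (f a)%:M - f c *: diag_mx D.
    apply/matrixP => i j; rewrite !mxE vE rmorphB rmorphM /=.
    by case: eqP => _; rewrite ?mulr0n ?mulr1n ?mulr0 ?subr0.
  by rewrite mulmxBr mulmxBl -scalemxAr -scalemxAl mul_mx_scalar -[_ *: _ *m P]scalemxAl mulVmx // scalemx1.
(* The recurrence has order two, so V_(r-1) is carried along in the induction. *)
have [-> _] : map_mx f (chebV (a%:M - c *: M) r) = invmx P *m diag_mx (\row_i f (chebV (a - c * v i) r)) *m P
  /\ map_mx f (chebV_pair (a%:M - c *: M) r).2 = invmx P *m diag_mx (\row_i f (chebV_pair (a - c * v i) r).2) *m P.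
  have conjM (X Y : 'M[R[i]]_d) :
      (invmx P *m X *m P) *m (invmx P *m Y *m P) = invmx P *m (X *m Y) *m P.
    by rewrite !mulmxA mulmxK.
  elim: r => [|r [IH1 IH2]] /=.
    have -> : (\row_(i < d) f 1) = const_mx 1 by apply/rowP => i; rewrite !mxE rmorph1.
    by rewrite map_mx1 diag_const_mx mulmx1 mulVmx.
  split; last exact: IH1.
  rewrite rmorphB rmorphMn rmorphM /= HE IH2 {1}/chebV IH1 -mulmxE conjM.
  pose V1 := \row_i f (chebV (a - c * v i) r).
  pose V2 := \row_i f (chebV_pair (a - c * v i) r).2.
  have -> : diag_mx (\row_i f (chebV (a - c * v i) r.+1)) =
      diag_mx E *m diag_mx V1 + diag_mx E *m diag_mx V1 - diag_mx V2.
    rewrite mulmx_diag; apply/matrixP => i j.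
    rewrite !mxE /chebV /= rmorphB rmorphMn rmorphM /=.
    by case: (i == j); rewrite ?mulr0n ?mulr1n ?addr0 ?subr0 // mulr2n.
  by rewrite mulmxBr mulmxBl mulmxDr mulmxDl mulr2n.
rewrite conj_tr mxtrace_diag rmorph_sum.
by apply: eq_bigr => i _; rewrite mxE.
Qed.

(* For y^2 < 1 the left-hand side is a positive definite quadratic form. *)
Lemma chebV_pair_invariant (A : comPzRingType) (y : A) (r : nat) :
  let p := chebV_pair y r in
  p.1 ^+ 2 - y * p.1 * p.2 *+ 2 + p.2 ^+ 2 = 2%:R - y *+ 2.
Proof. by elim: r => [|r /= IH] /=; [|rewrite -IH]; ring. Qed.

(** Completing the square in the invariant gives (1 - y^2) p^2 <= 2 (1 - y); for y < 1, division by
    1 - y leaves (1 + y) p^2 <= 2, and 3/2 is a rational bound for sqrt 2. At y = 1 every V_r is 1.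
    The bound fails for negative y: at y = -1 the absolute value of V_r is 2 r + 1. *)
Lemma chebV_bound (R : realType) (y : R) (r : nat) :
  0 <= y -> y <= 1 -> `|chebV y r| <= 3 / 2.
Proof.
move=> y0 y1; suff le2 : chebV y r ^+ 2 <= 2.
  rewrite -(@ler_pXn2r _ 2) ?nnegrE ?divr_ge0 //.
  by rewrite real_normK ?num_real //; apply: le_trans le2 _; lra.
rewrite /chebV; have := chebV_pair_invariant y r; move: y1; rewrite le_eqVlt.
case/orP => [/eqP ->|y1].
  have -> : chebV_pair (1 : R) r = (1, 1).
    by elim: r => //= r -> /=; congr (_, _); ring.
  by move=> _ /=; lra.
move: (chebV_pair y r) => [p q] /= e.
have e1 : (1 - y) * ((1 + y) * p ^+ 2) <= (1 - y) * 2.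
  by have := sqr_ge0 (q - y * p); nra.
have y1' : 0 < 1 - y by rewrite subr_gt0.
rewrite (ler_pM2l y1') in e1.
by have := sqr_ge0 p; nra.
Qed.

(* With x = (g + 1) / g, the evaluation point is (x + 1/x) / 2. *)
Lemma chebV_closed_form (R : realType) (g r : nat) :
  (0 < g)%N ->
  chebV (1 + (2 * g * g.+1)%:R^-1 : R) r * ((2 * g).+1 * (g.+1 * g) ^ r)%:R =
  (g.+1 ^ (2 * r).+1 + g ^ (2 * r).+1)%:R.
Proof.
move=> g0; set y := 1 + _.
have yE : (g.+1 * g)%:R * y *+ 2 = (g.+1 ^ 2 + g ^ 2)%:R :> R.
  rewrite /y mulrDr mulrnDl mulr1 natrD !natrX !natrM !invfM -(natr1 g).
  have : (g%:R : R) != 0 by rewrite pnatr_eq0 -lt0n.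
  have : (g%:R + 1 : R) != 0 by rewrite natr1 pnatr_eq0.
  by move=> h1 h2; field; rewrite h1 h2.
(* The companion formula for V_(r-1) is g (g + 1) times the sum of the powers of exponent 2 r - 1,
   multiplied out so that it makes sense at r = 0. *)
suff [] : chebV y r * ((2 * g).+1 * (g.+1 * g) ^ r)%:R =
    (g.+1 ^ (2 * r).+1 + g ^ (2 * r).+1)%:R /\
  (chebV_pair y r).2 * ((2 * g).+1 * (g.+1 * g) ^ r)%:R =
    (g * g.+1 ^ (2 * r) + g.+1 * g ^ (2 * r))%:R by [].
elim: r => [|r [IH1 IH2]].
  by rewrite /chebV /= !muln0 !expn0 !expn1; split; rewrite mul1r; congr _%:R; lia.
have eM : ((2 * g).+1 * (g.+1 * g) ^ r.+1)%:R =
   (g.+1 * g)%:R * ((2 * g).+1 * (g.+1 * g) ^ r)%:R :> R.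
  by rewrite -natrM expnS; congr _%:R; ring.
rewrite eM mulnS [chebV _ _]/= /chebV /=; split.
  rewrite mulrBl; set q := (_ * _)%:R in IH1 IH2 *.
  have -> : y * (chebV_pair y r).1 *+ 2 * ((g.+1 * g)%:R * q) =
    ((g.+1 * g)%:R * y *+ 2) * ((chebV_pair y r).1 * q) by ring.
  rewrite [(chebV_pair y r).2 * _]mulrCA IH2 IH1 yE -!natrM -natrB; last first.
    rewrite !expnS expn0 muln1; move: (g.+1 ^ _)%N (g ^ _)%N => u v.
    by apply: leq_trans (leq_addr (g.+1 * g.+1 * g.+1 * u + g * g * g * v) _) _; apply: eq_leq; ring.
  congr _%:R; rewrite -[(2 + 2 * r).+1]/(2 * r).+3 !expnS expn0 !muln1.
  move: (g.+1 ^ _)%N (g ^ _)%N => u v.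
  apply/eqP; rewrite -(eqn_add2r (g.+1 * g * (g * u + g.+1 * v))) subnK.
    by apply/eqP; ring.
  by apply: leq_trans (leq_addr (g.+1 * g.+1 * g.+1 * u + g * g * g * v) _) _; apply: eq_leq; ring.
by rewrite [(chebV_pair y r).1 * _]mulrCA IH1 -natrM; congr _%:R; rewrite !expnS; ring.
Qed.

(** The first two terms of the binomial expansion of (g + 1)^g are both g^g. *)
Lemma bernoulli_expn (g : nat) : (0 < g)%N -> (2 * g ^ g <= g.+1 ^ g)%N.
Proof.
move=> g0; case: g g0 => // g _; rewrite -[g.+2]addn1 expnDn.
rewrite big_ord_recl big_ord_recl /= bin0 subn0 !mul1n exp1n muln1 /bump /=.
rewrite bin1 exp1n muln1 addn0 subn1 /= -expnS mul2n -addnn addnA leq_addr //.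
Qed.

(** With x = (g + 1) / g, the larger of the two terms of the closed form is x^m (g + 1) / (2 g + 1),
    hence at least x^m / 2, and x^g >= 2. So V_m(y) gains a factor 2 every g steps, which fixes the
    walk length g * s. *)
Lemma chebV_growth (R : realType) (g s : nat) :
  (0 < g)%N ->
  (2 ^ s)%:R / 2 <= chebV (1 + (2 * g * g.+1)%:R^-1 : R) (g * s).
Proof.
move=> g0; have q0 : (0 < (2 * g).+1 * (g.+1 * g) ^ (g * s))%N.
  by rewrite muln_gt0 expn_gt0 muln_gt0 g0.
rewrite -(@ler_pM2r _ ((2 * g).+1 * (g.+1 * g) ^ (g * s))%:R) ?ltr0n //.
rewrite chebV_closed_form // mulrAC ler_pdivrMr // -!natrM ler_nat.
have h : (2 ^ s * g ^ (g * s) <= g.+1 ^ (g * s))%N.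
  case: s {q0} => [|s]; first by rewrite muln0.
  by rewrite !expnM -expnMn leq_exp2r ?bernoulli_expn.
rewrite !expnS !mul2n -!addnn !expnD expnMn.
move: h; move: (2 ^ s)%N (g ^ (g * s))%N (g.+1 ^ (g * s))%N => e v u h.
apply: (@leq_trans ((g + g).+1 * (u * u))).
  by rewrite mulnCA leq_mul2l /= mulnA [(e * u)%N]mulnC -mulnA leq_mul2l h orbT.
by rewrite mulnDl (leq_trans _ (leq_addr _ _)) // mulnAC leq_mul2r; apply/orP; right; lia.
Qed.

(** * The combinatorial Laplacian *)

Section LaplacianOperator.
Variables (R : realType) (n : nat) (K : {set {set 'I_n}}).
Hypothesis Kcx : simplicial_complex K.

Definition below (A : {set 'I_n}) (i : 'I_n) : nat :=
  #|[set l in A | (l < i)%N]|.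

Definition swappable (A : {set 'I_n}) (j i : 'I_n) : bool :=
  (i \in A) && (j |: A :\ i \in K).

(** The product of the boundary coefficients of [A] and [j |: A :\ i] at their common facet
    [A :\ i]. Counting in the facet makes it symmetric in [i] and [j]. *)
Definition swap_sign (A : {set 'I_n}) (j i : 'I_n) : R :=
  (-1) ^+ (below (A :\ i) i + below (A :\ i) j).

(** The row of the Laplacian at [A], sorted by the vertex [j] that is swapped in, as the walk
    samples it. For [j] in [A] the set [j |: A] is [A] itself and the term belongs to the diagonal
    of the down part; for the other [j] with [j |: A] in [K] it belongs to the diagonal of the up
    part. *)
Definition laplacian_op (h : {set 'I_n} -> R) (A : {set 'I_n}) : R :=
  \sum_(j : 'I_n)
    if j |: A \in K then h A
    else \sum_(i | swappable A j i) swap_sign A j i * h (j |: A :\ i).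

Lemma belowD1 (A : {set 'I_n}) i j : i \in A ->
  below A j = (below (A :\ i) j + (i < j))%N.
Proof.
move=> iA; rewrite /below; case: ltnP => ij /=.
  rewrite (cardsD1 i) inE iA ij /= addnC; congr (#|pred_of_set _| + _)%N.
  by apply/setP => l; rewrite !inE andbA.
rewrite addn0; apply: eq_card => l; rewrite !inE.
by case: eqP => //= ->; rewrite ltnNge ij andbF.
Qed.

Lemma below_addx (A : {set 'I_n}) j : below (j |: A) j = below A j.
Proof.
apply: eq_card => l; rewrite !inE; case: eqP => //= ->.
by rewrite ltnn andbF.
Qed.

Lemma below_delx (A : {set 'I_n}) i : below (A :\ i) i = below A i.
Proof.
apply: eq_card => l; rewrite !inE; case: eqP => //= ->.
by rewrite ltnn andbF.
Qed.

Let bd (B A : {set 'I_n}) : R :=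
  \sum_(i in A | B == A :\ i) (-1) ^+ below A i.

Let sum_bd_l m (A : {set 'I_n}) (g : {set 'I_n} -> R) :
  A \in faces_card K m.+1 ->
  \sum_(C in faces_card K m) bd C A * g C =
  \sum_(i in A) (-1) ^+ below A i * g (A :\ i).
Proof.
rewrite inE => /andP[AK /eqP cA]; rewrite /bd.
under eq_bigr do rewrite big_distrl /= big_mkcondr /=.
rewrite exchange_big /=; apply: eq_bigr => i iA.
have CF : A :\ i \in faces_card K m.
  rewrite inE (Kcx AK) ?finset.subD1set //=.
  by move: cA; rewrite (cardsD1 i) iA add1n => -[->].
rewrite (bigD1 (A :\ i)) //= eqxx big1 ?addr0 // => C /andP[_ /negPf ->] //.
Qed.

Let sum_bd_r m (C : {set 'I_n}) (g : {set 'I_n} -> R) :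
  #|C| = m ->
  \sum_(B in faces_card K m.+1) bd C B * g B =
  \sum_(j | (j \notin C) && (j |: C \in K)) (-1) ^+ below C j * g (j |: C).
Proof.
move=> cC; rewrite /bd.
under eq_bigr do rewrite big_distrl /= big_mkcond /=.
rewrite exchange_big /= [RHS]big_mkcond /=; apply: eq_bigr => j _.
case: ifPn => [/andP[jC jK]|jC].
  rewrite (bigD1 (j |: C)) /=; last by rewrite inE jK cardsU1 jC cC add1n eqxx.
  rewrite finset.setU11 finset.setU1K // eqxx /= below_addx big1 ?addr0 // => B /andP[_ BC].
  case: ifP => // /andP[jB /eqP CE]; case/negP: BC.
  by rewrite CE finset.setD1K.
apply: big1 => B; rewrite inE => /andP[BK _].
case: ifP => // /andP[jB /eqP CE]; case/negP: jC.
by rewrite CE finset.setD11 /= finset.setD1K.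
Qed.

Lemma sum_faces k (F : {set 'I_n} -> R) :
  \sum_(q < #|faces_card K k|) F (enum_val q) = \sum_(B in faces_card K k) F B.
Proof. by rewrite -big_enum_val. Qed.

(* The terms of the up and down parts that exchange j and i cancel as soon as
   j |: A is a face. *)
Lemma laplacian_opE k (p : 'I_#|faces K k|) (h : {set 'I_n} -> R) :
  \sum_q laplacian R K k p q * h (enum_val q) = laplacian_op h (enum_val p).
Proof.
set A : {set 'I_n} := enum_val p.
have AF : A \in faces_card K k.+1 := enum_valP p.
have [AK cA] : A \in K /\ #|A| = k.+1.
  by move: AF; rewrite inE => /andP[? /eqP].
transitivity (\sum_(C in faces_card K k) bd C A *
                 (\sum_(B in faces_card K k.+1) bd C B * h B) +
              \sum_(D in faces_card K k.+2) bd A D *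
                 (\sum_(B in faces_card K k.+1) bd B D * h B)).
  under eq_bigr do rewrite /laplacian !mxE mulrDl.
  rewrite big_split /=; congr (_ + _).
    rewrite -(sum_faces _ (fun C => bd C A * _)).
    under eq_bigr do rewrite big_distrl /=.
    rewrite exchange_big /=; apply: eq_bigr => C _.
    rewrite -(sum_faces _ (fun B => bd _ B * h B)) big_distrr /=.
    by apply: eq_bigr => q _; rewrite !mxE -mulrA.
  rewrite -(sum_faces _ (fun D => bd A D * _)).
  under eq_bigr do rewrite big_distrl /=.
  rewrite exchange_big /=; apply: eq_bigr => C _.
  rewrite -(sum_faces _ (fun B => bd B _ * h B)) big_distrr /=.
  by apply: eq_bigr => q _; rewrite !mxE -mulrA.
rewrite sum_bd_l // sum_bd_r //.
have -> : \sum_(i in A) (-1) ^+ below A i *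
    (\sum_(B in faces_card K k.+1) bd (A :\ i) B * h B) =
  \sum_(i in A) h A +
  \sum_(j | j \notin A) \sum_(i | swappable A j i) swap_sign A j i * h (j |: A :\ i).
  rewrite (exchange_big_dep (mem A)) /=; last by move=> j i _ /andP[].
  rewrite -big_split /=; apply: eq_bigr => i iA.
  have ci : #|A :\ i| = k by move: cA; rewrite (cardsD1 i) iA add1n => -[].
  rewrite sum_bd_r // (bigD1 i) /=; last by rewrite finset.setD11 finset.setD1K.
  rewrite finset.setD1K // mulrDr mulrA below_delx -expr2 sqrr_sign mul1r.
  congr (_ + _); rewrite big_distrr /=; apply: eq_big => j.
    rewrite /swappable iA !inE negb_and negbK andbAC; case: eqP => //=.
      by move=> ->; rewrite iA.
    by rewrite andbT.
  by move=> _; rewrite mulrA -exprD /swap_sign below_delx.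
have -> : \sum_(j | (j \notin A) && (j |: A \in K)) (-1) ^+ below A j *
    (\sum_(B in faces_card K k.+1) bd B (j |: A) * h B) =
  \sum_(j | j \notin A) if j |: A \in K then
     h A - \sum_(i | swappable A j i) swap_sign A j i * h (j |: A :\ i) else 0.
  rewrite big_mkcondr /=; apply: eq_bigr => j jA; case: ifP => // jK.
  rewrite sum_bd_l; last by rewrite inE jK cardsU1 jA cA add1n eqxx.
  rewrite (bigD1 j) ?finset.setU11 //= finset.setU1K // below_addx mulrDr mulrA -expr2.
  rewrite sqrr_sign mul1r big_distrr /= -sumrN; congr (_ + _).
  apply: eq_big => i.
    rewrite /swappable !inE; have [->|ij] := eqVneq i j.
      by rewrite (negPf jA).
    rewrite /= andbT; case iA: (i \in A) => //=; apply/esym.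
    by apply: Kcx jK _; apply: finset.setUS; apply: finset.subD1set.
  rewrite !inE => /andP[/orP[/eqP->|iA] ij]; first by rewrite eqxx in ij.
  have -> : (j |: A) :\ i = j |: A :\ i.
    by apply/setP => l; rewrite !inE; case: eqP => //= ->; rewrite (negPf ij).
  rewrite mulrA -exprD -mulNr /swap_sign; congr (_ * _).
  rewrite [below A j](belowD1 _ iA) -(below_delx (j |: A) i).
  have -> : (j |: A) :\ i = j |: A :\ i.
    by apply/setP => l; rewrite !inE; case: eqP => //= ->; rewrite (negPf ij).
  rewrite (@belowD1 (j |: A :\ i) j i) ?finset.setU11 // finset.setU1K; last first.
    by rewrite !inE negb_and jA orbT.
  (* Of the two counts below, exactly one changes when passing from the facet to [A] or [j |: A], so
     the up and down signs are opposite. *)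
  have : ((i < j) + (j < i) = 1)%N.
    by case: ltngtP => // /val_inj e; rewrite e eqxx in ij.
  move: (below _ i) (below _ j) (i < j)%N (j < i)%N => x y b b' bb.
  have -> : (y + b + (x + b') = (x + y).+1)%N by lia.
  by rewrite exprS mulN1r.
rewrite /laplacian_op [RHS](bigID (mem A)) /= -addrA; congr (_ + _).
  by apply: eq_bigr => j jA; rewrite (finset.setUidPr _) ?finset.sub1set // AK.
rewrite -big_split /=; apply: eq_bigr => j jA.
by case: ifP => _; rewrite ?addr0 // addrC subrK.
Qed.

(** Two distinct swaps would make [j] adjacent to all of [A] except [i1] and to all of [A] except
    [i2], hence to all of [A], and [j |: A] would be a clique. *)
Lemma clique_swap_unique (A : {set 'I_n}) (j i1 i2 : 'I_n) :
  is_clique_complex K -> A \in K -> j |: A \notin K ->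
  swappable A j i1 -> swappable A j i2 -> i1 = i2.
Proof.
move=> [e [esym _ KE]] AK jK /andP[i1A s1] /andP[i2A s2]; apply/eqP.
apply: contraNT jK => i12; rewrite KE inE; apply/forall_inP => x xA.
apply/forall_inP => y yA; apply/implyP => xy.
have KP (B : {set 'I_n}) u v : B \in K -> u \in B -> v \in B -> u != v -> e u v.
  rewrite KE inE => /forall_inP BP uB vB uv.
  by have /forall_inP/(_ v vB)/implyP/(_ uv) := BP u uB.
have jy y' : y' \in A -> y' != j -> e j y'.
  move=> y'A y'j; have [yi|yi] := eqVneq y' i1.
    apply: (KP _ _ _ s2); rewrite ?finset.setU11 1?eq_sym //.
    by rewrite !inE y'A yi i12 orbT.
  apply: (KP _ _ _ s1); rewrite ?finset.setU11 1?eq_sym //.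
  by rewrite !inE y'A yi orbT.
move: xA yA; rewrite !inE => /orP[/eqP xj|xA] /orP[/eqP yj|yA].
- by rewrite xj yj eqxx in xy.
- by rewrite xj jy // -xj eq_sym.
- by rewrite yj esym jy // -yj.
- exact: (KP A).
Qed.

End LaplacianOperator.

(** * Spectrum of the Laplacian and the bias of the trace estimate *)

Section LaplacianSpectrum.
Variables (R : realType) (n : nat) (K : {set {set 'I_n}}) (k : nat).
Hypothesis Kcx : simplicial_complex K.
Let L := laplacian R K k.

Lemma laplacian_sym : L^T = L.
Proof. by rewrite /L /laplacian linearD /= !trmx_mul !trmxK. Qed.

(** Apply the row to the indicator of the face itself: a vertex of the face contributes 1, and no
    vertex contributes a negative amount. *)
Lemma laplacian_diag_ge1 p : 1 <= L p p.
Proof.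
have := @laplacian_opE R n K Kcx k p (fun B => (B == enum_val p)%:R).
rewrite (bigD1 p) //= eqxx mulr1 big1 ?addr0 => [->|q /negPf qp]; last first.
  by rewrite (inj_eq enum_val_inj) qp mulr0.
have [AK cA] : enum_val p \in K /\ #|enum_val p : {set 'I_n}| = k.+1.
  by have := enum_valP p; rewrite inE => /andP[? /eqP].
set A : {set 'I_n} := enum_val p in AK cA *.
have /card_gt0P[j jA] : (0 < #|A|)%N by rewrite cA.
have jAE : j |: A = A by apply/finset.setUidPr; rewrite finset.sub1set.
rewrite /laplacian_op (bigD1 j) //= jAE AK eqxx.
rewrite lerDl sumr_ge0 // => l _; case: ifPn => // lA.
rewrite sumr_ge0 // => i _; case: eqP => [e|]; last by rewrite mulr0.
by case/negP: lA; rewrite -e finset.setUA finset.setUid e.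
Qed.

(** Evaluate the eigenvector equation at an entry of largest modulus: the row has at most n^2 terms
    of coefficient 1 or -1. This keeps L, and with it the search for L and all bit lengths,
    polynomial in n. *)
Lemma laplacian_eigenvalue_le (x : R) : eigenvalue L x -> x <= (n ^ 2)%:R.
Proof.
move=> /eigenvalueP[v vE v0].
have [p vp] : exists p, v 0 p != 0.
  by apply/existsP; apply: contraNT v0 => /existsPn h; apply/eqP/rowP => p;
     rewrite mxE; apply/eqP; rewrite -[_ == _]negbK.
pose p0 := [arg max_(q > p) `|v 0 q|]%O.
have p0max q : `|v 0 q| <= `|v 0 p0| by rewrite /p0; case: arg_maxP => //= i _; apply.
have vp0 : 0 < `|v 0 p0| by apply: lt_le_trans (p0max p); rewrite normr_gt0.
(* [laplacian_op] acts on functions of all sets, so [v] is extended by 0 outside the k-faces. *)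
pose h (B : {set 'I_n}) := if [pick q | enum_val q == B] is Some q then v 0 q else 0.
have hE q : h (enum_val q) = v 0 q.
  rewrite /h; case: pickP => [q' /eqP/enum_val_inj -> //|/(_ q)].
  by rewrite eqxx.
have hb B : `|h B| <= `|v 0 p0|.
  by rewrite /h; case: pickP => [q _|_]; rewrite ?normr0.
have := @laplacian_opE R n K Kcx k p0 h.
have -> : \sum_q laplacian R K k p0 q * h (enum_val q) = x * v 0 p0.
  have /rowP/(_ p0) := vE; rewrite !mxE => <-; apply: eq_bigr => q _.
  by rewrite hE mulrC -/L; congr (_ * _); rewrite -{1}laplacian_sym mxE.
move=> e; rewrite -(ler_pM2r vp0); apply: le_trans (ler_norm _) _.
rewrite normrM normr_id -normrM e /laplacian_op.
apply: le_trans (ler_norm_sum _ _ _) _.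
apply: (@le_trans _ _ (\sum_(j < n) (n%:R * `|v 0 p0|))); last first.
  by rewrite sumr_const card_ord -mulrnAl -mulrnA mulnn.
apply: ler_sum => j _; case: ifP => _.
  by apply: le_trans (hb _) _; rewrite ler_peMl // ler1n; case: (n) j => // -[].
apply: le_trans (ler_norm_sum _ _ _) _.
apply: (@le_trans _ _ (\sum_(i < n) `|v 0 p0|)); last first.
  by rewrite sumr_const card_ord mulr_natl.
rewrite big_mkcond; apply: ler_sum => i _; case: ifP => // _.
by rewrite /swap_sign normrM normr_sign mul1r.
Qed.

(** The trace is at least d_k and at most d_k times the largest eigenvalue. The bound makes it
    harmless to round L up to an integer. *)
Lemma laplacian_largest_ge1 (l : R) :
  (0 < #|faces K k|)%N -> is_largest_eigenvalue L l -> 1 <= l.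
Proof.
move=> d0 [_ lmax]; have [v [vev _ trv _]] := spectral_real laplacian_sym.
rewrite -(@ler_pM2l _ #|faces K k|%:R) ?ltr0n // mulr1.
apply: (@le_trans _ _ (\tr L)).
  have -> : #|faces K k|%:R = \sum_(p < #|faces K k|) (1 : R).
    by rewrite sumr_const card_ord.
  by apply: ler_sum => i _; rewrite laplacian_diag_ge1.
have -> : #|faces K k|%:R * l = \sum_(p < #|faces K k|) l.
  by rewrite sumr_const card_ord mulr_natl.
by rewrite trv; apply: ler_sum => i _; exact: lmax.
Qed.

(** Each zero eigenvalue contributes exactly V_m(y), which accounts for the Betti number. Any other
    eigenvalue of Y lies in [0, 1] and contributes at most 3/2, and V_m(y) >= 2^s / 2. *)
Lemma chebV_trace_estimate (lmax gap : R) (l g s : nat) :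
  (0 < #|faces K k|)%N -> (0 < l)%N -> (0 < g)%N ->
  is_largest_eigenvalue L lmax -> is_spectral_gap L gap ->
  lmax <= l%:R -> l%:R <= gap * (2 * g * g.+1)%:R ->
  forall y0, y0 = 1 + (2 * g * g.+1)%:R^-1 ->
  `| \tr (chebV (y0%:M - l%:R^-1 *: L) (g * s)) / (#|faces K k|%:R * chebV y0 (g * s))
     - (betti R K k)%:R / #|faces K k|%:R | <= 3 / (2 ^ s)%:R.
Proof.
move=> d0 l0 g0 [_ lmaxP] [_ _ gapP] lmaxl lgap y0 y0E.
have [v [vev rv _ ->]] := spectral_real laplacian_sym.
have grow : (2 ^ s)%:R / 2 <= chebV y0 (g * s).
  by rewrite y0E; exact: chebV_growth.
set V := chebV y0 _ in grow *; set d := #|_| in d0 v vev rv *.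
have s0 : 0 < (2 ^ s)%:R :> R by rewrite ltr0n expn_gt0.
have V0 : 0 < V by apply: lt_le_trans grow; rewrite divr_gt0.
have dR : 0 < d%:R :> R by rewrite ltr0n.
rewrite /betti -/L rv invfM mulrA mulrAC -mulrBl normrM (gtr0_norm (x := d%:R^-1)) ?invr_gt0 //.
rewrite ler_pdivrMr //.
have -> : #|[pred i | v i == 0]|%:R = (\sum_(i | v i == 0) V) / V.
  by rewrite sumr_const -[V *+ _]mulr_natl mulfK // gt_eqF.
rewrite -mulrBl normrM (gtr0_norm (x := V^-1)) ?invr_gt0 // ler_pdivrMr //.
rewrite (bigID (fun i => v i == 0)) /=.
rewrite (eq_bigr (fun=> V)) => [|i /eqP ->]; last by rewrite mulr0 subr0.
rewrite addrAC subrr add0r; apply: le_trans (ler_norm_sum _ _ _) _.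
apply: (@le_trans _ _ (\sum_(i < d) (3 / 2))).
  rewrite big_mkcond /=; apply: ler_sum => i _; case: ifP => [vi|_].
    have lR : 0 < l%:R :> R by rewrite ltr0n.
    have DR : 0 < (2 * g * g.+1)%:R :> R by rewrite ltr0n !muln_gt0 g0.
    have h1 : l%:R^-1 * v i <= 1.
      by rewrite mulrC ler_pdivrMr // mul1r (le_trans (lmaxP _ (vev i))).
    have h2 : (2 * g * g.+1)%:R^-1 <= l%:R^-1 * v i.
      rewrite mulrC ler_pdivlMr // mulrC ler_pdivrMr //.
      apply: le_trans lgap _; rewrite ler_pM2r //; exact: gapP.
    have DI : 0 < (2 * g * g.+1)%:R^-1 :> R by rewrite invr_gt0.
    rewrite y0E; move: DI h1 h2; move: (l%:R^-1 * v i) (_%:R^-1) => x z DI h1 h2.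
    by apply: chebV_bound; lra.
  by rewrite divr_ge0.
rewrite sumr_const card_ord -[_ *+ d]mulr_natl mulrAC [leRHS]mulrC ler_pM2l //.
rewrite [leRHS]mulrAC ler_pdivlMr //; move: grow; move: (_ %:R) => S; lra.
Qed.
End LaplacianSpectrum.

(** * Finitely supported distributions *)

Section Distributions.
Variable R : realType.

Definition dmap (T U : Type) (f : T -> U) (D : dist R T) : dist R U :=
  [seq (p.1, f p.2) | p <- D].

Definition Ex (T : Type) (D : dist R T) (f : T -> R) : R :=
  \sum_(p <- D) p.1 * f p.2.

(** Quantifies over every listed outcome, whatever its weight, as the guarantees on time and space
    do. *)
Fixpoint dall (T : Type) (P : T -> Prop) (D : dist R T) : Prop :=
  if D is p :: D' then P p.2 /\ dall P D' else True.

Fixpoint diter (T : Type) (r : nat) (step : T -> dist R T) (x : T) : dist R T :=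
  if r is r'.+1 then dbind (step x) (diter r' step) else dret R x.

Definition probability_dist (T : Type) (D : dist R T) : Prop :=
  all (fun p => 0 <= p.1) D /\ Ex D (fun=> 1) = 1.

Lemma dbind_cons (T U : Type) (p : R * T) D (k : T -> dist R U) :
  dbind (p :: D) k = [seq (p.1 * q.1, q.2) | q <- k p.2] ++ dbind D k.
Proof. by []. Qed.

Lemma dbind_ret (T U : Type) (x : T) (k : T -> dist R U) :
  dbind (dret R x) k = k x.
Proof.
rewrite /dret dbind_cons /= /dbind /= cats0 -[RHS]map_id; apply: eq_map => -[w y].
by rewrite mul1r.
Qed.

Lemma dmap_ret (T U : Type) (f : T -> U) x : dmap f (dret R x) = dret R (f x).
Proof. by []. Qed.

Lemma dmap_comp (T U V : Type) (f : U -> V) (g : T -> U) D :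
  dmap f (dmap g D) = dmap (f \o g) D.
Proof. by rewrite /dmap -map_comp. Qed.

Lemma eq_dmap (T U : Type) (f g : T -> U) D : f =1 g -> dmap f D = dmap g D.
Proof. by move=> fg; apply: eq_map => p; rewrite fg. Qed.

Lemma dmap_bind (T U V : Type) (f : U -> V) (k : T -> dist R U) D :
  dmap f (dbind D k) = dbind D (fun x => dmap f (k x)).
Proof.
elim: D => //= p D IH; rewrite !dbind_cons -IH /dmap map_cat -!map_comp.
by congr (_ ++ _); apply: eq_map.
Qed.

Lemma dbind_map (T U V : Type) (f : T -> U) (k : U -> dist R V) D :
  dbind (dmap f D) k = dbind D (fun x => k (f x)).
Proof. by elim: D => //= p D IH; rewrite !dbind_cons IH. Qed.

Lemma dmapE (T U : Type) (f : T -> U) D : dmap f D = dbind D (fun x => dret R (f x)).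
Proof. by elim: D => //= p D IH; rewrite dbind_cons -IH /= mulr1. Qed.

Lemma diter_ret (T : Type) r (f : T -> T) x :
  diter r (fun y => dret R (f y)) x = dret R (iter r f x).
Proof. by elim: r x => //= r IH x; rewrite dbind_ret IH -iterSr iterS. Qed.

Lemma dall_cat (T : Type) P (D1 D2 : dist R T) :
  dall P (D1 ++ D2) <-> dall P D1 /\ dall P D2.
Proof. by elim: D1 => /= [|p D1 IH]; tauto. Qed.

Lemma dall_impl (T : Type) (P Q : T -> Prop) D :
  (forall x, P x -> Q x) -> dall P D -> dall Q D.
Proof. by move=> PQ; elim: D => //= p D IH [/PQ ? /IH]. Qed.

Lemma dall_and (T : Type) (P Q : T -> Prop) D :
  dall P D -> dall Q D -> dall (fun x => P x /\ Q x) D.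
Proof. by elim: D => //= p D IH [? ?] [? ?]; split; last apply: IH. Qed.

Lemma dall_true (T : Type) (P : T -> Prop) D : (forall x, P x) -> dall P D.
Proof. by move=> h; elim: D => //= p D IH; split. Qed.

Lemma dall_map (T U : Type) (f : T -> U) P D :
  dall P (dmap f D) <-> dall (fun x => P (f x)) D.
Proof. by elim: D => //= p D IH; tauto. Qed.

Lemma dall_bind (T U : Type) (k : T -> dist R U) P D :
  dall P (dbind D k) <-> dall (fun x => dall P (k x)) D.
Proof.
elim: D => //= p D IH; rewrite dbind_cons dall_cat IH.
suff -> : dall P [seq (p.1 * q.1, q.2) | q <- k p.2] <-> dall P (k p.2) by [].
by elim: (k p.2) => //= q D' IH'; tauto.
Qed.

Lemma dall_uniform (T : eqType) (P : T -> Prop) s :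
  (forall x, x \in s -> P x) -> dall P (uniform R s).
Proof.
move=> h; rewrite /uniform; move: (_^-1) => w; elim: s h => //= x s IH h.
split; first by apply: h; rewrite mem_head.
by apply: IH => y ys; apply: h; rewrite inE ys orbT.
Qed.

Lemma dall_iter (T : Type) (P : nat -> T -> Prop) (step : T -> dist R T) r x :
  (forall r x, P r.+1 x -> dall (P r) (step x)) -> P r x -> dall (P 0%N) (diter r step x).
Proof.
move=> h; elim: r x => [|r IH] x Px /=; first by split.
by apply/dall_bind; apply: dall_impl IH (h _ _ Px).
Qed.

Lemma dall_mem (T : eqType) (P : T -> Prop) (D : dist R T) p x :
  dall P D -> (p, x) \in D -> P x.
Proof.
elim: D => //= q D IH [Pq PD]; rewrite inE => /orP[/eqP e|]; last exact: IH.
by rewrite -e in Pq.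
Qed.

(** As the support is finite, one amount of fuel suffices for all outcomes. *)
Lemma dall_eventually (T : Type) (Q : nat -> T -> Prop) D :
  dall (fun x => exists f0, forall f, (f0 <= f)%N -> Q f x) D ->
  exists f0, forall f, (f0 <= f)%N -> dall (Q f) D.
Proof.
elim: D => [|p D IH] /=; first by exists 0%N.
move=> [[f1 h1] /IH[f2 h2]]; exists (maxn f1 f2) => f.
by rewrite geq_max => /andP[? ?]; split; [apply: h1|apply: h2].
Qed.

Lemma Ex_ret (T : Type) (x : T) f : Ex (dret R x) f = f x.
Proof. by rewrite /Ex big_seq1 mul1r. Qed.

Lemma Ex_map (T U : Type) (g : T -> U) D f : Ex (dmap g D) f = Ex D (fun x => f (g x)).
Proof. by rewrite /Ex big_map. Qed.

Lemma Ex_bind (T U : Type) (k : T -> dist R U) D f :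
  Ex (dbind D k) f = Ex D (fun x => Ex (k x) f).
Proof.
elim: D => [|p D IH]; first by rewrite /Ex !big_nil.
rewrite dbind_cons /Ex big_cat big_cons /=; congr (_ + _); last exact: IH.
by rewrite big_map /= big_distrr /=; apply: eq_bigr => q _; rewrite mulrA.
Qed.

Lemma Ex_uniform (T : Type) (s : seq T) f :
  Ex (uniform R s) f = (size s)%:R^-1 * \sum_(x <- s) f x.
Proof. by rewrite /Ex big_map big_distrr. Qed.

Lemma eq_Ex (T : Type) (D : dist R T) f g : f =1 g -> Ex D f = Ex D g.
Proof. by move=> fg; apply: eq_bigr => p _; rewrite fg. Qed.

Lemma eq_Ex_dall (T : Type) (P : T -> Prop) (D : dist R T) f g :
  dall P D -> (forall x, P x -> f x = g x) -> Ex D f = Ex D g.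
Proof.
move=> + fg; rewrite /Ex; elim: D => [|p D IH]; first by rewrite !big_nil.
by move=> /= [/fg e /IH]; rewrite !big_cons e => ->.
Qed.

Lemma ExD (T : Type) (D : dist R T) f g :
  Ex D (fun x => f x + g x) = Ex D f + Ex D g.
Proof. by rewrite /Ex -big_split /=; apply: eq_bigr => p _; rewrite mulrDr. Qed.

Lemma ExZ (T : Type) (D : dist R T) c f : Ex D (fun x => c * f x) = c * Ex D f.
Proof. by rewrite /Ex big_distrr /=; apply: eq_bigr => p _; rewrite mulrCA. Qed.

Lemma Ex_cst (T : Type) (D : dist R T) c :
  probability_dist D -> Ex D (fun=> c) = c.
Proof.
move=> [_ D1]; rewrite -[RHS]mulr1 -D1 -ExZ; apply: eq_Ex => x.
by rewrite mulr1.
Qed.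

Lemma le_Ex (T : Type) (P : T -> Prop) (D : dist R T) f g :
  probability_dist D -> dall P D -> (forall x, P x -> f x <= g x) ->
  Ex D f <= Ex D g.
Proof.
move=> [+ _] + fg; rewrite /Ex; elim: D => [|p D IH].
  by rewrite !big_nil.
move=> /= /andP[p0 D0] [/fg h /(IH D0) IH']; rewrite !big_cons.
by apply: lerD => //; apply: ler_wpM2l.
Qed.

Lemma probability_ret (T : Type) (x : T) : probability_dist (dret R x).
Proof. by split; [rewrite /= ler01|rewrite Ex_ret]. Qed.

Lemma probability_map (T U : Type) (f : T -> U) D :
  probability_dist D -> probability_dist (dmap f D).
Proof. by move=> [D0 D1]; split; [rewrite all_map|rewrite Ex_map]. Qed.

Lemma probability_bind (T U : Type) (P : T -> Prop) (k : T -> dist R U) D :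
  probability_dist D -> dall P D -> (forall x, P x -> probability_dist (k x)) ->
  probability_dist (dbind D k).
Proof.
move=> [D0 D1] DP kp; split; last first.
  by rewrite Ex_bind -[RHS]D1; apply: eq_Ex_dall DP _ => x /kp[].
elim: D D0 DP {D1} => //= p D IH /andP[p0 D0] [/kp[k0 _] DP].
rewrite dbind_cons all_cat IH // andbT all_map.
by apply: sub_all k0 => q q0 /=; apply: mulr_ge0.
Qed.

Lemma probability_uniform (T : Type) (s : seq T) :
  (0 < size s)%N -> probability_dist (uniform R s).
Proof.
move=> s0; split.
  rewrite /uniform; move: (size s) => m; elim: s {s0} => //= x s ->.
  by rewrite invr_ge0 ler0n.
rewrite Ex_uniform big_const_seq count_predT iter_addr_0 mulVf //.
by rewrite pnatr_eq0 -lt0n.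
Qed.

Lemma probability_iter (T : Type) (P : nat -> T -> Prop) (step : T -> dist R T) r x :
  (forall r x, P r.+1 x -> probability_dist (step x) /\ dall (P r) (step x)) ->
  P r x -> probability_dist (diter r step x).
Proof.
move=> h; elim: r x => [|r IH] x Px; first exact: probability_ret.
by have [sp sP] := h _ _ Px; apply: probability_bind sp sP IH.
Qed.

Lemma PrE (T : Type) (Q : T -> bool) (D : dist R T) :
  Pr Q D = Ex D (fun x => (Q x)%:R).
Proof.
rewrite /Pr /Ex big_mkcond; apply: eq_bigr => p _.
by case: (Q _); rewrite ?mulr1 ?mulr0.
Qed.

(** Pointwise, 1 - (f x - m)^2 / t^2 is at most the indicator of the event; take expectations. *)
Lemma Pr_chebyshev (T : Type) (D : dist R T) (f : T -> R) (m t v : R) :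
  probability_dist D -> 0 < t ->
  Ex D (fun x => (f x - m) ^+ 2) <= v ->
  1 - v / t ^+ 2 <= Pr (fun x => `|f x - m| <= t) D.
Proof.
move=> Dp t0 hv; have t2 : 0 < t ^+ 2 by rewrite exprn_gt0.
apply: (@le_trans _ _ (1 - Ex D (fun x => (f x - m) ^+ 2) / t ^+ 2)).
  by rewrite lerB // ler_pM2r ?invr_gt0.
rewrite PrE -[X in X - _](Ex_cst 1 Dp) mulrC -ExZ -mulN1r -ExZ -ExD.
apply: (@le_Ex _ (fun=> True)) => //; first exact: dall_true.
move=> x _; case: (lerP `|f x - m| t) => h /=.
  by rewrite mulN1r gerDl oppr_le0 mulr_ge0 ?sqr_ge0 // invr_ge0 ltW.
rewrite mulN1r subr_le0 mulrC ler_pdivlMr // mul1r -[leRHS]real_normK ?num_real //.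
by rewrite ler_pXn2r ?nnegrE ?normr_ge0 // ltW.
Qed.

End Distributions.

(** * A program logic with bounds on cells, time and space *)

(** When all cells have at most b bits, [expr_weight e * b] bounds both the bit length of the value
    of [e] and the cost of evaluating it. The factor 2 pays for writing the result of an operation,
    which is no longer than its operands together. *)
Fixpoint expr_weight (e : expr) : nat :=
  match e with
  | Cst c => bits c
  | Cell e1 => (expr_weight e1).+1
  | Bin _ e1 e2 => 2 * (expr_weight e1 + expr_weight e2)
  end%N.

Fixpoint cmd_weight (c : cmd) : nat :=
  match c with
  | Skip => 0
  | Store d e | Rand d e | Member d e => expr_weight d + expr_weight e
  | Seq c1 c2 => cmd_weight c1 + cmd_weight c2
  | If e c1 c2 => expr_weight e + (cmd_weight c1 + cmd_weight c2)
  | While e c1 => expr_weight e + cmd_weight c1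
  | SampleFace d => expr_weight d
  | Compare d _ e1 e2 => expr_weight d + (expr_weight e1 + expr_weight e2)
  end%N.

Lemma bits_gt0 v : (0 < bits v)%N. Proof. by []. Qed.

Lemma ltn_exp2_bits v : (v < 2 ^ bits v)%N.
Proof. by rewrite /bits trunc_log_ltn. Qed.

Lemma bits_leq v b : (0 < b)%N -> (v < 2 ^ b)%N -> (bits v <= b)%N.
Proof.
move=> b0 vb; rewrite /bits; case: v vb => [|v] vb; first by rewrite trunc_log0.
rewrite -(@ltn_exp2l 2) //; apply: leq_ltn_trans vb.
by rewrite trunc_logP.
Qed.

Lemma bits_binop o x y : (bits (eval_binop o x y) <= bits x + bits y)%N.
Proof.
have b0 : (0 < bits x + bits y)%N by rewrite addn_gt0 bits_gt0.
have hx : (bits x <= bits x + bits y)%N by rewrite leq_addr.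
have lx z : (z <= x)%N -> (bits z <= bits x + bits y)%N.
  move=> zx; apply: leq_trans hx; apply: bits_leq => //.
  exact: leq_ltn_trans zx (ltn_exp2_bits x).
have := ltn_exp2_bits x; have := ltn_exp2_bits y.
case: o => /= hby hbx; [|exact/lx/leq_subr| |exact/lx/leq_div|exact/lx/leq_mod].
  apply: bits_leq => //; rewrite expnD.
  have x1 : (1 < 2 ^ bits x)%N by rewrite -{1}(expn0 2) ltn_exp2l.
  have y1 : (1 < 2 ^ bits y)%N by rewrite -{1}(expn0 2) ltn_exp2l.
  move: (2 ^ bits x)%N (2 ^ bits y)%N hby hbx x1 y1 => X Y; nia.
by apply: bits_leq => //; rewrite expnD ltn_mul.
Qed.

Section ProgramLogic.
Variables (R : realType) (E : environment R).
(* All memory cells stay below [2 ^ b], at most [cells] cells are used, and [W]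
   bounds the weight of the expressions of the program. *)
Variables (b cells W : nat).
Hypothesis b0 : (0 < b)%N.
Hypothesis nb : (env_n E <= b)%N.

(** The three terms [W * b] cover the two operands and the address of a comparison, the further [b]
    the value stored, and 1 the successor in [step]. *)
Definition step_cost : nat :=
  (3 * (W * b) + b + env_sample_cost E + env_member_cost E + 1)%N.

Definition space_cost : nat := (cells * b.+1 + step_cost)%N.

Definition bounded (m : seq nat) : bool :=
  (size m <= cells)%N && all (fun v => v < 2 ^ b)%N m.

(* [D] is the distribution of the final memory and [N] the number of steps. *)
Definition spec (c : cmd) (m : seq nat) (N : nat) (D : dist R (seq nat)) : Prop :=
  (cmd_weight c <= W)%N -> bounded m ->
  exists f0, forall f, (f0 <= f)%N -> forall t p,
  exists D2 : dist R state,
    [/\ exec E f c (m, t, p) = dmap Some D2, dmap memory D2 = D &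
        dall (fun s => bounded (memory s) /\ (run_time s <= t + N * step_cost)%N
                       /\ (peak_space s <= maxn p space_cost)%N) D2].

Lemma bounded_nth m i : bounded m -> (nth 0%N m i < 2 ^ b)%N.
Proof.
move=> /andP[_ mb]; have [im|im] := ltnP i (size m); last first.
  by rewrite nth_default // expn_gt0.
exact: (allP mb) (mem_nth _ im).
Qed.

Lemma bounded_set m i v : bounded m -> (i < cells)%N -> (v < 2 ^ b)%N ->
  bounded (set_nth 0%N m i v).
Proof.
move=> /andP[mS mb] iS vb; rewrite /bounded size_set_nth geq_max iS mS /=.
apply/allP => x /(nthP 0%N)[j _ <-]; rewrite nth_set_nth /=.
by case: eqP => // _; apply: bounded_nth; rewrite /bounded mS mb.
Qed.

Lemma memory_size_le m : bounded m -> (memory_size m <= cells * b.+1)%N.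
Proof.
move=> /andP[mS /allP mb]; rewrite /memory_size big_seq.
apply: (@leq_trans (\sum_(v <- m | v \in m) b.+1)).
  by apply: leq_sum => v /mb vb; rewrite ltnS bits_leq.
by rewrite -big_seq big_const_seq count_predT iter_addn_0 mulnC leq_mul2r mS orbT.
Qed.

Lemma eval_expr_bits m e : bounded m ->
  (bits (eval_expr m e) <= expr_weight e * b)%N.
Proof.
move=> mb; elim: e => [c|e1 IH|o e1 IH1 e2 IH2] /=.
- by rewrite leq_pmulr.
- apply: (@leq_trans b); last by rewrite mulSn leq_addr.
  by apply: bits_leq => //; exact: bounded_nth.
- apply: leq_trans (bits_binop _ _ _) _.
  by rewrite -mulnA mulnDl; apply: leq_trans (leq_add IH1 IH2) _; rewrite leq_pmull.
Qed.

Lemma eval_cost_le m e : bounded m -> (eval_cost m e <= expr_weight e * b)%N.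
Proof.
move=> mb; elim: e => [c|e1 IH|o e1 IH1 e2 IH2] /=.
- by rewrite leq_pmulr.
- rewrite mulSn addnC; apply: leq_add => //.
  by apply: bits_leq => //; exact: bounded_nth.
- have h := leq_add IH1 IH2; have := bits_binop o (eval_expr m e1) (eval_expr m e2).
  have := eval_expr_bits e1 mb; have := eval_expr_bits e2 mb.
  rewrite -mulnA mulnDl; move: h; lia.
Qed.

Lemma eval_cost_weight m e : bounded m -> (expr_weight e <= W)%N ->
  (eval_cost m e <= W * b)%N.
Proof.
by move=> mb eW; apply: leq_trans (eval_cost_le e mb) _; rewrite leq_mul2r eW orbT.
Qed.

Lemma spec_weaken c m N N' D : (N <= N')%N -> spec c m N D -> spec c m N' D.
Proof.
move=> NN h cW mb; have [f0 hf] := h cW mb; exists f0 => f /hf hf' t p.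
have [D2 [e1 e2 hD]] := hf' t p; exists D2; split=> //.
apply: dall_impl hD => s [? [ht ?]]; split=> //; split=> //.
by apply: leq_trans ht _; rewrite leq_add2l leq_mul2r NN orbT.
Qed.

Lemma spec_skip m : spec Skip m 1 (dret R m).
Proof.
move=> _ mb; exists 1%N => -[//|f] _ t p; exists (dret R (step (m, t, p) 0 m)).
split=> //=; split=> //; split=> //; split; rewrite /run_time /peak_space /=.
  by rewrite mul1n leq_add2l /step_cost addn1.
rewrite geq_max leq_maxl /= (leq_trans _ (leq_maxr _ _)) // /space_cost.
by rewrite leq_add ?memory_size_le // /step_cost addn1.
Qed.

Lemma spec_step_ret (c : cmd) m (T : Type) (g : T -> seq nat) (D : dist R T) (cost : T -> nat) :
  (forall f t p, exec E f.+1 c (m, t, p) =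
     dmap (fun y => Some (step (m, t, p) (cost y) (g y))) D) ->
  dall (fun y => bounded (g y) /\ (cost y < step_cost)%N) D ->
  exists f0, forall f, (f0 <= f)%N -> forall t p,
  exists D2 : dist R state,
    [/\ exec E f c (m, t, p) = dmap Some D2, dmap memory D2 = dmap g D &
        dall (fun s => bounded (memory s) /\ (run_time s <= t + 1 * step_cost)%N
                       /\ (peak_space s <= maxn p space_cost)%N) D2].
Proof.
move=> ex hD; exists 1%N => -[//|f] _ t p.
exists (dmap (fun y => step (m, t, p) (cost y) (g y)) D); split.
- by rewrite ex dmap_comp.
- by rewrite dmap_comp; apply: eq_dmap.
apply/dall_map; apply: dall_impl hD => y [gb hc]; split=> //; split.
  by rewrite /run_time /= mul1n leq_add2l.
rewrite /peak_space /= geq_max leq_maxl /= (leq_trans _ (leq_maxr _ _)) //.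
by rewrite /space_cost leq_add ?memory_size_le.
Qed.

Lemma spec_store i e m : (i < cells)%N -> (eval_expr m e < 2 ^ b)%N ->
  spec (Store (Cst i) e) m 1 (dret R (set_nth 0%N m i (eval_expr m e))).
Proof.
move=> iS vb /= cW mb.
apply: (@spec_step_ret _ m nat (fun v => set_nth 0%N m i v) (dret R (eval_expr m e))
  (fun v => eval_cost m e + bits i + bits v)%N) => //=.
split=> //; split; first exact: bounded_set.
have h1 := @eval_cost_weight m e mb (leq_trans (leq_addl _ _) cW).
have h2 := @eval_cost_weight m (Cst i) mb (leq_trans (leq_addr _ _) cW).
by have := bits_leq b0 vb; move: h1 h2; rewrite /step_cost /=; lia.
Qed.

Lemma spec_rand i e m : (i < cells)%N -> (0 < eval_expr m e <= 2 ^ b)%N ->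
  spec (Rand (Cst i) e) m 1
    (dmap (fun v => set_nth 0%N m i v) (uniform R (iota 0 (eval_expr m e)))).
Proof.
move=> iS /andP[v0 vb] /= cW mb.
apply: (@spec_step_ret _ m nat (fun v => set_nth 0%N m i v) _
  (fun v => eval_cost m e + bits i + bits v)%N) => /=.
  by move=> f t p; rewrite (maxn_idPr v0) dmapE.
apply: dall_uniform => v; rewrite mem_iota add0n => /andP[_ vlt].
have {}vlt := leq_trans vlt vb.
split; first exact: bounded_set.
have h1 := @eval_cost_weight m e mb (leq_trans (leq_addl _ _) cW).
have h2 := @eval_cost_weight m (Cst i) mb (leq_trans (leq_addr _ _) cW).
by have := bits_leq b0 vlt; move: h1 h2; rewrite /step_cost /=; lia.
Qed.

Lemma encode_lt n (A : {set 'I_n}) : (encode A < 2 ^ n)%N.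
Proof.
have lt m : (\sum_(i < m) 2 ^ i < 2 ^ m)%N.
  elim: m => [|m IH]; first by rewrite big_ord0.
  by rewrite big_ord_recr /= expnS mul2n -addnn -addSn leq_add2r.
apply: leq_ltn_trans (lt n); rewrite /encode big_mkcond /=.
by apply: leq_sum => i _; case: ifP.
Qed.

Lemma spec_sample i m : (i < cells)%N ->
  spec (SampleFace (Cst i)) m 1
    (dmap (fun A => set_nth 0%N m i (encode A))
       (uniform R (enum (faces (env_complex E) (env_dim E))))).
Proof.
move=> iS /= cW mb.
apply: (@spec_step_ret _ m _ (fun A => set_nth 0%N m i (encode A)) _
  (fun A => env_sample_cost E + bits i + bits (encode A))%N) => /=.
  by move=> f t p; rewrite dmapE.
apply: dall_uniform => A _.
have vlt : (encode A < 2 ^ b)%N.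
  by apply: leq_trans (encode_lt A) _; rewrite leq_exp2l.
split; first exact: bounded_set.
have h2 := @eval_cost_weight m (Cst i) mb cW.
by have := bits_leq b0 vlt; move: h2; rewrite /step_cost /=; lia.
Qed.

Lemma bool_lt (x : bool) : (x < 2 ^ b)%N.
Proof.
by apply: (@leq_trans 2); [case: x|rewrite -{1}(expn1 2) leq_exp2l].
Qed.

Lemma spec_member i e m : (i < cells)%N ->
  spec (Member (Cst i) e) m 1 (dret R (set_nth 0%N m i
    (Defs.decode (env_n E) (eval_expr m e) \in env_complex E))).
Proof.
move=> iS /= cW mb.
set v : nat := _ \in _.
apply: (@spec_step_ret _ m nat (fun v => set_nth 0%N m i v) (dret R v)
  (fun v => eval_cost m e + env_member_cost E + bits i + bits v)%N) => //=.
split=> //; split; first by apply: bounded_set => //; exact: bool_lt.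
have h1 := @eval_cost_weight m e mb (leq_trans (leq_addl _ _) cW).
have h2 := @eval_cost_weight m (Cst i) mb (leq_trans (leq_addr _ _) cW).
by have := bits_leq b0 (bool_lt _ : v < 2 ^ b)%N; move: h1 h2; rewrite /step_cost /=; lia.
Qed.

Lemma spec_compare i p e1 e2 m : (i < cells)%N ->
  spec (Compare (Cst i) p e1 e2) m 1 (dret R (set_nth 0%N m i
    ((eval_expr m e1)%:R <= (eval_expr m e2)%:R * env_param E p))).
Proof.
move=> iS /= cW mb.
set v : nat := (_ <= _)%R.
apply: (@spec_step_ret _ m nat (fun v => set_nth 0%N m i v) (dret R v)
  (fun v => eval_cost m e1 + eval_cost m e2 + bits i + bits v)%N) => //=.
split=> //; split; first by apply: bounded_set => //; exact: bool_lt.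
have [cW1 cW2] : (expr_weight e1 <= W /\ expr_weight e2 <= W)%N.
  have cW' := leq_trans (leq_addl _ _) cW.
  by split; apply: leq_trans cW'; rewrite ?leq_addr ?leq_addl.
have h1 := eval_cost_weight mb cW1.
have h2 := eval_cost_weight mb cW2.
have h3 := @eval_cost_weight m (Cst i) mb (leq_trans (leq_addr _ _) cW).
have := bits_leq b0 (bool_lt _ : v < 2 ^ b)%N; move: h1 h2 h3.
by rewrite /step_cost /=; lia.
Qed.

(** The states in [D2] carry time and space, which [D] forgets; the equality of memories aligns the
    two lists item by item, and they are traversed in parallel. *)
Lemma bind_states (T : Type) (D : dist R T) (g : T -> seq nat)
    (k : T -> dist R (seq nat)) (D2 : dist R state)
    (F : state -> dist R (option state)) (P Q : state -> Prop) :
  dmap memory D2 = dmap g D ->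
  dall P D2 ->
  dall (fun y => forall s, P s -> memory s = g y -> exists D3 : dist R state,
     [/\ F s = dmap Some D3, dmap memory D3 = k y & dall Q D3]) D ->
  exists D4 : dist R state,
    [/\ dbind D2 F = dmap Some D4, dmap memory D4 = dbind D k & dall Q D4].
Proof.
elim: D D2 => [|[w y] D IH] [|[w' s] D2] //=; first by exists [::].
move=> [-> ms e2] [Ps PD2] [hy hD]; have [D4 [F4 M4 Q4]] := IH _ e2 PD2 hD.
have [D3 [F3 M3 Q3]] := hy s Ps ms.
exists ([seq (w * q.1, q.2) | q <- D3] ++ D4); split.
- rewrite dbind_cons F4 /= F3 /dmap map_cat -!map_comp.
  by congr (_ ++ _); apply: eq_map.
- rewrite dbind_cons /dmap map_cat -[map _ D4]/(dmap memory D4) M4 /= -M3 -!map_comp.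
  by congr (_ ++ _); apply: eq_map.
- apply/dall_cat; split=> //; elim: D3 Q3 {F3 M3} => //= q D3 IH3 [? /IH3 ?].
  by split.
Qed.

(** Common core of the rules for sequences and loops. A loop first evaluates its guard, which is
    charged as [N0] steps. *)
Lemma spec_bind (T : Type) (c1 c2 c : cmd) m N0 N1 N2 N (g : T -> seq nat)
    (D : dist R T) k :
  (cmd_weight c <= W -> cmd_weight c1 <= W /\ cmd_weight c2 <= W)%N ->
  (forall f t p, (t, p) = (run_time (m, t, p), peak_space (m, t, p)) ->
     exists t' p', exec E f.+1 c (m, t, p) =
      dbind (exec E f c1 (m, t', p'))
        (fun o => if o is Some s then exec E f c2 s else dret R None) /\
      ((t' <= t + N0 * step_cost)%N /\
       (bounded m -> p' <= maxn p space_cost)%N)) ->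
  spec c1 m N1 (dmap g D) ->
  dall (fun y => spec c2 (g y) N2 (k y)) D ->
  (N0 + N1 + N2 <= N)%N ->
  spec c m N (dbind D k).
Proof.
move=> cW12 ex h1 h2 NN cW mb; have [c1W c2W] := cW12 cW.
have [f1 hf1] := h1 c1W mb.
have gb : dall (fun y => bounded (g y)) D.
  have [D2 [_ e2 hD]] := hf1 f1 (leqnn _) 0%N 0%N.
  apply/(dall_map g bounded); rewrite -e2; apply/dall_map.
  by apply: dall_impl hD => s [].
have [f2 hf2] : exists f0, forall f, (f0 <= f)%N -> dall (fun y =>
    forall t p, exists D2 : dist R state,
    [/\ exec E f c2 (g y, t, p) = dmap Some D2, dmap memory D2 = k y &
        dall (fun s => bounded (memory s) /\ (run_time s <= t + N2 * step_cost)%N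
                       /\ (peak_space s <= maxn p space_cost)%N) D2]) D.
  apply: (@dall_eventually R T (fun f y => forall t p, exists D2, _)).
  by apply: dall_impl (dall_and h2 gb) => y [hy yb]; exact: hy c2W yb.
exists (maxn f1 f2).+1 => -[//|f]; rewrite ltnS geq_max => /andP[ff1 ff2] t p.
have [t' [p' [-> [ht hp]]]] := ex f t p erefl.
have [D2 [-> e2 hD]] := hf1 f ff1 t' p'.
rewrite dbind_map.
apply: (bind_states e2 hD); apply: dall_impl (hf2 f ff2) => y hy s.
move=> [sb [st sp]] sg; have [D3 [e3 e3' hD3]] := hy (run_time s) (peak_space s).
exists D3; split=> //; first by rewrite -e3 -sg /memory /run_time /peak_space -!surjective_pairing.
apply: dall_impl hD3 => s' [? [st' sp']]; split=> //; split.
  apply: leq_trans st' _; apply: leq_trans (leq_add st (leqnn _)) _.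
  have := leq_mul NN (leqnn step_cost); rewrite !mulnDl; move: ht; lia.
have hp' := hp mb; move: sp sp' hp'; rewrite !leq_max; lia.
Qed.

Lemma spec_seq (T : Type) (g : T -> seq nat) (D : dist R T) k c1 c2 m N1 N2 :
  spec c1 m N1 (dmap g D) -> dall (fun y => spec c2 (g y) N2 (k y)) D ->
  spec (Seq c1 c2) m (N1 + N2) (dbind D k).
Proof.
move=> h1 h2; apply: (@spec_bind T c1 c2 _ m 0 N1 N2 _ g) => //.
- by move=> /=; lia.
- by move=> f t p _; exists t, p; rewrite leq_maxl leq_addr.
Qed.

Lemma spec_seq_det c1 c2 m m' N1 N2 D :
  spec c1 m N1 (dret R m') -> spec c2 m' N2 D -> spec (Seq c1 c2) m (N1 + N2) D.
Proof.
move=> h1 h2; rewrite -[D](dbind_ret tt (fun=> D)).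
exact: (@spec_seq unit (fun=> m') (dret R tt)).
Qed.

Lemma step_costs m t p e : bounded m -> (expr_weight e <= W)%N ->
  (run_time (step (m, t, p) (eval_cost m e) m) <= t + step_cost)%N /\
  (peak_space (step (m, t, p) (eval_cost m e) m) <= maxn p space_cost)%N.
Proof.
move=> mb eW; have h := eval_cost_weight mb eW.
have hc : (eval_cost m e < step_cost)%N by rewrite /step_cost; lia.
split; first by rewrite /run_time /= leq_add2l.
rewrite /peak_space /= geq_max leq_maxl /= (leq_trans _ (leq_maxr _ _)) //.
by rewrite /space_cost leq_add ?memory_size_le.
Qed.

Lemma spec_step_then e c c1 m N D :
  (cmd_weight c <= W -> cmd_weight c1 <= W /\ expr_weight e <= W)%N ->
  (forall f t p, exec E f.+1 c (m, t, p) = exec E f c1 (step (m, t, p) (eval_cost m e) m)) ->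
  spec c1 m N D -> spec c m N.+1 D.
Proof.
move=> cW1 ex h1 cW mb; have [c1W eW] := cW1 cW; have [f0 hf] := h1 c1W mb.
exists f0.+1 => -[//|f]; rewrite ltnS => /hf hf' t p; rewrite ex.
have [st sp] := step_costs t p mb eW.
have [D2 [e1 e2 hD]] := hf' (run_time (step (m, t, p) (eval_cost m e) m))
  (peak_space (step (m, t, p) (eval_cost m e) m)).
exists D2; split=> //; apply: dall_impl hD => s [? [st' sp']]; split=> //; split.
  by apply: leq_trans st' _; rewrite mulSn addnA leq_add2r.
by apply: leq_trans sp' _; rewrite geq_max sp leq_maxr.
Qed.

Lemma spec_if e c1 c2 m N D :
  spec (if eval_expr m e != 0%N then c1 else c2) m N D ->
  spec (If e c1 c2) m N.+1 D.
Proof.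
apply: spec_step_then => //=.
by case: ifP => _ cW; split; lia.
Qed.

Lemma spec_while_stop e c m : eval_expr m e = 0%N -> spec (While e c) m 1 (dret R m).
Proof.
move=> em /= cW mb; have eW : (expr_weight e <= W)%N := leq_trans (leq_addr _ _) cW.
exists 1%N => -[//|f] _ t p.
exists (dret R (step (m, t, p) (eval_cost m e) m)); split=> //.
  by rewrite /= em eqxx.
by have [? ?] := step_costs t p mb eW; rewrite mul1n.
Qed.

Lemma spec_while_step (T : Type) (g : T -> seq nat) (D : dist R T) k e c m N1 N2 :
  eval_expr m e != 0%N ->
  spec c m N1 (dmap g D) ->
  dall (fun y => spec (While e c) (g y) N2 (k y)) D ->
  spec (While e c) m (N1 + N2).+1 (dbind D k).
Proof.
move=> em h1 h2 cW mb; have eW : (expr_weight e <= W)%N := leq_trans (leq_addr _ _) cW.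
have := @spec_bind T c (While e c) (While e c) m 1 N1 N2 (N1 + N2).+1 g D k.
apply=> //; first by move=> /=; lia.
move=> f t p _; exists (run_time (step (m, t, p) (eval_cost m e) m)).
exists (peak_space (step (m, t, p) (eval_cost m e) m)); rewrite /= em.
by have [? ?] := step_costs t p mb eW; rewrite mul1n.
Qed.

(** The number of rounds of each loop is known when it starts: [enc r x] is the memory with [r]
    rounds left, so the loop is an iteration and no termination argument is needed. *)
Lemma spec_while (T : Type) (enc : nat -> T -> seq nat) (Inv : nat -> T -> Prop)
    (stp : T -> dist R T) e c N r x :
  (forall r x, Inv r.+1 x ->
    [/\ eval_expr (enc r.+1 x) e != 0%N,
        spec c (enc r.+1 x) N (dmap (enc r) (stp x)) &
        dall (Inv r) (stp x)]) ->
  (forall x, Inv 0%N x -> eval_expr (enc 0%N x) e = 0%N) ->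
  Inv r x ->
  spec (While e c) (enc r x) (r * N.+1).+1 (dmap (enc 0%N) (diter r stp x)).
Proof.
move=> hS h0; elim: r x => [|r IH] x /= Ix; first exact/spec_while_stop/h0.
have [en hc hI] := hS r x Ix; rewrite dmap_bind.
apply: spec_weaken (spec_while_step en hc (dall_impl IH hI)).
by rewrite mulSn; lia.
Qed.

Lemma spec_while_det (I : nat -> seq nat) e c N r :
  (forall i, (i < r)%N -> eval_expr (I i) e != 0%N /\ spec c (I i) N (dret R (I i.+1))) ->
  eval_expr (I r) e = 0%N ->
  spec (While e c) (I 0%N) (r * N.+1).+1 (dret R (I r)).
Proof.
move=> hS h0; pose enc (j i : nat) := I i.
have := @spec_while nat enc (fun j i => j + i = r)%N (fun i => dret R i.+1) e c N r 0%N.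
rewrite diter_ret dmap_ret /enc /=.
have -> : iter r succn 0%N = r by elim: (r) => //= ? ->.
apply; last by rewrite addn0.
  move=> j i ji; have [|? ?] := hS i; first by rewrite -ji addSn ltnS leq_addl.
  by split=> //=; split=> //; rewrite -addSnnS.
by move=> i; rewrite add0n => ->.
Qed.

End ProgramLogic.

(** * The program *)

Lemma odd_bits (m i : nat) (f : nat -> bool) :
  odd ((\sum_(l < m) f l * 2 ^ l) %/ 2 ^ i) = (i < m)%N && f i.
Proof.
elim: i m f => [|i IH] [|m] f; rewrite ?big_ord0 ?div0n //.
  all: rewrite big_ord_recl /= expn0 muln1.
  all: have -> : (\sum_(l < m) f (bump 0 l) * 2 ^ bump 0 l =
          (\sum_(l < m) f l.+1 * 2 ^ l) * 2)%N
    by rewrite big_distrl; apply: eq_bigr => l _; rewrite /bump /= add1n expnSr mulnA.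
  by rewrite divn1 oddD oddM andbF addbF oddb.
have f2 : (f 0 < 2)%N by case: (f 0%N).
by rewrite expnS divnMA addnC divnMDl // (divn_small f2) addn0 (IH m (fun l => f l.+1)).
Qed.

Section Encoding.
Variable n : nat.
Implicit Types (A : {set 'I_n}) (i j : 'I_n).

Lemma encode_bit A i : (encode A %/ 2 ^ i %% 2)%N = (i \in A).
Proof.
rewrite modn2; congr nat_of_bool.
pose f (l : nat) := if (insub l : option 'I_n) is Some i then i \in A else false.
have -> : encode A = (\sum_(l < n) f l * 2 ^ l)%N.
  rewrite /encode big_mkcond /=; apply: eq_bigr => l _.
  by rewrite /f valK; case: (l \in A); rewrite ?mul1n ?mul0n.
by rewrite odd_bits ltn_ord /f valK.
Qed.

Lemma decodeK A : Defs.decode n (encode A) = A.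
Proof.
by apply/setP => i; rewrite inE; have := encode_bit A i; rewrite modn2; case: odd; case: (i \in A).
Qed.

Lemma encode_inj : injective (@encode n).
Proof. by move=> A B e; rewrite -(decodeK A) e decodeK. Qed.

Lemma encodeU1 A j : j \notin A -> encode (j |: A) = (encode A + 2 ^ j)%N.
Proof. by move=> jA; rewrite /encode big_setU1 //= addnC. Qed.

Lemma encodeD1 A i : i \in A -> encode A = (encode (A :\ i) + 2 ^ i)%N.
Proof. by move=> iA; rewrite /encode (big_setD1 i) //= addnC. Qed.

Lemma encode_swap A i j : i \in A -> j \notin A ->
  (encode A - 2 ^ i + 2 ^ j)%N = encode (j |: A :\ i).
Proof.
move=> iA jA; rewrite encodeU1; last by rewrite !inE negb_and jA orbT.
by rewrite (encodeD1 iA) addnK.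
Qed.

Lemma encode_add A j :
  (encode A + 2 ^ j * (1 - (encode A %/ 2 ^ j %% 2)))%N = encode (j |: A).
Proof.
rewrite encode_bit; case: (boolP (j \in A)) => jA /=.
  by rewrite muln0 addn0 (finset.setUidPr _) ?finset.sub1set.
by rewrite subn0 muln1 encodeU1.
Qed.

End Encoding.

(* Memory layout of the program, with the names used in [walk_memory] below:
   0 n, later the numerator of the output; 1 k, later its denominator;
   2 the clique flag, later the number w of slots per swapped-in vertex;
   3 L; 4 g; 5 2^s; 6 s; 7 walk length m;
   8, 9, 10 the cumulated masses of the three kinds of steps of the walk;
   11, 12 numerator and denominator of the final rescaling;
   13 number of samples; 14 samples left; 15 accumulator;
   16 starting face; 17 current face; 18 flag; 19 weight plus 1; 20 steps left;
   21 random draw; 22 loop counter; 23 2^j; 24 answers of the oracles; 25 2^l;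
   26 number of elements below l; 27 parity of the swap; 28 face after the swap. *)
Declare Scope cmd_scope.
Delimit Scope cmd_scope with cmd.
Notation "'$' i" := (Cell (Cst i)) (at level 1, i at level 0, format "$ i") : cmd_scope.
Notation "x + y" := (Bin OAdd x y) : cmd_scope.
Notation "x - y" := (Bin OSub x y) : cmd_scope.
Notation "x * y" := (Bin OMul x y) : cmd_scope.
Notation "x / y" := (Bin ODiv x y) : cmd_scope.
Notation "x 'mod' y" := (Bin OMod x y) (at level 40) : cmd_scope.
Notation "# c" := (Cst c) (at level 1, c at level 0, format "# c") : cmd_scope.
Notation "i <-' e" := (Store (Cst i) e%cmd) (at level 60) : cmd_scope.
Notation "c1 ;; c2" := (Seq c1%cmd c2%cmd) (at level 65, right associativity) : cmd_scope.

(* For [x], [y] natural numbers, the indicators of [x = y] and [x < y]. *)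
Definition eq_expr (x y : expr) : expr := (#1 - ((x - y) + (y - x)))%cmd.
Definition lt_expr (x y : expr) : expr := (#1 - (#1 - (y - x)))%cmd.

(** The weights -1, 0, 1 are stored as 0, 1, 2, so negation is y |-> 2 - y; the bit [x] selects
    it. *)
Definition negate_expr (x y : expr) : expr := (x * (#2 - y) + (#1 - x) * y)%cmd.

Definition power_cmd : cmd :=
  (23 <-' #1 ;;
   While $22 (23 <-' #2 * $23 ;; 22 <-' $22 - #1))%cmd.

(** The oracle is asked about A - l + j for every vertex l. If l is not in A the question is
    meaningless, hence the answer is multiplied by the bit of l in A. Cell 21 starts at t + 1 and
    decreases at each swappable vertex, so [$24 * eq_expr $21 #1] singles out the one of index t;
    afterwards truncated subtraction keeps the cell at 0. *)
Definition scan_body : cmd :=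
  (Member #24 ($17 - $25 + $23) ;;
   24 <-' $24 * ($17 / $25 mod #2) ;;
   28 <-' $28 + ($24 * eq_expr $21 #1) * ($17 - $25 + $23) ;;
   27 <-' $27 + $26 * eq_expr $25 $23 + ($24 * eq_expr $21 #1) * ($26 + lt_expr $25 $23) ;;
   21 <-' $21 - $24 ;;
   26 <-' $26 + ($17 / $25 mod #2) ;;
   25 <-' #2 * $25 ;;
   22 <-' $22 - #1)%cmd.

(** The parity in cell 27 starts at 1 because the walk applies minus the Laplacian. Cell 28 stays 0
    if there are at most t swaps, since a face obtained by a swap contains j and has a nonzero code;
    the walk then dies. *)
Definition swap_cmd : cmd :=
  (21 <-' $21 + #1 ;; 25 <-' #1 ;; 27 <-' #1 ;; 22 <-' $0 ;;
   While $22 scan_body ;;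
   If $28 (17 <-' $28 ;; 19 <-' negate_expr ($27 mod #2) $19) (19 <-' #1))%cmd.

Definition move_cmd : cmd :=
  (Rand #22 $0 ;; Rand #21 $2 ;; power_cmd ;;
   Member #24 ($17 + $23 * (#1 - ($17 / $23 mod #2))) ;;
   If $24 (19 <-' (#1 - $21) * (#2 - $19) + (#1 - (#1 - $21))) swap_cmd ;;
   23 <-' #0 ;; 24 <-' #0 ;; 25 <-' #0 ;; 26 <-' #0 ;; 27 <-' #0 ;; 28 <-' #0 ;;
   21 <-' #0)%cmd.

Definition step_cmd : cmd :=
  (Rand #21 $10 ;;
   If ($8 - $21)
      (19 <-' $18 * $19 + (#1 - $18) * (#2 - $19) ;; 18 <-' #1 - $18 ;; 21 <-' #0)
      (If $18 (19 <-' #1 ;; 21 <-' #0)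
          (If ($9 - $21) (21 <-' #0) move_cmd)) ;;
   20 <-' $20 - #1)%cmd.

Definition sample_cmd : cmd :=
  (SampleFace #16 ;; 17 <-' $16 ;; 18 <-' #0 ;; 19 <-' #2 ;; 20 <-' $7 ;;
   While $20 step_cmd ;;
   If (eq_expr $16 $17) (15 <-' $15 + $19) (15 <-' $15 + #1) ;;
   16 <-' #0 ;; 17 <-' #0 ;; 18 <-' #0 ;; 19 <-' #0 ;;
   14 <-' $14 - #1)%cmd.

Fixpoint expr_pow (e : expr) (c : nat) : expr :=
  if c is c'.+1 then (e * expr_pow e c')%cmd else Cst 1.

Definition search_cmd (start : cmd) (test : cmd) (again : expr) (next : cmd) : cmd :=
  (start ;; test ;; While again (next ;; test))%cmd.

Definition mass_cmd : cmd :=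
  (21 <-' (#2 * $4) * ($4 + #1) ;;
   8 <-' $21 * $3 ;;
   9 <-' $8 + (#2 * ($21 + #1)) * $3 ;;
   10 <-' $9 + (#2 * $21) * ($0 * $2) ;;
   21 <-' #0)%cmd.

Definition scale_loop : cmd :=
  (While $22
     (11 <-' $11 * $10 ;; 12 <-' $12 * (#2 * $3) ;;
      27 <-' $27 * (($4 + #1) * ($4 + #1)) ;; 28 <-' $28 * ($4 * $4) ;;
      22 <-' $22 - #1))%cmd.

Definition count_cmd (c : nat) : cmd :=
  (12 <-' $12 * ($27 + $28) ;; 27 <-' #0 ;; 28 <-' #0 ;;
   13 <-' ($5 * $5) * ((($11 / $12 + #1) * ($11 / $12 + #1)) * expr_pow ($0 + #1) c) ;;
   1 <-' $13 * $12 ;; 14 <-' $13 ;;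
   While $14 sample_cmd ;;
   0 <-' ($15 - $13) * $11)%cmd.

(** Writing cell 28 first extends the memory to its full length, whence the shape [walk_memory]. The
    three searches stop at the least L with L > M lambda, the least g with g^2 gamma >= M and the
    least s >= 1 with 2^s epsilon >= 6. *)
Definition betti_cmd (M c : nat) : cmd :=
  (28 <-' #0 ;;
   If (#2 - $0) (0 <-' #0 ;; 1 <-' #1)
   (search_cmd Skip (Compare #24 PLambda $3 #M) $24 (3 <-' $3 + #1) ;;
    search_cmd Skip (Compare #24 PGamma #M ($4 * $4)) (#1 - $24) (4 <-' $4 + #1) ;;
    search_cmd (6 <-' #1 ;; 5 <-' #2) (Compare #24 PEpsilon #6 $5) (#1 - $24)
       (6 <-' $6 + #1 ;; 5 <-' #2 * $5) ;;
    24 <-' #0 ;;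
    7 <-' $4 * $6 ;;
    If $2 (2 <-' #1) (2 <-' $0) ;;
    mass_cmd ;;
    11 <-' #2 * $4 + #1 ;; 12 <-' #1 ;; 27 <-' $4 + #1 ;; 28 <-' $4 ;; 22 <-' $7 ;;
    scale_loop ;;
    count_cmd c))%cmd.

(* Keeps conversion from unfolding [spec] into runs of the machine. *)
#[global] Opaque spec.

(** * Derived rules for assignments, oracle calls, random draws and branches *)

Section DerivedRules.
Variables (R : realType) (E : environment R) (b cells W : nat).
Hypothesis b0 : (0 < b)%N.
Hypothesis nb : (env_n E <= b)%N.
Local Notation spec := (@spec R E b cells W).

Lemma spec_assign_last i e m m' v :
  (i < cells)%N -> eval_expr m e = v -> (v < 2 ^ b)%N -> set_nth 0%N m i v = m' ->
  spec (Store (Cst i) e) m 1 (dret R m').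
Proof. by move=> iS ev vb <-; rewrite -ev; apply: spec_store => //; rewrite ev. Qed.

Lemma spec_assign i e c m m' v N D :
  (i < cells)%N -> eval_expr m e = v -> (v < 2 ^ b)%N -> set_nth 0%N m i v = m' ->
  spec c m' N D -> spec (Seq (Store (Cst i) e) c) m N.+1 D.
Proof.
move=> iS ev vb e1 h; rewrite -[N.+1]add1n; apply: spec_seq_det h => //.
exact: spec_assign_last ev vb e1.
Qed.

Lemma spec_member_assign i e c m m' (v : bool) N D :
  (i < cells)%N -> (Defs.decode (env_n E) (eval_expr m e) \in env_complex E) = v ->
  set_nth 0%N m i v = m' ->
  spec c m' N D -> spec (Seq (Member (Cst i) e) c) m N.+1 D.
Proof.
move=> iS <- <- h; rewrite -[N.+1]add1n; apply: spec_seq_det h => //.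
exact: spec_member.
Qed.

Lemma spec_rand_seq (T : eqType) (f : T -> nat) (r : seq T) i e c m N k :
  (i < cells)%N -> (0 < eval_expr m e <= 2 ^ b)%N ->
  [seq f y | y <- r] = iota 0 (eval_expr m e) ->
  (forall y, y \in r -> spec c (set_nth 0%N m i (f y)) N (k y)) ->
  spec (Seq (Rand (Cst i) e) c) m N.+1 (dbind (uniform R r) k).
Proof.
move=> iS vb fr h; rewrite -[N.+1]add1n.
apply: (spec_seq b0 nb (g := fun y => set_nth 0%N m i (f y))).
  have -> : dmap (fun y => set_nth 0%N m i (f y)) (uniform R r) =
      dmap (fun v => set_nth 0%N m i v) (uniform R (iota 0 (eval_expr m e))).
    by rewrite -fr /dmap /uniform size_map -!map_comp.
  exact: spec_rand.
exact: dall_uniform.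
Qed.

Lemma spec_if_true e c1 c2 m N D : eval_expr m e != 0%N ->
  spec c1 m N D -> spec (If e c1 c2) m N.+1 D.
Proof. by move=> em h; apply: spec_if; rewrite ?em. Qed.

Lemma spec_if_false e c1 c2 m N D : eval_expr m e = 0%N ->
  spec c2 m N D -> spec (If e c1 c2) m N.+1 D.
Proof. by move=> em h; apply: spec_if; rewrite ?em. Qed.

End DerivedRules.

Lemma indicator_eq (x y : nat) : (1 - ((x - y) + (y - x)) = (x == y))%N.
Proof. by case: eqP => [->|/eqP xy]; lia. Qed.

Lemma indicator_lt (x y : nat) : (1 - (1 - (y - x)) = (x < y))%N.
Proof. by case: ltnP => h; lia. Qed.

(** * Correctness of the scan for swappable vertices *)

Section Scan.
Variables (R : realType) (E : environment R) (b W : nat).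
Let n := env_n E.
Let K := env_complex E.
Hypothesis nb : (n + 3 <= b)%N.
Variables (c1 w L g e s m T0 T2 Nt F Q Ns : nat).
Local Notation spec := (@spec R E b 29 W).

Definition walk_memory (i acc A0 A f X r u l q ans p cnt par new : nat) : seq nat :=
  [:: n; c1; w; L; g; e; s; m; T0; T2; Nt; F; Q; Ns;
      i; acc; A0; A; f; X; r; u; l; q; ans; p; cnt; par; new].

Lemma b_gt0 : (0 < b)%N. Proof. by apply: leq_trans nb; rewrite addn3. Qed.

Lemma n_le_b : (env_n E <= b)%N. Proof. exact: leq_trans (leq_addr _ _) nb. Qed.

Lemma small_bound v : (v < 2 ^ n.+3)%N -> (v < 2 ^ b)%N.
Proof. by move=> h; apply: leq_trans h _; rewrite leq_exp2l // -addn3. Qed.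

Lemma below_le (A : {set 'I_n}) i : (below A i <= n)%N.
Proof. by rewrite -[leqRHS]card_ord max_card. Qed.

Lemma n_lt_exp2 : (n < 2 ^ n)%N. Proof. exact: ltn_expl. Qed.

Lemma small_bound3 v : (v < 3)%N -> (v < 2 ^ b)%N.
Proof.
move=> h; apply: small_bound; apply: leq_trans h _.
by have : (0 < 2 ^ n)%N; rewrite ?expn_gt0 // !expnS; lia.
Qed.

Lemma ord_bound v : (v <= n)%N -> (v < 2 ^ b)%N.
Proof.
move=> h; apply: small_bound; have := n_lt_exp2; rewrite !expnS -/n; lia.
Qed.

Lemma exp2_ord (i : 'I_n) : (2 * 2 ^ i <= 2 ^ n)%N.
Proof. by rewrite -expnS leq_exp2l. Qed.

Lemma power_spec i acc A0 A f X r u l q ans p cnt par new :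
  (l < n)%N ->
  spec power_cmd (walk_memory i acc A0 A f X r u l q ans p cnt par new)
    (l * 3).+2 (dret R (walk_memory i acc A0 A f X r u 0 (2 ^ l) ans p cnt par new)).
Proof.
move=> ln; rewrite /power_cmd.
have b1 := b_gt0; have nb' := n_le_b; have lt2n j : (j <= n)%N -> (2 ^ j < 2 ^ b)%N.
  by move=> jn; rewrite ltn_exp2l //; apply: leq_ltn_trans jn _; lia.
apply: (spec_assign b1 nb' _ (v := 1%N)) => //.
  by rewrite -(expn0 2); apply: lt2n.
have := @spec_while_det R E b 29 W b1 nb' (fun j => walk_memory i acc A0 A f X r u (l - j) (2 ^ j)
   ans p cnt par new) ($22)%cmd (23 <-' #2 * $23 ;; 22 <-' $22 - #1)%cmd 2 l.
rewrite subn0 expn0 subnn; apply=> // j jl; split; first by rewrite /= subn_eq0 -ltnNge.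
apply: (spec_assign b1 nb' _ (v := (2 ^ j.+1)%N)) => //.
- by rewrite /= expnS.
- by apply: lt2n; lia.
apply: (spec_assign_last b1 nb' _ (v := (l - j.+1)%N)) => //.
- by rewrite /=; lia.
- by apply: leq_ltn_trans (leq_subr _ _) _; apply: small_bound; have := n_lt_exp2; rewrite !expnS; lia.
Qed.

Definition swappables (A : {set 'I_n}) (j : 'I_n) (l : nat) : seq 'I_n :=
  [seq i <- take l (enum 'I_n) | swappable K A j i].

Lemma swappablesS A j (i : 'I_n) :
  swappables A j i.+1 = swappables A j i ++ nseq (swappable K A j i) i.
Proof.
rewrite /swappables (take_nth i) ?size_enum_ord // nth_ord_enum filter_rcons.
by case: ifP => _; rewrite ?cats0 // cats1.
Qed.

Definition scan_cnt (A : {set 'I_n}) (l : nat) : nat := #|[set i in A | (i < l)%N]|.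

Lemma scan_cntS A (i : 'I_n) : scan_cnt A i.+1 = (scan_cnt A i + (i \in A))%N.
Proof.
rewrite /scan_cnt; have [iA|iA] := boolP (i \in A).
  rewrite (cardsD1 i) inE iA ltnSn addnC; congr (#|pred_of_set _| + _)%N.
  by apply/setP => l; rewrite !inE ltnS ltn_neqAle andbCA; congr (_ && (_ && _)).
rewrite addn0; apply: eq_card => l; rewrite !inE ltnS leq_eqVlt.
by case: eqP => //= /val_inj ->; rewrite (negPf iA).
Qed.

Lemma scan_cnt_le A l : (scan_cnt A l <= n)%N.
Proof. by rewrite -[leqRHS]card_ord max_card. Qed.

Definition scan_new (A : {set 'I_n}) (j : 'I_n) (t l : nat) : nat :=
  let v := swappables A j l in
  if (t < size v)%N then encode (j |: A :\ nth j v t) else 0%N.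

(** [below A j] is added when the scan passes [j], the rest when it meets the selected vertex i.
    Since [below A j] counts i whenever i < j, the extra (i < j) restores the parity of the count in
    [A :\ i]. *)
Definition scan_par (A : {set 'I_n}) (j : 'I_n) (t l : nat) : nat :=
  let v := swappables A j l in
  (1 + (j < l) * below A j +
   if t < size v then below A (nth j v t) + (nth j v t < j) else 0)%N.

Lemma size_swappables A j (l : nat) : (l <= n)%N -> (size (swappables A j l) <= l)%N.
Proof.
move=> ln; rewrite size_filter; apply: leq_trans (count_size _ _) _.
by rewrite size_take size_enum_ord; case: ltnP ln.
Qed.

Lemma scan_newS A j t (i : 'I_n) :
  scan_new A j t i.+1 = (scan_new A j t i +
    (swappable K A j i && (t == size (swappables A j i))) * encode (j |: A :\ i))%N.
Proof.
rewrite /scan_new swappablesS; set v := swappables A j i.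
case: swappable; last by rewrite /= cats0 mul0n addn0.
rewrite size_cat nth_cat /= addn1 ltnS; case: ltngtP => // [_|->].
  by rewrite mul0n addn0.
by rewrite subnn mul1n.
Qed.

Lemma scan_parS A j t (i : 'I_n) :
  scan_par A j t i.+1 = (scan_par A j t i + scan_cnt A i * (2 ^ i == 2 ^ j) +
    (swappable K A j i && (t == size (swappables A j i))) *
       (scan_cnt A i + (2 ^ i < 2 ^ j)))%N.
Proof.
rewrite eqn_exp2l // ltn_exp2l // /scan_par swappablesS; set v := swappables A j i.
have -> : ((j < i.+1) * below A j = (j < i) * below A j + scan_cnt A i * (val i == val j))%N.
  rewrite ltnS leq_eqVlt [val i == _]eq_sym -[in scan_cnt A i]/(val i).
  case: ltngtP => [ji|ji|ji]; rewrite /= ?mul0n ?muln0 ?mul1n ?muln1 ?addn0 //.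
  by have -> : j = i by exact: val_inj.
move: (_ * below A j)%N (scan_cnt A i * _)%N => x y.
case: swappable; last by rewrite /= cats0 mul0n; lia.
rewrite size_cat nth_cat /= addn1 ltnS; case: ltngtP => //= [ts|ts|->].
- by lia.
- by lia.
by rewrite subnn mul1n /= -[below A i]/(scan_cnt A i); lia.
Qed.

Lemma scan_new_lt A j t l : (scan_new A j t l < 2 ^ n)%N.
Proof. by rewrite /scan_new; case: ifP => _; [exact: encode_lt|rewrite expn_gt0]. Qed.

Lemma scan_par_le A j t l : (scan_par A j t l <= 2 * n + 2)%N.
Proof.
rewrite /scan_par; have h2 := below_le A (nth j (swappables A j l) t).
have : ((j < l) * below A j <= n)%N.
  by case: (j < l)%N; rewrite ?mul1n ?mul0n // below_le.
move: (_ * below A j)%N => x hx; case: ifP => _; last by lia.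
by move: h2; case: (nth j _ t < j)%N => /=; move: (below A _) => y; lia.
Qed.

Lemma scan_spec i acc A0 (A : {set 'I_n}) f X r t (j : 'I_n) ans :
  j \notin A -> (t < n)%N ->
  exists u p cnt ans',
  spec (While $22%cmd scan_body)
    (walk_memory i acc A0 (encode A) f X r t.+1 n (2 ^ j) ans 1 0 1 0) (n * 9).+1
    (dret R (walk_memory i acc A0 (encode A) f X r u 0 (2 ^ j) ans' p cnt
              (scan_par A j t n) (scan_new A j t n))).
Proof.
move=> jA tn; have b1 := b_gt0; have nb' := n_le_b.
(* Cell 24 keeps the answer of the last round, and its old content before the first. *)
pose ans_at (l : nat) : nat := if l is l'.+1 then
  (if (insub l' : option 'I_n) is Some i then swappable K A j i else false) : nat else ans.
exists (t.+1 - size (swappables A j n))%N, (2 ^ n)%N, (scan_cnt A n), (ans_at n).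
pose I l := walk_memory i acc A0 (encode A) f X r
   (t.+1 - size (swappables A j l)) (n - l) (2 ^ j) (ans_at l) (2 ^ l) (scan_cnt A l)
   (scan_par A j t l) (scan_new A j t l).
have -> : walk_memory i acc A0 (encode A) f X r t.+1 n (2 ^ j) ans 1 0 1 0 = I 0%N.
  have sw0 : swappables A j 0 = [::] by rewrite /swappables take0.
  have c0 : scan_cnt A 0 = 0%N by apply: eq_card0 => l; rewrite !inE andbF.
  by rewrite /I /scan_par /scan_new sw0 c0 subn0.
have -> : walk_memory i acc A0 (encode A) f X r (t.+1 - size (swappables A j n)) 0
    (2 ^ j) (ans_at n) (2 ^ n) (scan_cnt A n) (scan_par A j t n) (scan_new A j t n) = I n.
  by rewrite /I subnn.
apply: spec_while_det => //; last by rewrite /= subnn.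
move=> l ln; split; first by rewrite /= subn_eq0 -ltnNge.
rewrite {}/I; cbv beta.
pose i0 := Ordinal ln.
have := swappablesS A j i0; have := scan_cntS A i0.
have := scan_newS A j t i0; have := scan_parS A j t i0.
move=> parS newS cntS swS; rewrite /= in parS newS cntS swS.
set ans0 := ans_at l; have -> : ans_at l.+1 = swappable K A j i0 by rewrite /ans_at insubT.
have bitE : (encode A %/ 2 ^ l %% 2)%N = (i0 \in A) by rewrite (encode_bit A i0).
have smA := encode_lt A; have nn := n_lt_exp2; have ej := exp2_ord j; have ei := exp2_ord i0.
have cl := scan_cnt_le A l; have bj := below_le A j.
have sb := small_bound.
have e8 : (2 ^ n.+3 = 8 * 2 ^ n)%N by rewrite !expnS; lia.
rewrite e8 /= in sb ei.
have sz : (size (swappables A j l) <= l)%N by apply: size_swappables; exact: ltnW.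
set u := (t.+1 - size (swappables A j l))%N.
(* Cell 21 is 1 exactly when t swappable vertices have been met so far. *)
have hitE : (swappable K A j i0 * (1 - ((u - 1) + (1 - u))) =
    swappable K A j i0 && (t == size (swappables A j l)))%N.
  rewrite indicator_eq; case: swappable => //=; rewrite mul1n; congr nat_of_bool.
  by rewrite /u; lia.
set hit := _ && _ in parS newS hitE.
have hitv : (hit * (encode A - 2 ^ l + 2 ^ j) = hit * encode (j |: A :\ i0))%N.
  rewrite /hit /swappable; case: (boolP (i0 \in A)) => // iA.
  by rewrite -(encode_swap iA jA).
rewrite /scan_body.
apply: (spec_member_assign b1 nb' _ erefl erefl) => //.
apply: (spec_assign b1 nb' _ (v := swappable K A j i0)) => //.
- rewrite /= bitE /swappable; case: (boolP (i0 \in A)) => iA; rewrite ?muln0 ?muln1 //=.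
  by rewrite (encode_swap iA jA) decodeK.
- exact: bool_lt.
rewrite /=; apply: (spec_assign b1 nb' _ (v := scan_new A j t l.+1)) => //.
- by rewrite /= hitE hitv newS.
- by apply: sb; apply: leq_trans (scan_new_lt A j t l.+1) _; rewrite leq_pmull.
rewrite /=; apply: (spec_assign b1 nb' _ (v := scan_par A j t l.+1)) => //.
- by rewrite /= hitE indicator_eq indicator_lt parS.
- by apply: sb; move: nn (scan_par_le A j t l.+1); clear; lia.
rewrite /=; apply: (spec_assign b1 nb' _ (v := (t.+1 - size (swappables A j l.+1))%N)) => //.
- by rewrite /= swS size_cat size_nseq subnDA.
- by apply: sb; apply: leq_ltn_trans (leq_subr _ _) _; move: nn tn; clear; lia.
rewrite /=; apply: (spec_assign b1 nb' _ (v := scan_cnt A l.+1)) => //.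
- by rewrite /= bitE cntS.
- by apply: sb; move: nn (scan_cnt_le A l.+1); clear; lia.
rewrite /=; apply: (spec_assign b1 nb' _ (v := (2 ^ l.+1)%N)) => //.
- by rewrite /= expnS.
- by apply: sb; rewrite expnS; move: nn ei; clear; lia.
apply: (spec_assign_last b1 nb' _ (v := (n - l.+1)%N)) => //.
- by rewrite [LHS]/= subn1 -subnS.
- by apply: sb; apply: leq_ltn_trans (leq_subr _ _) _; move: nn; clear; lia.
Qed.

End Scan.

(** * Semantics of the walk and of the program *)

Section Walk.
Variables (R : realType) (E : environment R) (b W : nat).
Let n := env_n E.
Let K := env_complex E.
Hypothesis nb : (n + 3 <= b)%N.
Variables (c1 w L g e s m T0 T2 Nt F Q Ns : nat).
Hypothesis n0 : (0 < n)%N.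
Hypothesis w0 : (0 < w <= n)%N.
Hypothesis Nt0 : (0 < Nt < 2 ^ b)%N.
Local Notation spec := (@spec R E b 29 W).
Local Notation memory := (walk_memory E c1 w L g e s m T0 T2 Nt F Q Ns).

(* A face, the flag of the recurrence, and the weight of the path shifted by 1:
   0, 1, 2 stand for the weights -1, 0, 1. *)
Definition walk_state : Type := ({set 'I_n} * bool * 'I_3)%type.

Definition dead : 'I_3 := @Ordinal 3 1 isT.
Definition alive : 'I_3 := @Ordinal 3 2 isT.

(** Each pair of [j] and a slot [t] stands for at most one unit term of the row of minus the
    Laplacian. If [j |: A] is a face the only term is diagonal and occupies slot 0; otherwise the
    slots enumerate the swaps. An empty slot kills the walk, so that all pairs can be drawn with
    equal probability. *)
Definition move_result (A : {set 'I_n}) (x : 'I_3) (j : 'I_n) (t : nat) :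
    {set 'I_n} * 'I_3 :=
  if j |: A \in K then (A, if t == 0%N then rev_ord x else dead)
  else
    let v := swappables A j n in
    if (t < size v)%N then
      let i := nth j v t in
      (j |: A :\ i,
       if odd (below (A :\ i) i + below (A :\ i) j) then x else rev_ord x)
    else (A, dead).

Definition walk_move (st : walk_state) : dist R walk_state :=
  let: (A, f, x) := st in
  dbind (uniform R (enum 'I_n)) (fun j =>
    dbind (uniform R (iota 0 w)) (fun t =>
      let y := move_result A x j t in dret R (y.1, f, y.2))).

Definition walk_step (st : walk_state) : dist R walk_state :=
  let: (A, f, x) := st in
  dbind (uniform R (iota 0 Nt)) (fun u =>
    if (u < T0)%N then dret R (A, ~~ f, if f then x else rev_ord x)
    else if f then dret R (A, f, dead)
    else if (u < T2)%N then dret R st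
    else walk_move st).

(** All scratch cells are zero: the resets in the program make the memory depend on the state of the
    walk alone. *)
Definition walk_enc (i acc A0 : nat) (r : nat) (st : walk_state) : seq nat :=
  memory i acc A0 (encode st.1.1) st.1.2 st.2 r 0 0 0 0 0 0 0 0.

Lemma negate_exprE mem e1 e2 (o : bool) (x : 'I_3) :
  eval_expr mem e1 = o -> eval_expr mem e2 = x ->
  eval_expr mem (negate_expr e1 e2) = if o then rev_ord x else x.
Proof.
move=> h1 h2; rewrite /= h1 h2; case: o {h1}; case: x h2 => [[|[|[|]]]] //=.
Qed.

Lemma stay_exprE (x : 'I_3) t :
  ((1 - t) * (2 - x) + (1 - (1 - t)))%N = (if t == 0%N then rev_ord x else dead).
Proof.
case: t => [|t] /=; first by rewrite subSS mul1n addn0.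
by rewrite subSS sub0n mul0n.
Qed.

Lemma swap_spec i acc A0 (A : {set 'I_n}) f (x : 'I_3) r t (j : 'I_n) ans :
  j |: A \notin K -> A \in K -> (t < w)%N ->
  exists u p cnt ans' par new q,
  spec swap_cmd (memory i acc A0 (encode A) f x r t 0 (2 ^ j) ans 0 0 0 0)
   (n * 9 + 8)
    (dret R (memory i acc A0 (encode (move_result A x j t).1) f (move_result A x j t).2 r
       u 0 q ans' p cnt par new)).
Proof.
move=> jK AK tw; have b1 := b_gt0 nb; have nb' := n_le_b nb.
have jA : j \notin A.
  by apply: contra jK => jA; rewrite (finset.setUidPr _) ?finset.sub1set.
have tn : (t < n)%N by apply: leq_trans tw _; case/andP: w0.
have [u [p [cnt [ans']]]] :=
  @scan_spec R E b W nb c1 w L g e s m T0 T2 Nt F Q Ns i acc A0 A f x r t j ans jA tn.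
move=> scan; exists u, p, cnt, ans', (scan_par A j t n), (scan_new A j t n), (2 ^ j)%N.
rewrite /swap_cmd (_ : (n * 9 + 8 = ((n * 9).+1 + 3).+4)%N); last by lia.
apply: (spec_assign b1 nb' _ (v := t.+1)); [by []|by rewrite /= addn1|exact: (ord_bound nb)|by []|].
rewrite /=; apply: (spec_assign b1 nb' _ (v := 1%N)); [by []|by []|exact: (small_bound3 nb)|by []|].
rewrite /=; apply: (spec_assign b1 nb' _ (v := 1%N)); [by []|by []|exact: (small_bound3 nb)|by []|].
rewrite /=; apply: (spec_assign b1 nb' _ (v := n)); [by []|by []|exact: (ord_bound nb)|by []|].
rewrite /=; apply: (spec_seq_det b1 nb' scan).
rewrite /move_result (negPf jK) /scan_new /scan_par -/K.
have := size_swappables A j (leqnn n).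
set v := swappables A j n => sv.
case: ifP => tv /=.
  set k := nth j v t; set B := j |: A :\ k.
  have : k \in v by exact: mem_nth.
  rewrite mem_filter => /andP[/andP[kA _] _].
  apply: spec_if_true => //.
    by rewrite /= /B encodeU1 ?addn_eq0 ?expn_eq0 ?andbF // !inE (negPf jA) andbF.
  apply: (spec_assign b1 nb' _ (v := encode B)) => //.
    by apply: leq_trans (encode_lt B) _; rewrite leq_exp2l.
  apply: (spec_assign_last b1 nb' _
    (v := if odd (below (A :\ k) k + below (A :\ k) j) then x else rev_ord x)) => //.
    rewrite (negate_exprE (o := ~~ odd (below (A :\ k) k + below (A :\ k) j)) (x := x)) //.
      by rewrite if_neg.
    rewrite /= modn2; congr nat_of_bool.
    rewrite (belowD1 j kA) -(below_delx A k) ltn_ord /=.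
    rewrite mul1n !oddD !oddb; move: (odd (below _ k)) (odd (below _ j)) (k < j)%N.
    by move=> [] [] [].

  by apply: (small_bound3 nb); case: ifP.
apply: spec_weaken (_ : spec _ _ 2 _) => //.
apply: spec_if_false => //.
by apply: (spec_assign_last b1 nb' _ (v := 1%N)) => //; exact: (small_bound3 nb).
Qed.

Lemma choose_spec i acc A0 r (A : {set 'I_n}) f (x : 'I_3) (j : 'I_n) t :
  A \in K -> (t < w)%N ->
  exists u p cnt ans par new q,
  spec (If $24%cmd (19 <-' (#1 - $21) * (#2 - $19) + (#1 - (#1 - $21)))%cmd swap_cmd)
    (memory i acc A0 (encode A) f x r t 0 (2 ^ j) (j |: A \in K) 0 0 0 0) (n * 9 + 9)
    (dret R (memory i acc A0 (encode (move_result A x j t).1) f (move_result A x j t).2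
       r u 0 q ans p cnt par new)).
Proof.
move=> AK tw; have b1 := b_gt0 nb; have nb' := n_le_b nb.
case/orP: (orbN (j |: A \in K)) => jK.
  exists t, 0%N, 0%N, 1%N, 0%N, 0%N, (2 ^ j)%N.
  have -> : move_result A x j t = (A, if t == 0%N then rev_ord x else dead).
    by rewrite /move_result jK.
  rewrite jK; apply: spec_weaken (_ : spec _ _ 2 _).
    by rewrite addnS ltnS addn_gt0 orbT.
  apply: (spec_if_true b1 nb'); first by [].
  apply: (spec_assign_last b1 nb' _ (v := if t == 0%N then rev_ord x else dead)); first by [].
  - by rewrite [LHS]/=; exact: stay_exprE.
  - by apply: (small_bound3 nb); case: ifP.
  - by [].
have [u' [p [cnt [ans' [par [new [q mid]]]]]]] :=
  swap_spec i acc A0 f x r 0 jK AK tw.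
exists u', p, cnt, ans', par, new, q.
rewrite (negPf jK) addnS; apply: (spec_if_false b1 nb'); first by [].
exact: mid.
Qed.

Lemma reset_spec i acc A0 A f X r u q ans p cnt par new :
  spec (23 <-' #0 ;; 24 <-' #0 ;; 25 <-' #0 ;; 26 <-' #0 ;; 27 <-' #0 ;; 28 <-' #0 ;;
        21 <-' #0)%cmd
    (memory i acc A0 A f X r u 0 q ans p cnt par new) 7
    (dret R (memory i acc A0 A f X r 0 0 0 0 0 0 0 0)).
Proof.
have b1 := b_gt0 nb; have nb' := n_le_b nb; have z : (0 < 2 ^ b)%N by rewrite expn_gt0.
apply: (spec_assign b1 nb' _ (v := 0%N)); [by []|by []|exact: z|by []|].
apply: (spec_assign b1 nb' _ (v := 0%N)); [by []|by []|exact: z|by []|].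
apply: (spec_assign b1 nb' _ (v := 0%N)); [by []|by []|exact: z|by []|].
apply: (spec_assign b1 nb' _ (v := 0%N)); [by []|by []|exact: z|by []|].
apply: (spec_assign b1 nb' _ (v := 0%N)); [by []|by []|exact: z|by []|].
apply: (spec_assign b1 nb' _ (v := 0%N)); [by []|by []|exact: z|by []|].
apply: (spec_assign_last b1 nb' _ (v := 0%N)); [by []|by []|exact: z|by []].
Qed.

Definition move_steps : nat := (n * 12 + 25)%N.

Lemma move_spec i acc A0 r (st : walk_state) u :
  st.1.1 \in K ->
  spec move_cmd (memory i acc A0 (encode st.1.1) st.1.2 st.2 r u 0 0 0 0 0 0 0)
    move_steps (dmap (walk_enc i acc A0 r) (walk_move st)).
Proof.
case: st => [[A f] x] AK; have b1 := b_gt0 nb; have nb' := n_le_b nb.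
have wn : (w <= n)%N by case/andP: w0.
rewrite dmap_bind /move_steps addnS.
apply: (spec_rand_seq b1 nb' (f := val)); first by [].
- by rewrite [eval_expr _ _]/= n0 ltnW // (ord_bound nb).
- exact: val_enum_ord.
move=> j _; rewrite dmap_bind addnS.
apply: (spec_rand_seq b1 nb' (f := id)); first by [].
- by rewrite [eval_expr _ _]/=; case/andP: w0 => -> _ /=; rewrite ltnW // (ord_bound nb).
- by rewrite map_id.
move=> t; rewrite mem_iota add0n => /andP[_ tw]; rewrite dmap_ret.
apply: spec_weaken (_ : spec _ _ ((j * 3).+2 + ((n * 9 + 9) + 7).+1) _).
  by have := ltn_ord j; lia.
have -> : set_nth 0%N (set_nth 0%N (memory i acc A0 (encode A) f x r u 0 0 0 0 0 0 0)
    22 (val j)) 21 (id t) = memory i acc A0 (encode A) f x r t j 0 0 0 0 0 0 by [].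
apply: (spec_seq_det b1 nb').
  exact: (power_spec nb).
have [u' [p [cnt [ans' [par [new [q mid]]]]]]] := choose_spec i acc A0 r f x j AK tw.
apply: (spec_member_assign b1 nb' _ (v := j |: A \in K)); first by [].
- by rewrite [eval_expr _ _]/= encode_add decodeK.
- by [].
apply: (spec_seq_det b1 nb' mid).
exact: reset_spec.
Qed.

Lemma move_result_face (A : {set 'I_n}) (x : 'I_3) (j : 'I_n) t :
  A \in K -> (move_result A x j t).1 \in K.
Proof.
move=> AK; rewrite /move_result; case: ifP => // _; case: ifP => //= tv.
have : nth j (swappables A j n) t \in swappables A j n by exact: mem_nth.
by rewrite mem_filter => /andP[/andP[_ +] _].
Qed.

Lemma walk_move_face (st : walk_state) : st.1.1 \in K ->
  dall (fun st => st.1.1 \in K) (walk_move st).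
Proof.
case: st => [[A f] x] /= AK; apply/dall_bind; apply: dall_true => j.
by apply/dall_bind; apply: dall_true => t /=; split=> //; exact: move_result_face.
Qed.

Lemma walk_step_face (st : walk_state) : st.1.1 \in K ->
  dall (fun st => st.1.1 \in K) (walk_step st).
Proof.
case: st => [[A f] x] AK; apply/dall_bind; apply: dall_true => u.
case: ifP => _; first by split.
case: ifP => _; first by split.
by case: ifP => _; [split|exact: walk_move_face].
Qed.

Definition step_steps : nat := (n * 12 + 30)%N.

Lemma step_spec i acc A0 r (st : walk_state) :
  (r < 2 ^ b)%N -> st.1.1 \in K ->
  spec step_cmd (walk_enc i acc A0 r.+1 st) step_steps
    (dmap (walk_enc i acc A0 r) (walk_step st)).
Proof.
case: st => [[A f] x] rb AK; have b1 := b_gt0 nb; have nb' := n_le_b nb.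
rewrite dmap_bind /step_steps addnS.
apply: (spec_rand_seq b1 nb' (f := id)); first by [].
- by rewrite [eval_expr _ _]/=; case/andP: Nt0 => -> /= /ltnW.
- by rewrite map_id.
move=> u _; rewrite addnS -[(n * 12 + 28).+1]addn1.
rewrite dmapE; apply: (spec_seq b1 nb'
  (g := fun st : walk_state => memory i acc A0 (encode st.1.1) st.1.2 st.2 r.+1 0 0 0 0 0 0 0 0)); last first.
  apply: dall_true => st.
  apply: (spec_assign_last b1 nb' _ (v := r)); [by []| |exact: rb|by []].
  by rewrite [LHS]/= subn1.
have -> : set_nth 0%N (walk_enc i acc A0 r.+1 (A, f, x)) 21 (id u) =
   memory i acc A0 (encode A) f x r.+1 u 0 0 0 0 0 0 0 by [].
rewrite addnS; have z : (0 < 2 ^ b)%N by rewrite expn_gt0.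
case: (ltnP u T0) => uT0.
  apply: (spec_if_true b1 nb'); first by rewrite [eval_expr _ _]/= subn_eq0 -ltnNge.
  apply: spec_weaken (_ : spec _ _ 3 _); first by rewrite addnS addnS addnS.
  apply: (spec_assign b1 nb' _ (v := if f then x else rev_ord x)); first by [].
  - rewrite [LHS]/=; case: (f); first by rewrite mul1n mul0n addn0.
    by rewrite mul0n subn0 mul1n /= subSS.
  - by apply: (small_bound3 nb); case: ifP.
  - by [].
  apply: (spec_assign b1 nb' _ (v := ~~ f)); [by []|by rewrite [LHS]/=; case: (f)|exact: bool_lt|by []|].
  by apply: (spec_assign_last b1 nb' _ (v := 0%N)); [by []|by []|exact: z|by []].
apply: (spec_if_false b1 nb'); first by rewrite [eval_expr _ _]/=; apply/eqP; rewrite subn_eq0.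
rewrite -[(n * 12 + 27)%N]/(n * 12 + 27)%N addnS; case: (f).
  apply: (spec_if_true b1 nb'); first by [].
  apply: spec_weaken (_ : spec _ _ 2 _); first by rewrite addnS addnS.
  apply: (spec_assign b1 nb' _ (v := 1%N)); [by []|by []|exact: (small_bound3 nb)|by []|].
  by apply: (spec_assign_last b1 nb' _ (v := 0%N)); [by []|by []|exact: z|by []].
apply: (spec_if_false b1 nb'); first by [].
rewrite addnS; case: (ltnP u T2) => uT2.
  apply: (spec_if_true b1 nb'); first by rewrite [eval_expr _ _]/= subn_eq0 -ltnNge.
  apply: spec_weaken (_ : spec _ _ 1 _); first by rewrite addnS.
  by apply: (spec_assign_last b1 nb' _ (v := 0%N)); [by []|by []|exact: z|by []].
apply: (spec_if_false b1 nb'); first by rewrite [eval_expr _ _]/=; apply/eqP; rewrite subn_eq0.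
exact: (@move_spec i acc A0 r.+1 (A, false, x) u AK).
Qed.

Lemma walk_spec i acc A0 (A : {set 'I_n}) r :
  (r < 2 ^ b)%N -> A \in K ->
  spec (While $20%cmd step_cmd) (walk_enc i acc A0 r (A, false, alive))
    (r * step_steps.+1).+1
    (dmap (walk_enc i acc A0 0) (diter r walk_step (A, false, alive))).
Proof.
move=> rb AK; have b1 := b_gt0 nb; have nb' := n_le_b nb.
apply: (spec_while b1 nb' (Inv := fun r st => (r < 2 ^ b)%N /\ st.1.1 \in K)) => //.
move=> r' st [r'b stK]; split; first by [].
  by apply: step_spec => //; exact: ltnW.
apply: dall_impl (walk_step_face stK) => st' st'K; split=> //; exact: ltnW.
Qed.

(** A sample is a weight plus 1, so that the accumulator remains a natural number; the number of
    samples is subtracted at the end. *)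
Definition sample_dist : dist R nat :=
  dbind (uniform R (enum (faces K (env_dim E)))) (fun A =>
    dmap (fun st : walk_state => if st.1.1 == A then val st.2 else 1%N)
      (diter m walk_step (A, false, alive))).

Lemma sample_dist_le2 : dall (fun y => y <= 2)%N sample_dist.
Proof.
apply/dall_bind; apply: dall_true => A; apply/dall_map; apply: dall_true => st.
by case: ifP => // _; rewrite -ltnS ltn_ord.
Qed.

Definition outer_memory (i acc : nat) : seq nat := memory i acc 0 0 0 0 0 0 0 0 0 0 0 0 0.

Definition sample_steps : nat := (m * step_steps.+1 + 13)%N.

Lemma sample_spec i acc :
  (m < 2 ^ b)%N -> (i < 2 ^ b)%N -> (acc + 2 < 2 ^ b)%N ->
  spec sample_cmd (outer_memory i.+1 acc) sample_steps
    (dmap (fun y => outer_memory i (acc + y)) sample_dist).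
Proof.
move=> mb ib accb; have b1 := b_gt0 nb; have nb' := n_le_b nb.
have z : (0 < 2 ^ b)%N by rewrite expn_gt0.
rewrite dmap_bind (_ : sample_steps = 1 + (m * step_steps.+1 + 12))%N; last first.
  by rewrite /sample_steps; lia.
apply: (spec_seq b1 nb' (g := fun A => set_nth 0%N (outer_memory i.+1 acc) 16 (encode A))).
  exact: spec_sample.
apply: dall_uniform => A; rewrite mem_enum inE => /andP[AK _].
rewrite addnS.
apply: (spec_assign b1 nb' _ (v := encode A)); [by []|by []| |by []|].
  by apply: leq_trans (encode_lt A) _; rewrite leq_exp2l.
rewrite addnS; apply: (spec_assign b1 nb' _ (v := 0%N)); [by []|by []|exact: z|by []|].
rewrite addnS; apply: (spec_assign b1 nb' _ (v := 2%N)); [by []|by []|exact: (small_bound3 nb)|by []|].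
rewrite addnS; apply: (spec_assign b1 nb' _ (v := m)); [by []|by []|exact: mb|by []|].
rewrite dmap_comp dmapE addnS -addSn.
apply: (spec_seq b1 nb' (g := walk_enc i.+1 acc (encode A) 0)).
  exact: (@walk_spec i.+1 acc (encode A) A m).
apply: dall_true => st.
set y := (if st.1.1 == A then val st.2 else 1)%N.
have y2 : (y <= 2)%N by rewrite /y; case: ifP => // _; rewrite -ltnS ltn_ord.
apply: (@spec_seq_det _ _ _ _ _ b1 nb' _ _ _ (set_nth 0%N (walk_enc i.+1 acc (encode A) 0 st) 15 (acc + y)) 2 5).
  apply: (spec_if b1 nb').
  have -> : (eval_expr (walk_enc i.+1 acc (encode A) 0 st) (eq_expr $16 $17)%cmd != 0)%N
     = (st.1.1 == A).
    rewrite [eval_expr _ _]/= indicator_eq (inj_eq (@encode_inj n)) [RHS]eq_sym.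
    by case: (A == st.1.1).
  rewrite /y; case: ifP => _.
    apply: (spec_assign_last b1 nb' _ (v := (acc + st.2)%N)); [by []|by []| |by []].
    by apply: leq_ltn_trans accb; rewrite leq_add2l -ltnS ltn_ord.
  apply: (spec_assign_last b1 nb' _ (v := (acc + 1)%N)); [by []|by []| |by []].
  by apply: leq_ltn_trans accb; rewrite leq_add2l.
apply: (spec_assign b1 nb' _ (v := 0%N)); [by []|by []|exact: z|by []|].
apply: (spec_assign b1 nb' _ (v := 0%N)); [by []|by []|exact: z|by []|].
apply: (spec_assign b1 nb' _ (v := 0%N)); [by []|by []|exact: z|by []|].
apply: (spec_assign b1 nb' _ (v := 0%N)); [by []|by []|exact: z|by []|].
apply: (spec_assign_last b1 nb' _ (v := i)); [by []| |exact: ib|by []].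
by rewrite [LHS]/= subn1.
Qed.

Lemma samples_spec :
  (m < 2 ^ b)%N -> (2 * Ns + 2 < 2 ^ b)%N ->
  spec (While $14%cmd sample_cmd) (outer_memory Ns 0) (Ns * sample_steps.+1).+1
    (dmap (outer_memory 0)
       (diter Ns (fun acc => dmap (addn acc) sample_dist) 0%N)).
Proof.
move=> mb Nb; have b1 := b_gt0 nb; have nb' := n_le_b nb.
apply: (spec_while b1 nb' (Inv := fun i acc => (acc + 2 * i <= 2 * Ns)%N)) => //.
move=> i acc hi; split=> //.
  rewrite dmap_comp; apply: sample_spec => //.
    by apply: leq_trans (ltnW Nb); lia.
  by apply: leq_ltn_trans Nb; lia.
apply/dall_map; apply: dall_impl sample_dist_le2 => y y2; lia.
Qed.

End Walk.

(** * Correctness of the whole program *)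

Section Program.
Variables (R : realType) (E : environment R) (b W M c : nat).
Let n := env_n E.
Variables (k : nat) (clique : bool) (L g s : nat).

(* In a clique complex a given vertex can be swapped in for at most one vertex
   of a face it does not extend, see [clique_swap_unique]. *)
Definition slots : nat := if clique then 1%N else n.
Definition walk_length : nat := (g * s)%N.
Definition shift : nat := (2 * g * (g + 1))%N.
(** In 2 Y V_r - V_(r-1) the toggle has coefficient of modulus 1, staying put 2 (1 + 1/D), and each
    pair of a vertex and a slot 2 / L. The masses are these coefficients times D L, with D =
    [shift g]; a step of the walk therefore scales the recurrence by [toggle_mass / total_mass]. *)
Definition toggle_mass : nat := (shift * L)%N.
Definition stay_mass : nat := (toggle_mass + 2 * (shift + 1) * L)%N.
Definition total_mass : nat := (stay_mass + 2 * shift * (n * slots))%N.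
Definition scale_num (i : nat) : nat := ((2 * g + 1) * total_mass ^ i)%N.
Definition den_pow (i : nat) : nat := ((2 * L) ^ i)%N.
Definition odd_pow (x i : nat) : nat := (x ^ (2 * i).+1)%N.
Definition scale_den : nat :=
  (den_pow walk_length * (odd_pow (g + 1) walk_length + odd_pow g walk_length))%N.
(* Enough for Chebyshev's inequality: [2 ^ s] is at least 6 / epsilon, and the
   mean of the samples is rescaled by [scale_num / scale_den]. *)
Definition sample_count : nat :=
  (2 ^ s * 2 ^ s * ((scale_num walk_length %/ scale_den + 1) *
    (scale_num walk_length %/ scale_den + 1) * (n + 1) ^ c))%N.
Definition final_memory (acc : nat) : seq nat :=
  walk_memory E (sample_count * scale_den) slots L g (2 ^ s) s walk_length toggle_mass
    stay_mass total_mass (scale_num walk_length) scale_den sample_count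
    0 acc 0 0 0 0 0 0 0 0 0 0 0 0 0.
Definition acc_dist : dist R nat :=
  diter sample_count (fun acc => dmap (addn acc)
    (sample_dist E slots walk_length toggle_mass stay_mass total_mass)) 0%N.

Local Notation spec := (@spec R E b 29 W).

Hypothesis n2 : (2 <= n)%N.
Hypothesis nb : (n + 3 <= b)%N.
Hypothesis kn : (k < n)%N.
Hypothesis L0 : (0 < L)%N.
Hypothesis g0 : (0 < g)%N.
Hypothesis s0 : (0 < s)%N.
(** Each real comparison is equated with a comparison of counters, so that [L], [g] and [s] are the
    values at which the searches stop. The search for [s] starts at 1, hence the successors. *)
Hypothesis LP : forall j, (j < L)%N = (j%:R <= M%:R * env_param E PLambda).
Hypothesis gP : forall j, (g <= j)%N = (M%:R <= (j * j)%:R * env_param E PGamma).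
Hypothesis sP : forall j, (s <= j.+1)%N = (6 <= (2 ^ j.+1)%:R * env_param E PEpsilon).
Hypothesis Lb : (L < 2 ^ b)%N.
Hypothesis gb : (g < 2 ^ b)%N.
Hypothesis sb : (s < b)%N.
Hypothesis mb : (walk_length < 2 ^ b)%N.
Hypothesis Ntb : (total_mass < 2 ^ b)%N.
Hypothesis NFb : (sample_count * scale_num walk_length < 2 ^ b)%N.
Hypothesis NQb : (sample_count * scale_den < 2 ^ b)%N.
Hypothesis Nb : (2 * sample_count + 2 < 2 ^ b)%N.

Let b1 := b_gt0 nb.
Let nb' := n_le_b nb.

Lemma spec_compare_last i p e1 e2 m m' (v : bool) :
  (i < 29)%N -> ((eval_expr m e1)%:R <= (eval_expr m e2)%:R * env_param E p) = v ->
  set_nth 0%N m i v = m' ->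
  spec (Compare (Cst i) p e1 e2) m 1 (dret R m').
Proof. by move=> iS <- <-; exact: spec_compare. Qed.

Lemma spec_search start test again next m m0 (I : nat -> seq nat) r N0 N1 :
  spec start m N0 (dret R m0) -> spec test m0 1 (dret R (I 0%N)) ->
  (forall j, (j < r)%N -> eval_expr (I j) again != 0%N /\
     exists m', spec next (I j) N1 (dret R m') /\ spec test m' 1 (dret R (I j.+1))) ->
  eval_expr (I r) again = 0%N ->
  spec (search_cmd start test again next) m
    (N0 + (1 + (r * (N1 + 1).+1).+1)) (dret R (I r)).
Proof.
move=> h1 h2 hS hr; apply: (spec_seq_det b1 nb' h1); apply: (spec_seq_det b1 nb' h2).
apply: (spec_while_det b1 nb') => // j jr; have [e [m' [h3 h4]]] := hS j jr.
by split=> //; apply: (spec_seq_det b1 nb' h3).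
Qed.

Local Notation mem0 := (fun w l q e t ans =>
  walk_memory E k w l q e t 0 0 0 0 0 0 0 0 0 0 0 0 0 0 0 0 0 ans 0 0 0 0).

Lemma search_L :
  spec (search_cmd Skip (Compare #24 PLambda $3 #M) $24 (3 <-' $3 + #1))%cmd
    (mem0 clique 0 0 0 0 0)%N (1 + (1 + (L * 3).+1)) (dret R (mem0 clique L 0 0 0 0)%N).
Proof.
have := @spec_search Skip (Compare #24 PLambda $3 #M)%cmd $24%cmd (3 <-' $3 + #1)%cmd
 (mem0 clique 0 0 0 0 0)%N (mem0 clique 0 0 0 0 0)%N
 (fun j => mem0 clique j 0%N 0%N 0%N (j < L)%N) L 1 1.
rewrite ltnn; apply=> //.
- exact: spec_skip.
- apply: (spec_compare_last (v := (0 < L)%N)); [by []|by rewrite LP|by []].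
move=> j jL; split; first by rewrite /= jL.
exists (mem0 clique j.+1 0%N 0%N 0%N (j < L)%N); split.
  apply: (spec_assign_last b1 nb' _ (v := j.+1)); first by [].
  - by rewrite [LHS]/= addn1.
  - exact: leq_ltn_trans jL Lb.
  - by [].
by apply: (spec_compare_last (v := (j.+1 < L)%N)); [by []|by rewrite LP|by []].
Qed.

Lemma search_g :
  spec (search_cmd Skip (Compare #24 PGamma #M ($4 * $4)) (#1 - $24) (4 <-' $4 + #1))%cmd
    (mem0 clique L 0 0 0 0)%N (1 + (1 + (g * 3).+1)) (dret R (mem0 clique L g 0 0 1)%N).
Proof.
have := @spec_search Skip (Compare #24 PGamma #M ($4 * $4))%cmd (#1 - $24)%cmd
 (4 <-' $4 + #1)%cmd
 (mem0 clique L 0 0 0 0)%N (mem0 clique L 0 0 0 0)%N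
 (fun j => mem0 clique L j 0%N 0%N (g <= j)%N) g 1 1.
rewrite leqnn; apply=> //.
- exact: spec_skip.
- apply: (spec_compare_last (v := (g <= 0)%N)); [by []|by rewrite gP|by []].
move=> j jg; split; first by rewrite /= leqNgt jg.
exists (mem0 clique L j.+1 0%N 0%N (g <= j)%N); split.
  apply: (spec_assign_last b1 nb' _ (v := j.+1)); first by [].
  - by rewrite [LHS]/= addn1.
  - exact: leq_ltn_trans jg gb.
  - by [].
by apply: (spec_compare_last (v := (g <= j.+1)%N)); [by []|by rewrite gP|by []].
Qed.

Lemma search_s :
  spec (search_cmd (6 <-' #1 ;; 5 <-' #2) (Compare #24 PEpsilon #6 $5) (#1 - $24)
       (6 <-' $6 + #1 ;; 5 <-' #2 * $5))%cmd
    (mem0 clique L g 0 0 1)%N (2 + (1 + (s.-1 * 4).+1))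
    (dret R (mem0 clique L g (2 ^ s) s 1)%N).
Proof.
have e2 j : (j <= s)%N -> (2 ^ j < 2 ^ b)%N.
  by move=> js; rewrite ltn_exp2l //; apply: leq_ltn_trans js sb.
have := @spec_search (6 <-' #1 ;; 5 <-' #2)%cmd (Compare #24 PEpsilon #6 $5)%cmd
  (#1 - $24)%cmd (6 <-' $6 + #1 ;; 5 <-' #2 * $5)%cmd
 (mem0 clique L g 0 0 1)%N (mem0 clique L g 2 1 1)%N
 (fun j => mem0 clique L g (2 ^ j.+1)%N j.+1 (s <= j.+1)%N) s.-1 2 2.
rewrite prednK // leqnn; apply=> //.
- apply: (spec_assign b1 nb' _ (v := 1%N)); [by []|by []|exact: (small_bound3 nb)|by []|].
  by apply: (spec_assign_last b1 nb' _ (v := 2%N)); [by []|by []|exact: (small_bound3 nb)|by []].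
- apply: (spec_compare_last (v := (s <= 1)%N)); [by []|by rewrite sP|by []].
move=> j js; have js' : (j.+1 < s)%N by rewrite -(prednK s0) ltnS.
split; first by rewrite /= leqNgt js'.
exists (mem0 clique L g (2 ^ j.+2)%N j.+2 (s <= j.+1)%N); split.
  apply: (spec_assign b1 nb' _ (v := j.+2)); first by [].
  - by rewrite [LHS]/= addn1.
  - apply: leq_ltn_trans js' _; apply: leq_ltn_trans (ltnW sb) _; exact: ltn_expl.
  - by [].
  apply: (spec_assign_last b1 nb' _ (v := (2 ^ j.+2)%N)); first by [].
  - by rewrite [LHS]/= -expnS.
  - exact: e2.
  - by [].
by apply: (spec_compare_last (v := (s <= j.+2)%N)); [by []|by rewrite sP|by []].
Qed.

Lemma total_mass_gt0 : (0 < total_mass)%N.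
Proof.
rewrite /total_mass !addn_gt0 /toggle_mass muln_gt0 L0 andbT /shift.
by rewrite !muln_gt0 g0 addn1.
Qed.

Lemma sample_count_gt0 : (0 < sample_count)%N.
Proof. by rewrite /sample_count !muln_gt0 !expn_gt0 !addn1. Qed.

Lemma scale_den_gt0 : (0 < scale_den)%N.
Proof.
by rewrite /scale_den muln_gt0 expn_gt0 muln_gt0 L0 /= addn_gt0 expn_gt0 addn1.
Qed.

Lemma scale_num_lt j : (j <= walk_length)%N -> (scale_num j < 2 ^ b)%N.
Proof.
move=> jm; apply: leq_ltn_trans NFb.
apply: leq_trans (leq_pmull _ sample_count_gt0).
by rewrite leq_mul2l leq_pexp2l ?orbT // total_mass_gt0.
Qed.

Lemma scale_den_lt : (scale_den < 2 ^ b)%N.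
Proof. exact: leq_ltn_trans (leq_pmull _ sample_count_gt0) NQb. Qed.

Lemma den_pow_lt j : (j <= walk_length)%N -> (den_pow j < 2 ^ b)%N.
Proof.
move=> jm; apply: leq_ltn_trans scale_den_lt; rewrite /scale_den.
apply: (@leq_trans (den_pow walk_length)).
  by rewrite leq_pexp2l // muln_gt0 L0.
by rewrite leq_pmulr // addn_gt0 expn_gt0 addn1.
Qed.

Lemma odd_pow_lt x j : (j <= walk_length)%N -> (x = g \/ x = g + 1)%N ->
  (odd_pow x j < 2 ^ b)%N.
Proof.
move=> jm xg; apply: leq_ltn_trans scale_den_lt; rewrite /scale_den.
apply: leq_trans (leq_pmull _ _); last by rewrite expn_gt0 muln_gt0 L0.
apply: (@leq_trans (odd_pow x walk_length)).
  rewrite leq_pexp2l ?ltnS ?leq_mul2l ?jm ?orbT //.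
  by case: xg => ->; rewrite ?addn1.
by case: xg => ->; rewrite ?leq_addr ?leq_addl.
Qed.

Lemma eval_expr_pow m e j : eval_expr m (expr_pow e j) = (eval_expr m e ^ j)%N.
Proof. by elim: j => //= j ->; rewrite expnS. Qed.

Local Notation mem1 := (fun F Q l p1 p2 =>
  walk_memory E k slots L g (2 ^ s) s walk_length toggle_mass stay_mass total_mass F Q
    0 0 0 0 0 0 0 0 0 l 0 0 0 0 p1 p2).

Lemma mass_spec :
  spec mass_cmd
   (walk_memory E k slots L g (2 ^ s) s walk_length 0 0 0 0 0
    0 0 0 0 0 0 0 0 0 0 0 0 0 0 0 0) 5
   (dret R (mem1 0 0 0 0 0)%N).
Proof.
have t2 : (stay_mass <= total_mass)%N by rewrite leq_addr.
have t1 : (toggle_mass <= total_mass)%N by apply: leq_trans t2; rewrite leq_addr.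
have t0 : (shift <= total_mass)%N by apply: leq_trans t1; rewrite leq_pmulr.
apply: (spec_assign b1 nb' _ (v := shift)); [by []|by []|exact: leq_ltn_trans t0 Ntb|by []|].
apply: (spec_assign b1 nb' _ (v := toggle_mass)); [by []|by []|exact: leq_ltn_trans t1 Ntb|by []|].
apply: (spec_assign b1 nb' _ (v := stay_mass)); [by []|by []|exact: leq_ltn_trans t2 Ntb|by []|].
apply: (spec_assign b1 nb' _ (v := total_mass)); [by []|by []|exact: Ntb|by []|].
by apply: (spec_assign_last b1 nb' _ (v := 0%N)); [by []|by []|exact: (small_bound3 nb)|by []].
Qed.

Lemma scale_loop_spec :
  spec scale_loop (mem1 (2 * g + 1) 1 walk_length (g + 1) g)%N (walk_length * 6).+1
   (dret R (mem1 (scale_num walk_length) (den_pow walk_length) 0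
     (odd_pow (g + 1) walk_length) (odd_pow g walk_length))%N).
Proof.
pose I j := mem1 (scale_num j) (den_pow j) (walk_length - j)%N (odd_pow (g + 1) j) (odd_pow g j).
have -> : mem1 (2 * g + 1)%N 1%N walk_length (g + 1)%N g = I 0%N.
  by rewrite /I /scale_num /den_pow /odd_pow muln0 !expn0 !expn1 muln1 subn0.
have -> : mem1 (scale_num walk_length) (den_pow walk_length) 0%N
     (odd_pow (g + 1) walk_length) (odd_pow g walk_length) = I walk_length.
  by rewrite /I subnn.
apply: (spec_while_det b1 nb'); last by rewrite [LHS]/= subnn.
move=> j jm; split; first by rewrite [eval_expr _ _]/= subn_eq0 -ltnNge.
have pS x : odd_pow x j.+1 = (odd_pow x j * (x * x))%N.
  by rewrite /odd_pow mulnS -addnS addnC expnD -mulnn.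
apply: (spec_assign b1 nb' _ (v := scale_num j.+1)); [by []| |exact: scale_num_lt|by []|].
  by rewrite [LHS]/= /scale_num expnSr mulnA.
apply: (spec_assign b1 nb' _ (v := den_pow j.+1)); [by []| |exact: den_pow_lt|by []|].
  by rewrite [LHS]/= /den_pow expnSr.
apply: (spec_assign b1 nb' _ (v := odd_pow (g + 1) j.+1)); [by []| | |by []|].
- by rewrite [LHS]/= pS.
- by apply: odd_pow_lt => //; right.
apply: (spec_assign b1 nb' _ (v := odd_pow g j.+1)); [by []| | |by []|].
- by rewrite [LHS]/= pS.
- by apply: odd_pow_lt => //; left.
apply: (spec_assign_last b1 nb' _ (v := (walk_length - j.+1)%N)); [by []| | |by []].
- by rewrite [LHS]/= [RHS]subnS subn1.
- by apply: leq_ltn_trans mb; exact: leq_subr.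
Qed.

(** When the sampled mean is negative, truncated subtraction reports 0, which is no farther from the
    nonnegative target. *)
Definition output_memory (acc : nat) : seq nat :=
  set_nth 0%N (final_memory acc) 0 ((acc - sample_count) * scale_num walk_length)%N.

Local Notation sstep := (sample_steps E walk_length).+1.

Lemma count_spec :
  spec (count_cmd c)
   (mem1 (scale_num walk_length) (den_pow walk_length) 0
     (odd_pow (g + 1) walk_length) (odd_pow g walk_length))%N
   ((sample_count * sstep).+1 + 1).+4.+2
   (dmap output_memory acc_dist).
Proof.
have z := small_bound3 nb (isT : (0 < 3)%N).
have Nlt : (sample_count < 2 ^ b)%N by apply: leq_ltn_trans Nb; lia.
have sl : (0 < slots <= n)%N by rewrite /slots; case: clique => //=; rewrite ?leqnn ltnW // ltnW.
have n0 : (0 < n)%N by apply: ltnW.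
have Ntb' : (0 < total_mass < 2 ^ b)%N by rewrite total_mass_gt0 Ntb.
apply: (spec_assign b1 nb' _ (v := scale_den)); [by []|by []|exact: scale_den_lt|by []|].
apply: (spec_assign b1 nb' _ (v := 0%N)); [by []|by []|exact: z|by []|].
apply: (spec_assign b1 nb' _ (v := 0%N)); [by []|by []|exact: z|by []|].
apply: (spec_assign b1 nb' _ (v := sample_count)); [by []| |exact: Nlt|by []|].
  by rewrite [LHS]/= eval_expr_pow.
apply: (spec_assign b1 nb' _ (v := (sample_count * scale_den)%N)); [by []|by []|exact: NQb|by []|].
apply: (spec_assign b1 nb' _ (v := sample_count)); [by []|by []|exact: Nlt|by []|].
rewrite dmapE; apply: (spec_seq b1 nb' (g := final_memory)).
  exact: (@samples_spec R E b W nb (sample_count * scale_den) slots L g (2 ^ s) s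
    walk_length toggle_mass stay_mass total_mass (scale_num walk_length) scale_den
    sample_count n0 sl Ntb' mb Nb).
(* A sample is at most 2, so [acc - sample_count] is at most [sample_count] and the numerator of the
   output fits in b bits. *)
have : dall (fun acc => acc + 2 * 0 <= 2 * sample_count)%N acc_dist.
  apply: (dall_iter (P := fun i acc => (acc + 2 * i <= 2 * sample_count)%N)) => //.
  move=> i acc hi; apply/dall_map; apply: dall_impl (sample_dist_le2 _ _ _ _ _ _) => y y2.
  by move: hi y2; rewrite mulnS; move: (2 * sample_count)%N => NN; lia.
apply: dall_impl => acc accN; rewrite muln0 addn0 in accN.
apply: (spec_assign_last b1 nb' _ (v := ((acc - sample_count) * scale_num walk_length)%N)).
- by [].
- by [].
- apply: leq_ltn_trans NFb; rewrite leq_mul2r leq_subLR addnn -mul2n accN orbT //.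
- by [].
Qed.

Definition program_steps : nat :=
  (L * 3 + g * 3 + s * 4 + walk_length * 6 + sample_count * sstep + 50)%N.

Lemma betti_cmd_spec :
  spec (betti_cmd M c) [:: n; k; nat_of_bool clique] program_steps
    (dmap output_memory acc_dist).
Proof.
have z := small_bound3 nb (isT : (0 < 3)%N).
apply: spec_weaken (_ : spec _ _ ((1 + (1 + (L * 3).+1)) + ((1 + (1 + (g * 3).+1)) +
   ((2 + (1 + (s.-1 * 4).+1)) + (2 + (5 + ((walk_length * 6).+1 +
     ((sample_count * sstep).+1 + 1).+4.+2).+4.+1)).+2))).+2 _).
  rewrite /program_steps; move: (_ * sstep)%N => X; have := prednK s0; lia.
apply: (spec_assign b1 nb' _ (v := 0%N) (m' := (mem0 clique 0 0 0 0 0)%N)); [by []|by []|exact: z|by []|].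
apply: (spec_if_false b1 nb').
  by rewrite [eval_expr _ _]/=; apply/eqP; rewrite subn_eq0.
apply: (spec_seq_det b1 nb' search_L).
apply: (spec_seq_det b1 nb' search_g).
apply: (spec_seq_det b1 nb' search_s).
apply: (spec_assign b1 nb' _ (v := 0%N)); [by []|by []|exact: z|by []|].
apply: (spec_assign b1 nb' _ (v := walk_length)); [by []|by []|exact: mb|by []|].
apply: (@spec_seq_det _ _ _ _ _ b1 nb' _ _ _ (walk_memory E k slots L g (2 ^ s) s walk_length 0 0 0 0 0
    0 0 0 0 0 0 0 0 0 0 0 0 0 0 0 0) 2).
  apply: (spec_if b1 nb'); rewrite [eval_expr _ _]/= /slots; case: clique.
    by apply: (spec_assign_last b1 nb' _ (v := 1%N)); [by []|by []|exact: (small_bound3 nb)|by []].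
  by apply: (spec_assign_last b1 nb' _ (v := n)); [by []|by []|exact: (ord_bound nb)|by []].
apply: (spec_seq_det b1 nb' mass_spec).
have m0 := leq0n walk_length.
apply: (spec_assign b1 nb' _ (v := (2 * g + 1)%N)); [by []|by []| |by []|].
  by have := scale_num_lt m0; rewrite /scale_num expn0 muln1.
apply: (spec_assign b1 nb' _ (v := 1%N)); [by []|by []|exact: (small_bound3 nb)|by []|].
apply: (spec_assign b1 nb' _ (v := (g + 1)%N)); [by []|by []| |by []|].
  by have := @odd_pow_lt (g + 1) 0 m0 (or_intror erefl); rewrite /odd_pow muln0 expn1.
apply: (spec_assign b1 nb' _ (v := g)); [by []|by []|exact: gb|by []|].
apply: (spec_assign b1 nb' _ (v := walk_length)); [by []|by []|exact: mb|by []|].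
apply: (spec_seq_det b1 nb' scale_loop_spec).
exact: count_spec.
Qed.

End Program.

(** * Expectation and variance of the samples *)

Section Expectation.
Variables (R : realType) (E : environment R).
Let n := env_n E.
Let K := env_complex E.
Variables (w m D L : nat).
Let T0 := (D * L)%N.
Let T2 := (T0 + 2 * (D + 1) * L)%N.
Let Nt := (T2 + 2 * D * (n * w))%N.
Hypothesis Kcx : simplicial_complex K.
Hypothesis n0 : (0 < n)%N.
Hypothesis w0 : (0 < w)%N.
Hypothesis D0 : (0 < D)%N.
Hypothesis L0 : (0 < L)%N.
Hypothesis swap_le : forall (A : {set 'I_n}) j, A \in K -> j |: A \notin K ->
  (size (@swappables R E A j n) <= w)%N.

Local Notation step := (@walk_step R E w T0 T2 Nt).

Definition weight (x : 'I_3) : R := (x : nat)%:R - 1.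

Lemma weight_rev x : weight (rev_ord x) = - weight x.
Proof.
rewrite /weight /= subSS natrB; last by rewrite -ltnS.
by ring.
Qed.

Lemma weight_dead : weight dead = 0. Proof. by rewrite /weight subrr. Qed.

Lemma weight_alive : weight alive = 1. Proof. by rewrite /weight /=; ring. Qed.

Lemma sum_swappables (F : 'I_n -> R) (A : {set 'I_n}) j :
  A \in K -> j |: A \notin K ->
  \sum_(t <- iota 0 w)
    (if (t < size (@swappables R E A j n))%N then F (nth j (@swappables R E A j n) t) else 0) =
  \sum_(i | swappable K A j i) F i.
Proof.
move=> AK jK; have := swap_le AK jK; set v := swappables A j n => vw.
rewrite -(subnKC vw) iotaD add0n big_cat /= [X in _ + X]big1_seq ?addr0; last first.
  by move=> t /andP[_]; rewrite mem_iota => /andP[vt _]; rewrite ltnNge vt.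
transitivity (\sum_(i <- v) F i).
  rewrite (big_nth j) /index_iota subn0; apply: eq_big_seq => t.
  by rewrite mem_iota add0n => /andP[_ ->].
by rewrite /v /swappables take_oversize ?size_enum_ord // big_filter big_enum_cond.
Qed.

Lemma Ex_walk_move (H : {set 'I_n} -> bool -> R) (A : {set 'I_n}) f x :
  A \in K ->
  Ex (@walk_move R E w (A, f, x)) (fun st => weight st.2 * H st.1.1 st.1.2) =
  - (weight x * laplacian_op K (fun B => H B f) A) / (n * w)%:R.
Proof.
move=> AK; rewrite /walk_move Ex_bind Ex_uniform size_enum_ord big_enum /=.
rewrite [RHS]mulrC natrM invfM -mulrA; congr (_ * _).
rewrite /laplacian_op big_distrr /= -sumrN big_distrr /=; apply: eq_bigr => j _.
rewrite Ex_bind Ex_uniform size_iota; congr (_ * _).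
rewrite (eq_bigr (fun t => weight (@move_result R E A x j t).2 *
  H (@move_result R E A x j t).1 f)); last by move=> t _; rewrite Ex_ret.
rewrite /move_result -/K; case: ifPn => jK.
  have -> : iota 0 w = 0%N :: iota 1 w.-1 by rewrite -{1}(prednK w0).
  rewrite big_cons /= weight_rev big1_seq ?addr0 ?mulNr // => -[|t] //.
    by rewrite mem_iota.
  by rewrite /= weight_dead mul0r.
have h := sum_swappables (fun i => - (weight x * (swap_sign R A j i * H (j |: A :\ i) f))) AK jK.
rewrite big_distrr -sumrN /= -h; apply: eq_bigr => t _; case: ifP => _ /=.
  rewrite /swap_sign -signr_odd; case: odd => /=.
    by rewrite expr1 mulN1r mulrN opprK.
  by rewrite expr0 mul1r weight_rev mulNr.
by rewrite weight_dead mul0r.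
Qed.

Lemma sum_pieces (a b c : R) (x y z : nat) : (x <= y)%N -> (y <= z)%N ->
  \sum_(u <- iota 0 z) (if (u < x)%N then a else if (u < y)%N then b else c) =
  a *+ x + b *+ (y - x) + c *+ (z - y).
Proof.
move=> xy yz.
have cst (r : seq nat) e : \sum_(u <- r) e = e *+ size r :> R.
  by rewrite big_const_seq count_predT iter_addr_0.
have -> : iota 0 z = iota 0 x ++ iota x (y - x) ++ iota y (z - y).
  have split p q : (p <= q)%N -> iota 0 q = iota 0 p ++ iota p (q - p).
    by move=> pq; rewrite -[X in _ ++ iota X _]add0n -iotaD subnKC.
  by rewrite catA -split // -split.
rewrite !big_cat /= addrA; congr (_ + _ + _).
- rewrite -[in RHS](size_iota 0 x) -cst; apply: eq_big_seq => u.
  by rewrite mem_iota add0n => /andP[_ ->].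
- rewrite -[in RHS](size_iota x (y - x)) -cst; apply: eq_big_seq => u.
  by rewrite mem_iota subnKC // => /andP[xu uy]; rewrite ltnNge xu uy.
rewrite -[in RHS](size_iota y (z - y)) -cst; apply: eq_big_seq => u.
rewrite mem_iota => /andP[yu _].
by rewrite ltnNge (leq_trans xy yu) ltnNge yu.
Qed.

(** The recurrence as an operator on pairs: flag [false] holds V_r and flag [true] holds V_(r-1).
    Toggling thus negates the weight only when it sets the flag, and with the flag set only the
    toggle survives. *)
Definition chebyshev_step (H : {set 'I_n} -> bool -> R) (A : {set 'I_n}) (f : bool) : R :=
  if f then H A false
  else ((1 + D%:R^-1) * H A false - L%:R^-1 * laplacian_op K (fun B => H B false) A) *+ 2
       - H A true.

Lemma Ex_walk_step (H : {set 'I_n} -> bool -> R) (A : {set 'I_n}) f x :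
  A \in K ->
  Ex (step (A, f, x)) (fun st => weight st.2 * H st.1.1 st.1.2) =
  weight x * (T0%:R / Nt%:R) * chebyshev_step H A f.
Proof.
move=> AK; rewrite /walk_step Ex_bind Ex_uniform size_iota.
rewrite (eq_bigr (fun u => if (u < T0)%N then weight x * (if f then H A false else - H A true)
   else if (u < T2)%N then weight x * (if f then 0 else H A false)
   else weight x * (if f then 0 else - laplacian_op K (fun B => H B false) A / (n * w)%:R)));
   last first.
  move=> u _; case: (u < T0)%N; last case: (u < T2)%N.
  - by rewrite Ex_ret /=; case: f => //=; rewrite weight_rev mulrN mulNr.
  - case: f; rewrite Ex_ret //= ?weight_dead ?mul0r ?mulr0 //.
  - case: f; first by rewrite Ex_ret /= weight_dead mul0r mulr0.
    by rewrite Ex_walk_move // !mulNr mulrN mulrA.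
have T02 : (T0 <= T2)%N by rewrite leq_addr.
have T2N : (T2 <= Nt)%N by rewrite leq_addr.
have NtR : Nt%:R != 0 :> R.
  rewrite pnatr_eq0 -lt0n; apply: leq_trans T2N; apply: leq_trans T02.
  by rewrite muln_gt0 D0 L0.
rewrite sum_pieces // addKn addKn /chebyshev_step.
rewrite -3![weight x * _ *+ _]mulr_natr; move: (Nt%:R) NtR => NN NtR.
rewrite /T0 !natrM !natrD.
have DR : D%:R != 0 :> R by rewrite pnatr_eq0 -lt0n.
have LR : L%:R != 0 :> R by rewrite pnatr_eq0 -lt0n.
have nR : n%:R != 0 :> R by rewrite pnatr_eq0 -lt0n.
have wR : w%:R != 0 :> R by rewrite pnatr_eq0 -lt0n.
case: f; first by field.
by field; rewrite NtR DR LR nR wR.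
Qed.

(** The base case ignores the flag because V_0 = V_(-1) = 1. *)
Fixpoint walk_value (A0 : {set 'I_n}) (r : nat) : {set 'I_n} -> bool -> R :=
  if r is r'.+1 then chebyshev_step (walk_value A0 r') else fun A _ => (A == A0)%:R.

Lemma Ex_walk A0 r (A : {set 'I_n}) f x :
  A \in K ->
  Ex (diter r step (A, f, x)) (fun st => weight st.2 * (st.1.1 == A0)%:R) =
  weight x * (T0%:R / Nt%:R) ^+ r * walk_value A0 r A f.
Proof.
elim: r A f x => [|r IH] A f x AK.
  by rewrite Ex_ret /= expr0 mulr1.
have AfxK : (A, f, x).1.1 \in K by [].
rewrite /= Ex_bind (eq_Ex_dall (walk_step_face w T0 T2 Nt AfxK)
  (g := fun st => (T0%:R / Nt%:R) ^+ r * (weight st.2 * walk_value A0 r st.1.1 st.1.2)));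
  last by move=> [[A' f'] x'] A'K; rewrite IH //= mulrCA mulrA.
by rewrite ExZ Ex_walk_step // exprS; ring.
Qed.

Local Notation Y k :=
  ((1 + D%:R^-1 : R)%:M - (L%:R^-1 : R) *: laplacian R K k).

Lemma walk_value_matrix k (p p0 : 'I_#|faces K k|) r :
  walk_value (enum_val p0) r (enum_val p) false = (chebV_pair (Y k) r).1 p p0 /\
  walk_value (enum_val p0) r (enum_val p) true = (chebV_pair (Y k) r).2 p p0.
Proof.
elim: r p => [|r IH] p.
  by rewrite /= (inj_eq enum_val_inj) !mxE.
split; last by case: (IH p).
rewrite [LHS]/= /chebyshev_step.
rewrite -(laplacian_opE Kcx p (fun B => walk_value (enum_val p0) r B false)).
have [-> ->] := IH p.
rewrite [chebV_pair _ _]/= [RHS]mxE; congr (_ + _); last by rewrite mxE.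
rewrite [RHS]mulmxnE; congr (_ *+ _).
rewrite -mulmxE mulmxBl mul_scalar_mx -scalemxAl [RHS]mxE [X in _ = X + _]mxE.
congr (_ + _); rewrite mxE mxE mxE; congr (- (_ * _)); apply: eq_bigr => q _.
by have [-> _] := IH q.
Qed.

Lemma Ex_sample_dist :
  (0 < #|faces K (env_dim E)|)%N ->
  Ex (@sample_dist R E w m T0 T2 Nt) (fun y => y%:R - 1) =
  (T0%:R / Nt%:R) ^+ m * (\tr (chebV (Y (env_dim E)) m) / #|faces K (env_dim E)|%:R).
Proof.
move=> d0; rewrite /sample_dist Ex_bind Ex_uniform -cardE big_enum /=.
rewrite [RHS]mulrA [RHS]mulrC; congr (_ * _); rewrite /mxtrace big_distrr /=.
rewrite big_enum_val; apply: eq_bigr => p _; rewrite Ex_map.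
have pK : enum_val p \in K by have := enum_valP p; rewrite inE => /andP[].
rewrite /chebV -(walk_value_matrix p p m).1.
transitivity (weight alive * (T0%:R / Nt%:R) ^+ m *
    walk_value (enum_val p) m (enum_val p) false).
  rewrite -Ex_walk //; apply: eq_Ex => st.
  by case: ifP => _; rewrite /weight ?mulr1 ?mulr0 ?subrr.
by rewrite weight_alive mul1r.
Qed.

Hypothesis Km : (0 < #|faces K (env_dim E)|)%N.

Lemma Nt_gt0 : (0 < Nt)%N.
Proof. by rewrite /Nt /T2 /T0 !addn_gt0 !muln_gt0 D0 L0. Qed.

Lemma probability_sample : probability_dist (@sample_dist R E w m T0 T2 Nt).
Proof.
apply: (probability_bind (P := fun A => A \in K)).
- by apply: probability_uniform; rewrite -cardE.
- by apply: dall_uniform => A; rewrite mem_enum inE => /andP[].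
move=> A AK; apply: probability_map.
apply: (probability_iter (P := fun _ st => st.1.1 \in K)) => // _ [[A' f] x] A'K.
split; last exact: walk_step_face.
apply: (probability_bind (P := fun=> True)).
- by apply: probability_uniform; rewrite size_iota Nt_gt0.
- exact: dall_true.
move=> u _; case: ifP => _; first exact: probability_ret.
case: ifP => _; first exact: probability_ret.
case: ifP => _; first exact: probability_ret.
apply: (probability_bind (P := fun=> True)); last 1 first.
- move=> j _; apply: (probability_bind (P := fun=> True)).
  + by apply: probability_uniform; rewrite size_iota.
  + exact: dall_true.
  + by move=> t _; exact: probability_ret.
- by apply: probability_uniform; rewrite size_enum_ord.
- exact: dall_true.
Qed.

(* The increments have variance at most 1, as [y - 1] lies in [-1, 1]. *)
Lemma acc_variance (mu : R) N :
  Ex (@sample_dist R E w m T0 T2 Nt) (fun y => y%:R - 1) = mu ->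
  let D := diter N (fun acc => dmap (addn acc) (@sample_dist R E w m T0 T2 Nt)) 0%N in
  probability_dist D /\
  Ex D (fun acc => (acc%:R - N%:R * (1 + mu)) ^+ 2) <= N%:R.
Proof.
move=> mean; set smp := sample_dist _ _ _ _ _ _ in mean *.
have smpP : probability_dist smp := probability_sample.
(* The start [a] and the centre [z] are generalized, so that the first sample can be absorbed into
   them. *)
have key r a : probability_dist (diter r (fun acc => dmap (addn acc) smp) a) /\
  forall z : R, Ex (diter r (fun acc => dmap (addn acc) smp) a)
     (fun acc => (acc%:R - r%:R * (1 + mu) - z) ^+ 2) <= (a%:R - z) ^+ 2 + r%:R.
  elim: r a => [|r IH] a.
    split; first exact: probability_ret.
    by move=> z; rewrite Ex_ret mul0r subr0 addr0.
  split.
    apply: (probability_bind (P := fun=> True)); [exact: probability_map|exact: dall_true|].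
    by move=> a' _; case: (IH a').
  move=> z; rewrite /= Ex_bind Ex_map.
  have dt : dall (fun y => y <= 2)%N smp := @sample_dist_le2 R E w m T0 T2 Nt.
  (* Bounding (y - 1)^2 by 1 makes the integrand affine in y, and its linear part has mean zero. *)
  apply: (@le_trans _ _ (Ex smp (fun y =>
     ((a%:R - z) ^+ 2 + r%:R + 1 - mu ^+ 2) + (2 * (a%:R - z) - 2 * mu) * ((y%:R - 1) - mu)
      ))).
    apply: le_Ex smpP dt _ => y y2.
    have [_ h] := IH (a + y)%N.
    apply: le_trans (_ : _ <= ((a + y)%:R - (z + (1 + mu))) ^+ 2 + r%:R) _.
      apply: le_trans (h _); rewrite le_eqVlt; apply/orP; left; apply/eqP; apply: eq_Ex => acc.
      by congr (_ ^+ 2); rewrite -natr1; ring.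
    rewrite natrD; have : (y%:R - 1 : R) ^+ 2 <= 1.
      by case: y y2 {h} => [|[|[|]]] //= _; lra.
    move: (y%:R : R) => Y hY; nra.
  rewrite ExD Ex_cst // ExZ.
  have -> : Ex smp (fun y => y%:R - 1 - mu) = 0.
    by rewrite (ExD smp (fun y => y%:R - 1) (fun=> - mu)) mean Ex_cst // subrr.
  rewrite mulr0 addr0 -natr1; have := sqr_ge0 mu; lra.
have [h1 h2] := key N 0%N; split=> //.
have := h2 0; rewrite subr0 expr0n /= add0r; apply: le_trans; rewrite le_eqVlt; apply/orP; left; apply/eqP.
by apply: eq_Ex => acc; rewrite subr0.
Qed.

End Expectation.

(** * Bounds on cells, time and space *)

Lemma leq_exp2_self x : (x <= 2 ^ x)%N. Proof. exact: ltnW (ltn_expl _ _). Qed.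

Lemma leq_exp2W x p q : (x <= 2 ^ p)%N -> (p <= q)%N -> (x <= 2 ^ q)%N.
Proof. by move=> xp pq; apply: leq_trans xp _; rewrite leq_exp2l. Qed.

Lemma leq_exp2M x y p q : (x <= 2 ^ p)%N -> (y <= 2 ^ q)%N -> (x * y <= 2 ^ (p + q))%N.
Proof. by move=> xp yq; rewrite expnD leq_mul. Qed.

Lemma leq_exp2D x y p q r : (x <= 2 ^ p)%N -> (y <= 2 ^ q)%N ->
  (p < r)%N -> (q < r)%N -> (x + y <= 2 ^ r)%N.
Proof.
case: r => // r xp yq pr qr; rewrite expnS mul2n -addnn.
by apply: leq_add; [exact: leq_exp2W xp pr|exact: leq_exp2W yq qr].
Qed.

Lemma leq_exp2X x p k : (x <= 2 ^ p)%N -> (x ^ k <= 2 ^ (p * k))%N.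
Proof. by move=> xp; rewrite expnM; case: k => // k; rewrite leq_exp2r. Qed.

Lemma leq_exp2_lt x p q : (x <= 2 ^ p)%N -> (p < q)%N -> (x < 2 ^ q)%N.
Proof. by move=> xp pq; apply: leq_ltn_trans xp _; rewrite ltn_exp2l. Qed.

Section BitBudget.
Variables (R : realType) (E : environment R) (c : nat) (clique : bool) (L g s : nat).
Let n := env_n E.
Let m := walk_length g s.
Hypothesis n2 : (2 <= n)%N.
Hypothesis L0 : (0 < L)%N.
Hypothesis g0 : (0 < g)%N.
Hypothesis s0 : (0 < s)%N.

(** The exponents rest on the crude bound x <= 2^x instead of logarithms: L, g, s and n are
    polynomial in n and m, so the bit lengths remain polynomial. *)
Definition mass_bits : nat := (2 * g + L + 2 * n + 5)%N.
Definition num_bits : nat := (g + 2 + mass_bits * m)%N.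
Definition den_bits : nat := ((L + 1) * m + (g * (2 * m).+1 + 1))%N.
Definition count_bits : nat := (s + s + (num_bits + 1 + (num_bits + 1) + n * c))%N.
Definition bit_budget : nat :=
  (count_bits + num_bits + den_bits + mass_bits + n + L + g + s + m + 10)%N.

Lemma slots_le : (slots E clique <= n)%N.
Proof. by rewrite /slots; case: clique => //; apply: ltnW. Qed.

Lemma shift_bits : (shift g <= 2 ^ (1 + g + g))%N.
Proof.
apply: leq_exp2M; last by rewrite addn1 ltn_expl.
by apply: leq_exp2M => //; exact: leq_exp2_self.
Qed.

Lemma total_mass_bits : (total_mass E clique L g <= 2 ^ mass_bits)%N.
Proof.
have sh := shift_bits; have Ls := leq_exp2_self L; have ns := leq_exp2_self n.
have ws : (slots E clique <= 2 ^ n)%N := leq_trans slots_le ns.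
apply: (@leq_exp2D _ _ (2 * g + L + 4) (2 * g + 2 * n + 2)); try (rewrite /mass_bits; lia).
  apply: (@leq_exp2D _ _ (1 + g + g + L) (2 * g + L + 3)); try lia.
    exact: leq_exp2M.
  apply: (leq_exp2W (p := 1 + (1 + g + g + 1) + L)); last by lia.
  apply: leq_exp2M => //; apply: leq_exp2M => //.
  by apply: (@leq_exp2D _ _ (1 + g + g) 0) => //; lia.
apply: (leq_exp2W (p := 1 + (1 + g + g) + (n + n))); last by lia.
by apply: leq_exp2M; apply: leq_exp2M.
Qed.

Lemma scale_num_bits : (scale_num E clique L g m <= 2 ^ num_bits)%N.
Proof.
apply: leq_exp2M; last exact: leq_exp2X total_mass_bits.
apply: (@leq_exp2D _ _ (1 + g) 0); try lia.
by apply: leq_exp2M => //; exact: leq_exp2_self.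
Qed.

Lemma scale_den_bits : (scale_den L g s <= 2 ^ den_bits)%N.
Proof.
apply: leq_exp2M.
  apply: leq_exp2X; rewrite addnC; apply: leq_exp2M => //; exact: leq_exp2_self.
apply: (@leq_exp2D _ _ (g * (2 * m).+1) (g * (2 * m).+1)); try by rewrite addn1.
  by apply: leq_exp2X; rewrite addn1 ltn_expl.
by apply: leq_exp2X; exact: leq_exp2_self.
Qed.

Lemma sample_count_bits : (sample_count E c clique L g s <= 2 ^ count_bits)%N.
Proof.
have q : (scale_num E clique L g m %/ scale_den L g s + 1 <= 2 ^ (num_bits + 1))%N.
  apply: (@leq_exp2D _ _ num_bits 0); try (rewrite ?addn1 //).
  exact: leq_trans (leq_div _ _) scale_num_bits.
apply: leq_exp2M; first by rewrite expnD.
apply: leq_exp2M; first exact: leq_exp2M.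
by apply: leq_exp2X; rewrite addn1 ltn_expl.
Qed.

Lemma bit_budget_enough : let b := bit_budget in
  [/\ (n + 3 <= b)%N, (s < b)%N,
      [/\ (L < 2 ^ b)%N, (g < 2 ^ b)%N, (m < 2 ^ b)%N & (total_mass E clique L g < 2 ^ b)%N] &
      [/\ (sample_count E c clique L g s * scale_num E clique L g m < 2 ^ b)%N,
          (sample_count E c clique L g s * scale_den L g s < 2 ^ b)%N &
          (2 * sample_count E c clique L g s + 2 < 2 ^ b)%N]].
Proof.
have h1 := leq_exp2M sample_count_bits scale_num_bits.
have h2 := leq_exp2M sample_count_bits scale_den_bits.
have h3 := sample_count_bits; have h4 := total_mass_bits.
rewrite /= /bit_budget; split; try lia; split.
- by apply: leq_exp2_lt (leq_exp2_self L) _; lia.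
- by apply: leq_exp2_lt (leq_exp2_self g) _; lia.
- by apply: leq_exp2_lt (leq_exp2_self m) _; lia.
- by apply: leq_exp2_lt h4 _; lia.
- by apply: leq_exp2_lt h1 _; lia.
- by apply: leq_exp2_lt h2 _; lia.
have h5 : (2 * sample_count E c clique L g s + 2 <= 2 ^ (count_bits + 2))%N.
  apply: (@leq_exp2D _ _ (1 + count_bits) 1); try lia.
  exact: leq_exp2M.
by apply: leq_exp2_lt h5 _; lia.
Qed.

(** The largest terms are of the form L m, with L at most quadratic in n, hence the exponent 3. *)
Lemma bit_budget_poly (M : nat) : (L <= 2 * M ^ 2 * n ^ 2)%N ->
  (bit_budget <= (12 * M ^ 2 + c + 90) * (n + m) ^ 3)%N.
Proof.
move=> LM; set P := (n + m)%N.
have gm : (g <= m)%N by rewrite /m /walk_length leq_pmulr.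
have sm : (s <= m)%N by rewrite /m /walk_length leq_pmull.
have P1 : (1 <= P)%N by rewrite /P; lia.
have mP : (m <= P)%N by rewrite leq_addl.
have nP : (n <= P)%N by rewrite leq_addr.
have P12 : (P <= P ^ 2)%N by rewrite -mulnn leq_pmulr.
have P23 : (P ^ 2 <= P ^ 3)%N by rewrite (expnS P 2) leq_pmull.
have P21 : (P ^ 2 * P = P ^ 3)%N by rewrite (expnSr P 2).
have L2 : (L <= 2 * (M ^ 2 * P ^ 2))%N.
  by apply: leq_trans LM _; rewrite -mulnA !leq_mul // leq_exp2r.
have M23 : (M ^ 2 * P ^ 2 <= M ^ 2 * P ^ 3)%N by rewrite leq_mul.
have hP : (mass_bits <= 2 * (M ^ 2 * P ^ 2) + 9 * P ^ 2)%N.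
  rewrite /mass_bits; move: (M ^ 2 * P ^ 2)%N (P ^ 2)%N L2 P12 => u v; lia.
have hm : (mass_bits * m <= 2 * (M ^ 2 * P ^ 3) + 9 * P ^ 3)%N.
  by apply: leq_trans (leq_mul hP mP) _; rewrite -P21; apply: eq_leq; ring.
have Lm : (L * m <= 2 * (M ^ 2 * P ^ 3))%N.
  by apply: leq_trans (leq_mul L2 mP) _; rewrite -P21 !mulnA.
have gm2 : (g * m <= P ^ 2)%N by rewrite -mulnn leq_mul //; exact: leq_trans gm mP.
have nc : (n * c <= c * P ^ 3)%N.
  by rewrite mulnC leq_mul // (leq_trans nP) // (leq_trans P12).
have -> : ((12 * M ^ 2 + c + 90) * P ^ 3 =
    12 * (M ^ 2 * P ^ 3) + c * P ^ 3 + 90 * P ^ 3)%N by ring.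
have den : (den_bits = L * m + m + g + 2 * (g * m) + 1)%N by rewrite /den_bits; lia.
rewrite /bit_budget /count_bits den /num_bits.
move: mass_bits (mass_bits * m)%N (L * m)%N (g * m)%N (n * c)%N (M ^ 2 * P ^ 2)%N
  (M ^ 2 * P ^ 3)%N (c * P ^ 3)%N hm Lm gm2 nc hP M23 L2 => x0 x1 x2 x3 x4 x5 x6 x7.
move: (P ^ 3)%N (P ^ 2)%N P12 P23 => p3 p2; lia.
Qed.

End BitBudget.

(** * Number of samples and total running time *)

Section Costs.
Variables (R : realType) (E : environment R) (c : nat) (clique : bool) (L g s : nat).
Let n := env_n E.
Let m := walk_length g s.
Hypothesis n2 : (2 <= n)%N.
Hypothesis L0 : (0 < L)%N.
Hypothesis g0 : (0 < g)%N.
Hypothesis s0 : (0 < s)%N.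

Let y0 : R := 1 + (2 * g * g.+1)%:R^-1.

(** Insert the closed form of V_m(y): as the toggle mass is 2 g (g + 1) L, the powers of g (g + 1)
    cancel and only (2 L)^m remains next to the odd powers. *)
Lemma scale_ratio :
  (scale_num E clique L g m)%:R / (scale_den L g s)%:R =
  ((total_mass E clique L g)%:R / (toggle_mass L g)%:R) ^+ m / chebV y0 m.
Proof.
have := chebV_closed_form R m g0; rewrite -/y0; set v := chebV y0 m => vE.
have oddE : (odd_pow (g + 1) m + odd_pow g m)%:R = v * ((2 * g).+1 * (g.+1 * g) ^ m)%:R.
  by rewrite vE addn1.
have v0 : v != 0.
  apply: contraTneq (leqnn 0%N) => v0; move: vE; rewrite v0 mul0r => /esym/eqP.
  by rewrite pnatr_eq0 addn_eq0 !expn_eq0.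
rewrite /scale_num /scale_den -/m [(den_pow L m * _)%:R]natrM oddE /den_pow /toggle_mass /shift.
rewrite !natrM !natrX !natrM !addn1 !exprMn !exprVn !exprMn.
have gR : g%:R != 0 :> R by rewrite pnatr_eq0 -lt0n.
have LR : L%:R != 0 :> R by rewrite pnatr_eq0 -lt0n.
have h1 : g.+1%:R ^+ m != 0 :> R by rewrite expf_neq0 // pnatr_eq0.
have h2 : g%:R ^+ m != 0 :> R by rewrite expf_neq0.
have h3 : L%:R ^+ m != 0 :> R by rewrite expf_neq0.
have h4 : (2 : R) ^+ m != 0 by rewrite expf_neq0 // pnatr_eq0.
have h5 : (2 * g).+1%:R != 0 :> R by rewrite pnatr_eq0.
move: (g.+1%:R ^+ m) (g%:R ^+ m) (L%:R ^+ m) (2 ^+ m : R) ((2 * g).+1%:R : R) h1 h2 h3 h4 h5.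
move: (_ ^+ m) => N a b d e f h1 h2 h3 h4 h5.
by field; rewrite v0 h1 h2 h3 h4 h5.
Qed.

(** The ratio is 1 + 2 (1 + 1/D) + 2 n w / L with w = [slots], and D >= 4. *)
Lemma mass_ratio :
  (total_mass E clique L g)%:R / (toggle_mass L g)%:R <=
  4 + 2 * (n * slots E clique)%:R / L%:R :> R.
Proof.
rewrite /total_mass /stay_mass /toggle_mass.
have D4 : (4 <= shift g)%N.
  by rewrite /shift -[4%N]/(2 * 1 * 2)%N leq_mul ?leq_mul ?addn1.
move: (shift g) D4 => D D4.
have DR : 4 <= D%:R :> R by rewrite (ler_nat R 4 D).
have LR : 0 < L%:R :> R by rewrite ltr0n.
rewrite ler_pdivrMr; last by rewrite ltr0n muln_gt0 L0 (leq_trans _ D4).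
rewrite !natrD !natrM natrD; set N : R := n%:R * _.
have -> : (4 + 2 * N / L%:R) * (D%:R * L%:R) = 4 * D%:R * L%:R + 2 * D%:R * N.
  by field; rewrite gt_eqF.
by nra.
Qed.

(** As V_m(y) >= 1, the rescaling factor is at most Y^m; its rounding costs a factor 2, and 2^s <=
    2^m. *)
Lemma sample_count_le (Y : R) : 1 <= Y ->
  4 + 2 * (n * slots E clique)%:R / L%:R <= Y ->
  (sample_count E c clique L g s)%:R <= 4 * 4 ^+ m * Y ^+ (2 * m) * n.+1%:R ^+ c.
Proof.
move=> Y1 hY; have Y0 : 0 <= Y by apply: le_trans Y1.
have v1 : 1 <= chebV y0 m.
  apply: le_trans (chebV_growth R s g0).
  by rewrite ler_pdivlMr // mul1r (ler_nat R 2) -{1}(expn1 2) leq_exp2l.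
have Ym : 1 <= Y ^+ m by rewrite exprn_ege1.
have q : (scale_num E clique L g m %/ scale_den L g s + 1)%:R <= 2 * Y ^+ m.
  rewrite natrD; apply: (@le_trans _ _ (Y ^+ m + 1)); last by lra.
  rewrite lerD2r.
  apply: (@le_trans _ _ ((scale_num E clique L g m)%:R / (scale_den L g s)%:R)).
    rewrite ler_pdivlMr ?ltr0n ?scale_den_gt0 // -natrM ler_nat.
    exact: leq_divM.
  rewrite scale_ratio ler_pdivrMr; last by apply: lt_le_trans v1.
  apply: (@le_trans _ _ (Y ^+ m)); last by rewrite ler_peMr // exprn_ge0.
  rewrite lerXn2r ?nnegrE ?divr_ge0 //.
  exact: le_trans mass_ratio hY.
have sm : (s <= m)%N by rewrite /m /walk_length leq_pmull.
have es : (2 ^ s)%:R <= 2 ^+ m :> R by rewrite -natrX ler_nat leq_exp2l.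
rewrite /sample_count !natrM -/m natrX addn1.
have -> : 4 * 4 ^+ m * Y ^+ (2 * m) * n.+1%:R ^+ c =
    (2 ^+ m * 2 ^+ m) * ((2 * Y ^+ m) * (2 * Y ^+ m) * n.+1%:R ^+ c) :> R.
  have -> : (4 : R) ^+ m = 2 ^+ m * 2 ^+ m by rewrite -exprMn; congr (_ ^+ m); ring.
  by rewrite mulnC exprM expr2; ring.
rewrite !ler_pM ?mulr_ge0 ?exprn_ge0 ?ler0n //.
- by rewrite -!natrX ler_nat leq_exp2l.
- by rewrite -!natrX ler_nat leq_exp2l.
- by rewrite -addn1.
- by rewrite -addn1.
by rewrite addn1 natrX.
Qed.

Lemma program_steps_le (M : nat) : (L <= 2 * M ^ 2 * n ^ 2)%N ->
  (program_steps E c clique L g s <=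
   sample_count E c clique L g s * ((6 * M ^ 2 + 120) * (n + m) ^ 2))%N.
Proof.
move=> LM; set P := (n + m)%N.
have gm : (g <= m)%N by rewrite /m /walk_length leq_pmulr.
have sm : (s <= m)%N by rewrite /m /walk_length leq_pmull.
have P1 : (1 <= P)%N by rewrite /P; lia.
have mP : (m <= P)%N by rewrite leq_addl.
have nP : (n <= P)%N by rewrite leq_addr.
have P12 : (P <= P ^ 2)%N by rewrite -mulnn leq_pmulr.
have nm : (m * n <= P ^ 2)%N by rewrite -mulnn leq_mul.
have L2 : (L <= 2 * (M ^ 2 * P ^ 2))%N.
  by apply: leq_trans LM _; rewrite -mulnA !leq_mul // leq_exp2r.
have N1 : (0 < sample_count E c clique L g s)%N by exact: sample_count_gt0.
rewrite /program_steps -/m.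
apply: (@leq_trans (sample_count E c clique L g s *
  (L * 3 + g * 3 + s * 4 + m * 6 + (sample_steps E m).+1 + 50))).
  move: (sample_count _ _ _ _ _ _) N1 (sample_steps E m).+1 => N N1 S.
  move: (L * 3 + g * 3 + s * 4 + m * 6)%N => x; nia.
rewrite leq_mul2l; apply/orP; right.
have -> : (sample_steps E m = 12 * (m * n) + 31 * m + 13)%N.
  by rewrite /sample_steps /step_steps -/n; ring.
have -> : ((6 * M ^ 2 + 120) * P ^ 2 = 6 * (M ^ 2 * P ^ 2) + 120 * P ^ 2)%N by ring.
move: (m * n)%N (M ^ 2 * P ^ 2)%N nm L2 => x1 x2; move: (P ^ 2)%N P12 => p2; lia.
Qed.

Definition cost_constant (M A W : nat) : nat :=
  ((6 * M ^ 2 + 120) * ((3 * W + 1) * (12 * M ^ 2 + c + 90) + 2 * A + 1))%N.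

Lemma step_cost_le (M A W : nat) : (L <= 2 * M ^ 2 * n ^ 2)%N ->
  (env_sample_cost E <= A * n ^ A)%N -> (env_member_cost E <= A * n ^ A)%N ->
  (step_cost E (bit_budget E c L g s) W <=
   ((3 * W + 1) * (12 * M ^ 2 + c + 90) + 2 * A + 1) * ((n + m) ^ 3 * n ^ A))%N.
Proof.
move=> LM sA mA; have bP := bit_budget_poly c n2 L0 g0 s0 LM.
rewrite -/n -/m in bP; rewrite /step_cost.
have nA : (1 <= n ^ A)%N by rewrite expn_gt0 ltnW.
have P3 : (1 <= (n + m) ^ 3)%N by rewrite expn_gt0 addn_gt0 ltnW.
move: (bit_budget _ _ _ _ _) ((n + m) ^ 3)%N (n ^ A)%N (12 * M ^ 2 + c + 90)%N bP sA mA nA P3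
  => b p a B bP sA mA a1 p1.
have h1 : (b * (3 * W + 1) <= B * p * (3 * W + 1))%N by rewrite leq_mul2r bP orbT.
have h2 : (B * p * (3 * W + 1) <= (3 * W + 1) * B * (p * a))%N.
  apply: (@leq_trans ((3 * W + 1) * B * p)); first by apply: eq_leq; ring.
  by rewrite leq_mul2l leq_pmulr ?orbT.
have h3 : (A * a <= A * (p * a))%N by rewrite leq_mul2l leq_pmull ?orbT.
have h4 : (1 <= p * a)%N by rewrite muln_gt0 p1.
have -> : (((3 * W + 1) * B + 2 * A + 1) * (p * a) =
   (3 * W + 1) * B * (p * a) + 2 * (A * (p * a)) + p * a)%N by ring.
have -> : (3 * (W * b) + b = b * (3 * W + 1))%N by ring.
move: (b * (3 * W + 1))%N (B * p * (3 * W + 1))%N ((3 * W + 1) * B * (p * a))%N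
  (A * a)%N (A * (p * a))%N (p * a)%N h1 h2 h3 h4 sA mA; lia.
Qed.

(** The samples contribute 4^m Y^(2 m) (n + 1)^c. The number of steps per sample and the cost of a
    step contribute (n + m)^2 and (n + m)^3 n^A, and n + m <= n 2^m, which makes 2^(7 m) in all. [Y]
    stays free because the two time bounds choose it differently. *)
Lemma time_le (M A W : nat) (Y : R) : (L <= 2 * M ^ 2 * n ^ 2)%N ->
  (env_sample_cost E <= A * n ^ A)%N -> (env_member_cost E <= A * n ^ A)%N ->
  1 <= Y -> 4 + 2 * (n * slots E clique)%:R / L%:R <= Y ->
  (program_steps E c clique L g s * step_cost E (bit_budget E c L g s) W)%:R <=
  (4 * 2 ^ c * cost_constant M A W)%:R * n%:R ^+ (5 + A + c) * 2 ^+ (7 * m) * Y ^+ (2 * m).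
Proof.
move=> LM sA mA Y1 hY; have N := sample_count_le Y1 hY.
have st := program_steps_le LM; have sc := step_cost_le W LM sA mA.
apply: (@le_trans _ _ ((sample_count E c clique L g s)%:R *
  (cost_constant M A W * ((n * 2 ^ m) ^ 5 * n ^ A))%:R)).
  rewrite -natrM ler_nat; apply: leq_trans (leq_mul st sc) _.
  rewrite -mulnA leq_mul2l; apply/orP; right.
  have P : (n + m <= n * 2 ^ m)%N.
    have := ltn_expl m (ltnSn 1); have := n2; move: (2 ^ m)%N => e; nia.
  have P5 : ((n + m) ^ 5 <= (n * 2 ^ m) ^ 5)%N by rewrite leq_exp2r.
  apply: (@leq_trans (cost_constant M A W * ((n + m) ^ 5 * n ^ A))).
    by rewrite /cost_constant; apply: eq_leq; ring.
  by rewrite leq_mul2l leq_mul2r P5 !orbT.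
apply: le_trans (ler_wpM2r _ N) _; first by rewrite ler0n.
have nc : n.+1%:R ^+ c <= 2 ^+ c * n%:R ^+ c :> R.
  rewrite -exprMn -natrM -!natrX ler_nat; case: (c) => // c'; rewrite leq_exp2r //.
  by move: n2; lia.
apply: (@le_trans _ _ (4 * 4 ^+ m * Y ^+ (2 * m) * (2 ^+ c * n%:R ^+ c) *
   (cost_constant M A W * ((n * 2 ^ m) ^ 5 * n ^ A))%:R)).
  rewrite ler_wpM2r // ler_wpM2l // !mulr_ge0 ?exprn_ge0 //.
  exact: le_trans Y1.
move: (cost_constant M A W) => Kc; rewrite !(natrM, natrX).
have -> : (4 : R) ^+ m = 2 ^+ m * 2 ^+ m by rewrite -exprMn; congr (_ ^+ m); ring.
have -> : (2 : R) ^+ (7 * m) = (2 ^+ m) ^+ 7 by rewrite mulnC exprM.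
rewrite !exprD exprMn le_eqVlt; apply/orP; left; apply/eqP.
move: (2 ^+ m : R) (Y ^+ _) (2 ^+ c : R) (n%:R ^+ c : R) (n%:R ^+ A : R) => x1 x2 x3 x4 x5; ring.
Qed.

End Costs.

(** * Accuracy and asymptotics *)

Lemma swappables_le_slots (R : realType) (E : environment R) (clique : bool) :
  (clique -> is_clique_complex (env_complex E)) ->
  forall (A : {set 'I_(env_n E)}) j,
  A \in env_complex E -> j |: A \notin env_complex E ->
  (size (@swappables R E A j (env_n E)) <= slots E clique)%N.
Proof.
rewrite /slots; case: clique => [/(_ isT) Kcl|_] A j AK jK; last first.
  exact: size_swappables.
have : uniq (@swappables R E A j (env_n E)).
  by rewrite filter_uniq // take_uniq // enum_uniq.
have : all (swappable (env_complex E) A j) (@swappables R E A j (env_n E)).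
  exact: filter_all.
case: swappables => [|x [|y v]] //= /andP[hx /andP[hy _]] /andP[].
by rewrite (clique_swap_unique Kcl AK jK hx hy) inE eqxx.
Qed.

Lemma least_nat_threshold (P : pred nat) :
  (forall i j, (i <= j)%N -> P i -> P j) -> (exists i, P i) ->
  exists k, forall j, (k <= j)%N = P j.
Proof.
move=> Pmono exP; case: (ex_minnP exP) => k Pk kmin; exists k => j.
by apply/idP/idP => [kj|/kmin //]; exact: Pmono kj Pk.
Qed.

Lemma threshold_trunc (R : realType) (x : R) (j : nat) : 0 <= x ->
  (j < (Num.truncn x).+1)%N = (j%:R <= x).
Proof.
by move=> x0; case: j => [|j]; rewrite ?x0 // ltnS ltnNge truncn_le_nat -leNgt.
Qed.

(** * Bounds on g and s in terms of gamma and epsilon *)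

Section Logarithms.
Variable R : realType.
Implicit Types (x gamma epsilon : R).

Lemma ln2_ge_half : 2^-1 <= ln 2 :> R.
Proof.
have h : ln (1 + - 2^-1) <= - 2^-1 :> R by apply: le_ln1Dx; lra.
have e : 1 + - 2^-1 = 2^-1 :> R by lra.
by rewrite e lnV ?posrE // lerN2 in h.
Qed.

Lemma log_inv_ge_half epsilon : 2^-1 <= log_inv epsilon.
Proof.
apply: le_trans ln2_ge_half _; rewrite /log_inv ler_ln ?posrE ?lt_max ?ltr0n //.
by rewrite le_max lexx.
Qed.

(** From 2^s < 6 / epsilon follows s ln 2 <= ln 6 + log_inv <= 5 + log_inv. As ln 2 and log_inv are
    at least 1/2, this gives s + 1 <= 11 + 2 log_inv <= 24 log_inv. *)
Lemma doublings_le epsilon (s : nat) : 0 < epsilon ->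
  (s == 0)%N || ~~ (6 <= (2 ^ s)%:R * epsilon) -> s.+1%:R <= 24 * log_inv epsilon.
Proof.
have l2 := ln2_ge_half; have lh := log_inv_ge_half epsilon.
move=> e0 /orP[/eqP ->|]; first by lra.
rewrite -ltNge => hs.
have h : s%:R * ln 2 <= 5 + log_inv epsilon.
  have -> : s%:R * ln 2 = ln ((2 ^ s)%:R : R) by rewrite natrX lnXn // mulr_natl.
  apply: (@le_trans _ _ (ln (6 * Num.max 2 epsilon^-1))).
    rewrite ler_ln ?posrE ?mulr_gt0 ?lt_max ?ltr0n ?expn_gt0 //.
    apply: (@le_trans _ _ (6 * epsilon^-1)).
      by rewrite ler_pdivlMr // ltW.
    by rewrite ler_pM2l // le_max lexx orbT.
  rewrite lnM ?posrE ?lt_max ?ltr0n // lerD2r.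
  have -> : 6 = 1 + 5 :> R by ring.
  by apply: le_ln1Dx; lra.
have h' : s%:R * 2^-1 <= s%:R * ln 2 :> R by apply: ler_wpM2l => //; exact: ln2_ge_half.
by rewrite -natr1; lra.
Qed.

Lemma log_inv_ge0 epsilon : 0 <= log_inv epsilon.
Proof. by apply: le_trans (log_inv_ge_half epsilon). Qed.

(** For the last rejected g, g^2 gamma < M gives g sqrt gamma <= M, and gamma <= M gives sqrt gamma
    <= M; add the two. *)
Lemma sqrt_search_le gamma (M g : nat) : 0 < gamma -> (0 < M)%N ->
  gamma <= M%:R -> ~~ (M%:R <= (g * g)%:R * gamma) ->
  g.+1%:R <= 2 * M%:R * (Num.sqrt gamma)^-1.
Proof.
move=> g0 M0 gM; rewrite -ltNge => hg.
have q0 : 0 < Num.sqrt gamma by rewrite sqrtr_gt0.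
rewrite ler_pdivlMr // -natr1.
have qE : Num.sqrt gamma ^+ 2 = gamma by rewrite sqr_sqrtr // ltW.
have M1 : 1 <= M%:R :> R by rewrite ler1n.
move: qE hg gM; move: (Num.sqrt gamma) q0 => q q0 <-; rewrite natrM => hg gM.
have h1 : q <= M%:R.
  by rewrite leNgt; apply/negP => h; move: gM; rewrite expr2; nra.
have h2 : g%:R * q <= M%:R.
  rewrite leNgt; apply/negP => h; move: hg; rewrite expr2.
  have : M%:R * M%:R < g%:R * q * (g%:R * q) by rewrite ltr_pM ?ler0n.
  by move: (g%:R : R) h => G h; nra.
by nra.
Qed.

Lemma walk_length_le gamma epsilon (M g s : nat) : 0 < gamma -> 0 < epsilon ->
  (0 < M)%N -> gamma <= M%:R ->
  ~~ (M%:R <= (g * g)%:R * gamma) -> (s == 0)%N || ~~ (6 <= (2 ^ s)%:R * epsilon) ->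
  (walk_length g.+1 s.+1)%:R <= (48 * M)%:R * degree_bound gamma epsilon.
Proof.
move=> g0 e0 M0 gM hg hs; rewrite /walk_length /degree_bound natrM.
have h1 := sqrt_search_le g0 M0 gM hg; have h2 := doublings_le e0 hs.
apply: le_trans (ler_pM _ _ h1 h2) _; rewrite ?ler0n // natrM.
by rewrite le_eqVlt; apply/orP; left; apply/eqP; ring.
Qed.

End Logarithms.

(** * Bias and sampling error of the output *)

Section Accuracy.
Variables (R : realType) (E : environment R) (c : nat) (clique : bool) (L g s : nat).
Let n := env_n E.
Let K := env_complex E.
Let k := env_dim E.
Let m := walk_length g s.
Let d := #|faces K k|.
Let Ns := sample_count E c clique L g s.
Let F := scale_num E clique L g m.
Let Q := scale_den L g s.
Variables (lmax gap epsilon : R).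
Hypothesis Kcx : simplicial_complex K.
Hypothesis Kcl : clique -> is_clique_complex K.
Hypothesis n2 : (2 <= n)%N.
Hypothesis L0 : (0 < L)%N.
Hypothesis g0 : (0 < g)%N.
Hypothesis s0 : (0 < s)%N.
Hypothesis d0 : (0 < d)%N.
Hypothesis lmaxP : is_largest_eigenvalue (laplacian R K k) lmax.
Hypothesis gapP : is_spectral_gap (laplacian R K k) gap.
Hypothesis lmaxL : lmax <= L%:R.
Hypothesis Lgap : L%:R <= gap * (2 * g * g.+1)%:R.
Hypothesis e0 : 0 < epsilon.
Hypothesis es : 6 <= (2 ^ s)%:R * epsilon.

Definition memory_output (mem : seq nat) : R :=
  (nth 0%N mem 0)%:R / (nth 0%N mem 1)%:R.

Lemma scale_num_gt0 : (0 < F)%N.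
Proof. by rewrite /F /scale_num muln_gt0 addn1 expn_gt0 total_mass_gt0. Qed.

(** Half of epsilon pays for the bias, since 3 / 2^s <= epsilon / 2, and half for the sampling
    error. With r = F / Q, the latter exceeds its share with probability at most 4 r^2 / (N
    epsilon^2), and N is at least 36 r^2 (n + 1)^c / epsilon^2. *)
Lemma accuracy :
  1 - (n.+1%:R ^+ c)^-1 <=
    Pr (fun mem => `|memory_output mem - (betti R K k)%:R / d%:R| <= epsilon)
      (dmap (output_memory E c clique L g s) (acc_dist E c clique L g s)).
Proof.
pose y0 : R := 1 + (2 * g * g.+1)%:R^-1.
pose v := chebV y0 m.
pose tr := \tr (chebV (y0%:M - L%:R^-1 *: laplacian R K k) m).
have bias : `|tr / (d%:R * v) - (betti R K k)%:R / d%:R| <= epsilon / 2.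
  have h := (chebV_trace_estimate s d0 L0 g0 lmaxP gapP lmaxL Lgap (erefl y0)).
  apply: le_trans h _.
  by rewrite ler_pdivrMr ?ltr0n ?expn_gt0 //; move: es; move: ((2 ^ s)%:R : R) => S; nra.
have D0 : (0 < shift g)%N by rewrite /shift !muln_gt0 g0 addn1.
have n0 : (0 < n)%N by apply: ltnW.
have w0 : (0 < slots E clique)%N by rewrite /slots; case: clique.
have swle := swappables_le_slots Kcl.
have Dy : (shift g)%:R = (2 * g * g.+1)%:R :> R by rewrite /shift addn1.
have mean := Ex_sample_dist m Kcx n0 w0 D0 L0 swle d0.
have [accP var] := acc_variance n0 w0 D0 L0 d0 Ns mean.
set mu : R := (X in 1 + X) in var.
pose r : R := F%:R / Q%:R.
have Q0 : 0 < Q%:R :> R by rewrite ltr0n scale_den_gt0.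
have F0 : 0 < F%:R :> R by rewrite ltr0n scale_num_gt0.
have r0 : 0 < r by rewrite divr_gt0.
have N0 : 0 < Ns%:R :> R by rewrite ltr0n sample_count_gt0.
have mur : mu * r = tr / (d%:R * v).
  have T0R : 0 < (toggle_mass L g)%:R :> R by rewrite ltr0n /toggle_mass muln_gt0 D0.
  have NtR : 0 < (total_mass E clique L g)%:R :> R by rewrite ltr0n total_mass_gt0.
  have muE : mu = ((toggle_mass L g)%:R / (total_mass E clique L g)%:R) ^+ m * (tr / d%:R).
    by rewrite /mu Dy.
  rewrite /r /F /Q (scale_ratio E clique s L0 g0) -/m -/y0 -/v muE.
  rewrite mulrACA -exprMn.
  have -> : (toggle_mass L g)%:R / (total_mass E clique L g)%:R *
     ((total_mass E clique L g)%:R / (toggle_mass L g)%:R) = 1 :> R.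
    by field; rewrite !gt_eqF.
  by rewrite expr1n mul1r invfM mulrA.
(* The deviation of the accumulator that becomes epsilon / 2 under the rescaling by r / N. *)
clearbody mu; pose t := Ns%:R * (epsilon / 2) / r.
have t0 : 0 < t by rewrite divr_gt0 // mulr_gt0 // divr_gt0.
have := Pr_chebyshev accP t0 var.
set D := diter _ _ _ => cheb.
have -> : acc_dist E c clique L g s = D by [].
apply: (@le_trans _ _ (1 - Ns%:R / t ^+ 2)).
  rewrite lerD2l lerN2 /t.
  have -> : Ns%:R / (Ns%:R * (epsilon / 2) / r) ^+ 2 = 4 * r ^+ 2 / (Ns%:R * epsilon ^+ 2).
    by field; rewrite !gt_eqF.
  have nc : 0 < n.+1%:R ^+ c :> R by rewrite exprn_gt0.
  rewrite ler_pdivrMr ?mulr_gt0 ?exprn_gt0 // [leRHS]mulrC ler_pdivlMr //.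
  have rk : r <= (F %/ Q + 1)%:R.
    rewrite ler_pdivrMr // -natrM ler_nat addn1; apply: ltnW; apply: ltn_ceil.
    exact: scale_den_gt0.
  have -> : Ns%:R = (2 ^ s)%:R ^+ 2 * (F %/ Q + 1)%:R ^+ 2 * n.+1%:R ^+ c :> R.
    rewrite /Ns /sample_count -!natrX -!natrM -/m -/F -/Q -/n (addn1 n).
    by congr _%:R; ring.
  move: rk es; move: ((F %/ Q + 1)%:R : R) ((2 ^ s)%:R : R) (n.+1%:R ^+ c : R) nc => k' S nc nc0 rk eS.
  have h1 : 36 <= (S * epsilon) ^+ 2 by rewrite expr2; nra.
  have h2 : r ^+ 2 <= k' ^+ 2 by rewrite !expr2; nra.
  have h3 : 0 <= r ^+ 2 by apply: sqr_ge0.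
  have -> : S ^+ 2 * k' ^+ 2 * nc * epsilon ^+ 2 = (S * epsilon) ^+ 2 * k' ^+ 2 * nc by ring.
  rewrite ler_pM2r //; move: (r ^+ 2) (k' ^+ 2) ((S * epsilon) ^+ 2) h1 h2 h3 => x y z; nra.
apply: le_trans cheb _; rewrite !PrE Ex_map.
apply: (le_Ex (P := fun=> True) accP); first exact: dall_true.
move=> acc _; rewrite ler_nat; case: lerP => //= h.
suff -> : `|memory_output (output_memory E c clique L g s acc) - (betti R K k)%:R / d%:R| <= epsilon.
  by [].
have outE : memory_output (output_memory E c clique L g s acc) =
    ((acc - Ns)%N%:R / Ns%:R) * r.
  rewrite /memory_output /= -/Ns -/m -/F -/Q [X in X / _]natrM [X in _ / X]natrM /r.
  by field; rewrite !gt_eqF.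
rewrite outE; set B := (betti R K k)%:R / d%:R in bias *.
have B0 : 0 <= B by rewrite divr_ge0.
rewrite -mur in bias; clearbody B.
have h' : `|(acc%:R / Ns%:R - 1) * r - mu * r| <= epsilon / 2.
  have -> : (acc%:R / Ns%:R - 1) * r - mu * r = (acc%:R - Ns%:R * (1 + mu)) * (r / Ns%:R).
    by field; rewrite gt_eqF.
  rewrite normrM (gtr0_norm (x := r / _)) ?divr_gt0 //.
  by rewrite mulrA ler_pdivrMr // -ler_pdivlMr // [epsilon / 2 * _]mulrC.
move: bias h'; rewrite !ler_norml => /andP[b1 b2] /andP[b3 b4].
(* If truncation occurs, the exact estimate is negative and within epsilon of [B >= 0], so 0 is
   within epsilon as well. *)
case: (leqP Ns acc) => hN.
  have -> : (acc - Ns)%N%:R / Ns%:R = acc%:R / Ns%:R - 1 :> R.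
    by rewrite natrB // mulrBl divff // gt_eqF.
  by apply/andP; split; lra.
have -> : (acc - Ns)%N = 0%N by apply/eqP; rewrite subn_eq0 ltnW.
rewrite mul0r mul0r.
have : (acc%:R / Ns%:R - 1) * r <= 0.
  rewrite pmulr_lle0 // subr_le0 ler_pdivrMr // mul1r ler_nat; exact: ltnW.
by move=> h3; apply/andP; split; lra.
Qed.

End Accuracy.

Lemma spec_outcome (R : realType) (E : environment R) (b W : nat) alg mem N D
    (Q : seq nat -> bool) :
  (0 < b)%N -> spec E b 29 W alg mem N D -> (cmd_weight alg <= W)%N -> bounded b 29 mem ->
  exists fuel, let D' := exec E fuel alg (init_state mem) in
   (forall p o, (p, o) \in D' -> exists s, [/\ o = Some s,
      (run_time s <= N * step_cost E b W)%N & (peak_space s <= space_cost E b 29 W)%N]) /\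
   Pr (fun o : option state => if o is Some s then Q (memory s) else false) D' = Pr Q D.
Proof.
move=> b0 h hW memb; have [fuel hf] := h hW memb; exists fuel.
have [D2 [e1 e2 hD]] := hf fuel (leqnn _) 0%N (memory_size mem).
rewrite /init_state /= e1 -e2; split.
  move=> p o po.
  pose P (o : option state) := exists s, [/\ o = Some s,
      (run_time s <= N * step_cost E b W)%N & (peak_space s <= space_cost E b 29 W)%N].
  apply: (dall_mem (P := P) _ po); apply/dall_map; apply: dall_impl hD => s [_ [ht hp]].
  exists s; split=> //; apply: leq_trans hp _; rewrite geq_max leqnn andbT.
  apply: leq_trans (memory_size_le b0 memb) _; exact: leq_addr.
by rewrite !PrE !Ex_map.
Qed.

Lemma trivial_spec (R : realType) (E : environment R) (b W M c k : nat) (clique : bool) :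
  (0 < b)%N -> (env_n E <= b)%N ->
  spec E b 29 W (betti_cmd M c) [:: 1; k; nat_of_bool clique] 4
    (dret R (set_nth 0 (set_nth 0 (set_nth 0 [:: 1; k; nat_of_bool clique] 28 0) 0 0) 1 1))%N.
Proof.
move=> b0 nb; have z : (0 < 2 ^ b)%N by rewrite expn_gt0.
apply: (spec_assign b0 nb _ (v := 0%N)); [by []|by []|exact: z|by []|].
apply: (spec_if_true b0 nb); first by [].
apply: (spec_assign b0 nb _ (v := 0%N)); [by []|by []|exact: z|by []|].
apply: (spec_assign_last b0 nb _ (v := 1%N)); [by []|by []| |by []].
by rewrite -{1}(expn0 2) ltn_exp2l.
Qed.

(** The whole vertex set is the only possible k-face, so the Laplacian is a 1 by 1 matrix; the
    existence of a spectral gap makes it nonzero, and its kernel is trivial. *)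
Lemma betti_single_vertex (R : realType) (K : {set {set 'I_1}}) k (gap : R) :
  (0 < #|faces K k|)%N -> is_spectral_gap (laplacian R K k) gap ->
  betti R K k = 0%N /\ k = 0%N.
Proof.
move=> d0 [/eigenvalueP[v ve v0] gap0 _].
have d1 : (#|faces K k| <= 1)%N.
  apply: (@leq_trans #|[set [set: 'I_1]]|); last by rewrite cards1.
  apply: subset_leq_card; apply/fintype.subsetP => A.
  rewrite !inE => /andP[_ /eqP cA]; rewrite eqEcard finset.subsetT cardsT card_ord cA //.
split.
  rewrite /betti mxrank_ker; apply/eqP; rewrite subn_eq0 (leq_trans d1) // lt0n mxrank_eq0.
  apply: contraNneq v0 => L0; move: ve; rewrite L0 mulmx0 => /esym/eqP.
  by rewrite scaler_eq0 (negPf gap0).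
have /card_gt0P[A] := d0; rewrite !inE => /andP[_ /eqP cA].
by apply/eqP; rewrite -leqn0 -ltnS -cA -[leqRHS]card_ord max_card.
Qed.

(** * From explicit costs to the bounds of the theorem *)

Section Asymptotics.
Variable R : realType.
Implicit Types (gamma epsilon lambda : R).

Lemma degree_bound_ge0 gamma epsilon : 0 <= degree_bound gamma epsilon.
Proof. by rewrite mulr_ge0 ?invr_ge0 ?sqrtr_ge0 ?log_inv_ge0. Qed.

Lemma exprn_le_powR (X x : R) (j : nat) : 1 <= X -> j%:R <= x -> X ^+ j <= X `^ x.
Proof. by move=> X1 jx; rewrite -powR_mulrn ?ler_powR // (le_trans _ X1). Qed.

(** With X = max(2, n / lambda), 4 + 2 n / L <= 4 X <= X^3, so Y = X^3 is admissible, and 2^(7 m)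
    Y^(2 m) <= X^(13 m). *)
Lemma clique_time_bound (C Kc A Cm n m T : nat) (lambda gamma epsilon Lr : R) :
  (1 <= n)%N -> (Kc <= C)%N -> (A <= C)%N -> (13 * Cm <= C)%N ->
  0 < lambda -> lambda <= Lr ->
  m%:R <= Cm%:R * degree_bound gamma epsilon ->
  (forall Y : R, 1 <= Y -> 4 + 2 * n%:R / Lr <= Y ->
     T%:R <= Kc%:R * n%:R ^+ A * 2 ^+ (7 * m) * Y ^+ (2 * m)) ->
  T%:R <= time_clique C n lambda gamma epsilon.
Proof.
move=> n1 KC AC CC l0 lL mdeg hT; rewrite /time_clique.
set X := Num.max 2 (n%:R / lambda).
have X2 : 2 <= X by rewrite le_max lexx.
have X1 : 1 <= X by lra.
have X0 : 0 <= X by lra.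
have nX : n%:R / lambda <= X by rewrite le_max lexx orbT.
have Lr0 : 0 < Lr by apply: lt_le_trans lL.
have nL : n%:R / Lr <= n%:R / lambda by rewrite ler_wpM2l // lef_pV2 ?posrE.
have X3 : 4 * X <= X ^+ 3 by rewrite !exprS expr0 mulr1; nra.
apply: le_trans (hT (X ^+ 3) _ _) _; first exact: exprn_ege1.
  by rewrite -mulrA; lra.
apply: (@le_trans _ _ (X ^+ (13 * m) * (Kc%:R * n%:R ^+ A))).
  have -> : (13 * m = 7 * m + 3 * (2 * m))%N by ring.
  rewrite exprD [X ^+ (3 * _)]exprM [leRHS]mulrC [leRHS]mulrA.
  apply: ler_wpM2r; first by rewrite !exprn_ge0.
  apply: ler_wpM2l; first by rewrite mulr_ge0 ?exprn_ge0.
  by rewrite lerXn2r ?nnegrE.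
apply: ler_pM; rewrite ?mulr_ge0 ?exprn_ge0 ?ler0n //.
  apply: exprn_le_powR => //; rewrite natrM.
  apply: (@le_trans _ _ (13 * (Cm%:R * degree_bound gamma epsilon))).
    by rewrite ler_wpM2l.
  by rewrite mulrA ler_wpM2r ?degree_bound_ge0 // -natrM ler_nat.
apply: ler_pM; rewrite ?exprn_ge0 ?ler0n ?ler_nat //.
by rewrite -!natrX ler_nat leq_pexp2l.
Qed.

(** Here Y = n^4 is admissible, since 4 + 2 n^2 <= n^4 for n >= 2. As m >= 1, the polynomial factor
    n^A is absorbed as well, which leads to n^((A + 15) m). *)
Lemma general_time_bound (C Kc A Cm n m T : nat) (gamma epsilon Lr : R) :
  (2 <= n)%N -> (1 <= m)%N -> (Kc <= C)%N -> ((A + 15) * Cm <= C)%N ->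
  1 <= Lr ->
  m%:R <= Cm%:R * degree_bound gamma epsilon ->
  (forall Y : R, 1 <= Y -> 4 + 2 * (n * n)%:R / Lr <= Y ->
     T%:R <= Kc%:R * n%:R ^+ A * 2 ^+ (7 * m) * Y ^+ (2 * m)) ->
  T%:R <= time_general C n gamma epsilon.
Proof.
move=> n2 m1 KC CC L1 mdeg hT; rewrite /time_general.
have n2R : 2 <= n%:R :> R by rewrite (ler_nat R 2).
have n1R : 1 <= n%:R :> R by lra.
have n0R : 0 <= n%:R :> R by lra.
apply: le_trans (hT (n%:R ^+ 4) _ _) _; first exact: exprn_ege1.
  apply: (@le_trans _ _ (4 + 2 * (n * n)%:R)).
    rewrite lerD2l ler_pdivrMr; last by lra.
    by rewrite ler_peMr // mulr_ge0.
  rewrite natrM !exprS expr0 mulr1; move: (n%:R : R) n2R => x x2.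
  have -> : x * (x * (x * x)) = (x * x) * (x * x) by ring.
  have : 4 <= x * x by nra.
  by move: (x * x) => u u4; nra.
apply: (@le_trans _ _ (Kc%:R * n%:R ^+ ((A + 15) * m))).
  rewrite -!mulrA ler_wpM2l //.
  apply: (@le_trans _ _ (n%:R ^+ (A * m) * (n%:R ^+ (7 * m) * n%:R ^+ (8 * m)))).
    apply: ler_pM; rewrite ?mulr_ge0 ?exprn_ge0 //.
      by rewrite ler_weXn2l // leq_pmulr.
    apply: ler_pM; rewrite ?exprn_ge0 //.
      by rewrite lerXn2r ?nnegrE.
    by rewrite -exprM mulnA.
  rewrite -!exprD le_eqVlt; apply/orP; left; apply/eqP; congr (_ ^+ _); ring.
apply: ler_pM; rewrite ?exprn_ge0 ?ler0n ?ler_nat //.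
apply: exprn_le_powR => //; rewrite natrM.
apply: (@le_trans _ _ ((A + 15)%:R * (Cm%:R * degree_bound gamma epsilon))).
  by rewrite ler_wpM2l.
by rewrite mulrA ler_wpM2r ?degree_bound_ge0 // -natrM ler_nat.
Qed.

Lemma space_bound_le (C Ks A Cm n m Sp : nat) (gamma epsilon : R) :
  (1 <= n)%N -> 0 < gamma -> (Ks * (1 + Cm) ^ 3 <= C)%N -> (6 + A <= C)%N ->
  m%:R <= Cm%:R * degree_bound gamma epsilon ->
  (Sp <= Ks * ((n + m) ^ 3 * n ^ A))%N ->
  Sp%:R <= space_bound C n gamma epsilon.
Proof.
move=> n1 g0 KC AC mdeg hS; rewrite /space_bound.
set S := n%:R + _ + _.
have l0 := log_inv_ge0 epsilon.
have gi : 0 < gamma^-1 by rewrite invr_gt0.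
have n1R : 1 <= n%:R :> R by rewrite ler1n.
have S1 : 1 <= S by rewrite /S; lra.
have S0 : 0 <= S by lra.
(* x <= x^2 + 1/4 at x = 1 / sqrt gamma bounds it by 1 / gamma + 1/4. *)
have q : (Num.sqrt gamma)^-1 <= S.
  have q0 : 0 < Num.sqrt gamma by rewrite sqrtr_gt0.
  have : gamma^-1 = (Num.sqrt gamma)^-1 ^+ 2 by rewrite exprVn sqr_sqrtr // ltW.
  rewrite /S => ->; move: (_^-1) => x; have := sqr_ge0 (x - 2^-1); rewrite !expr2; nra.
have deg : degree_bound gamma epsilon <= S ^+ 2.
  rewrite /degree_bound expr2; apply: ler_pM; rewrite ?invr_ge0 ?sqrtr_ge0 //.
  by rewrite /S; lra.
have nm : (n + m)%:R <= (1 + Cm)%:R * S ^+ 2.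
  rewrite !natrD mulrDl mul1r; apply: lerD.
    by rewrite expr2; apply: (@le_trans _ _ S); [rewrite /S; lra|rewrite ler_peMr].
  by apply: le_trans mdeg _; rewrite ler_wpM2l.
apply: (@le_trans _ _ (Ks%:R * (((1 + Cm)%:R * S ^+ 2) ^+ 3 * S ^+ A))).
  apply: (@le_trans _ _ (Ks * ((n + m) ^ 3 * n ^ A))%:R); first by rewrite ler_nat.
  rewrite [(Ks * _)%:R]natrM [(_ * n ^ A)%:R]natrM !natrX.
  apply: ler_wpM2l => //; apply: ler_pM; rewrite ?exprn_ge0 //.
    by rewrite lerXn2r ?nnegrE ?mulr_ge0 ?exprn_ge0.
  by rewrite lerXn2r ?nnegrE //; rewrite /S; lra.
have -> : Ks%:R * (((1 + Cm)%:R * S ^+ 2) ^+ 3 * S ^+ A) =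
    (Ks * (1 + Cm) ^ 3)%:R * S ^+ (6 + A).
  by rewrite natrM natrX exprMn -exprM exprD; ring.
by apply: ler_pM; rewrite ?exprn_ge0 ?ler0n ?ler_nat // ler_weXn2l.
Qed.

End Asymptotics.

Lemma betti_cmd_correct (R : realType) (M c A : nat) (n : nat) (K : {set {set 'I_n}}) (k : nat)
    (clique : bool) (sample_cost member_cost : nat)
    (lambda_max gap lambda gamma epsilon : R) :
  let W := cmd_weight (betti_cmd M c) in
  let Kc := (4 * 2 ^ c * cost_constant c M A W)%N in
  let Cm := (48 * M)%N in
  let B := (12 * M ^ 2 + c + 90)%N in
  let Ks := (29 * B + 29 + ((3 * W + 1) * B + 2 * A + 1))%N in
  forall C : nat,
  (Kc <= C)%N -> (5 + A + c <= C)%N -> ((5 + A + c + 15) * Cm <= C)%N ->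
  (Ks * (1 + Cm) ^ 3 <= C)%N -> (6 + A <= C)%N ->
  (0 < M)%N -> (2 <= n)%N ->
  simplicial_complex K ->
  (0 < #|faces K k|)%N ->
  (clique -> is_clique_complex K) ->
  (sample_cost <= A * n ^ A)%N ->
  (member_cost <= A * n ^ A)%N ->
  is_largest_eigenvalue (laplacian R K k) lambda_max ->
  is_spectral_gap (laplacian R K k) gap ->
  lambda_max <= M%:R * lambda -> lambda <= M%:R * lambda_max ->
  0 < gamma -> gamma * lambda <= gap ->
  0 < epsilon ->
  exists fuel : nat,
    let E := @Environment R n K k sample_cost member_cost
               (parameters lambda gamma epsilon) in
    let D := exec E fuel (betti_cmd M c) (init_state [:: n; k; nat_of_bool clique]) in
    (forall (p : R) (o : option state), (p, o) \in D ->
       exists s : state,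
         [/\ o = Some s,
             (run_time s)%:R <= (if clique
                             then time_clique C n lambda gamma epsilon
                             else time_general C n gamma epsilon) &
             (peak_space s)%:R <= space_bound C n gamma epsilon]) /\
    1 - (n.+1%:R ^+ c)^-1 <=
      Pr (fun o : option state =>
            if o is Some s then
              `|output R s - (betti R K k)%:R / #|faces K k|%:R| <= epsilon
            else false) D.
Proof.
move=> W Kc Cm B Ks C hKc hA hCm hKs h6 M0 n2 Kcx d0 Kcl sA mA lmaxP gapP lmaxM lamM g0 ggap e0.
pose E := @Environment R n K k sample_cost member_cost (parameters lambda gamma epsilon).
have lmax1 : 1 <= lambda_max := laplacian_largest_ge1 Kcx d0 lmaxP.
have lmaxn : lambda_max <= (n ^ 2)%:R.
  by have [ev _] := lmaxP; exact: laplacian_eigenvalue_le Kcx _ ev.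
have MR : 1 <= M%:R :> R by rewrite ler1n.
have Ml1 : 1 <= M%:R * lambda by apply: le_trans lmaxM.
have lam0 : 0 < lambda by rewrite -(@pmulr_rgt0 _ M%:R) //; lra.
pose L := (Num.truncn (M%:R * lambda)).+1.
have LP j : (j < L)%N = (j%:R <= M%:R * lambda).
  by apply: threshold_trunc; lra.
have L0 : (0 < L)%N by [].
have Lgt : M%:R * lambda < L%:R by rewrite ltNge -LP ltnn.
have Lle : L%:R <= M%:R * lambda + 1.
  by rewrite -natr1 lerD2r -LP.
have lmaxL : lambda_max <= L%:R by lra.
have LM : (L <= 2 * M ^ 2 * n ^ 2)%N.
  rewrite -(ler_nat R) [(2 * M ^ 2 * n ^ 2)%:R]natrM [(2 * M ^ 2)%:R]natrM !natrX.
  apply: le_trans Lle _; rewrite -[leRHS]mulrA.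
  have h : M%:R * lambda <= M%:R ^+ 2 * n%:R ^+ 2.
    rewrite [M%:R ^+ 2]expr2 -mulrA ler_wpM2l //; apply: le_trans lamM _.
    by rewrite ler_wpM2l // -natrX.
  by move: (M%:R ^+ 2 * n%:R ^+ 2) h => x h; lra.
(* gamma lambda <= gap <= lambda_max <= M lambda. *)
have gammaM : gamma <= M%:R.
  have gapl : gap <= lambda_max by have [ev _ _] := gapP; have [_] := lmaxP; apply.
  by rewrite -(ler_pM2r lam0); apply: le_trans ggap _; lra.
have [g gP] : exists g, forall j, (g <= j)%N = (M%:R <= (j * j)%:R * gamma).
  apply: least_nat_threshold => [i j ij /le_trans|]; first apply.
    by rewrite ler_wpM2r ?(ltW g0) // ler_nat leq_mul.
  exists (Num.truncn (M%:R / gamma)).+1.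
  rewrite -ler_pdivrMr //; apply: le_trans (ltW (truncnS_gt _)) _.
  by rewrite ler_nat leq_pmulr.
have [s' sP'] : exists s, forall j, (s <= j)%N = (6 <= (2 ^ j.+1)%:R * epsilon).
  apply: least_nat_threshold => [i j ij /le_trans|]; first apply.
    by rewrite ler_wpM2r ?(ltW e0) // ler_nat leq_exp2l // ltnS.
  exists (Num.truncn (6 / epsilon)).+1.
  rewrite -ler_pdivrMr //; apply: le_trans (ltW (truncnS_gt _)) _.
  by rewrite ler_nat; apply: ltnW; apply: ltn_trans (ltnSn _) _; exact: ltn_expl.
(* The value 0 never passes the test, so g has a predecessor, which was rejected and bounds g from
   above. *)
case: g gP => [|g'] gP.
  by have := gP 0%N; rewrite mul0r leqnn; lra.
pose s := s'.+1.
have sP j : (s <= j.+1)%N = (6 <= (2 ^ j.+1)%:R * epsilon) by rewrite ltnS.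
pose m := walk_length g'.+1 s.
have m0 : (1 <= m)%N by rewrite muln_gt0.
have mdeg : m%:R <= Cm%:R * degree_bound gamma epsilon.
  apply: walk_length_le => //; first by rewrite -gP ltnn.
  by move: sP'; case: (s') => [|s''] // hs; rewrite -hs ltnn.
pose b := bit_budget E c L g'.+1 s.
have [nb sb [Lb gb mb Ntb] [NFb NQb Nb]] := @bit_budget_enough R E c clique L g'.+1 s n2 L0 (ltn0Sn g') (ltn0Sn s').
have b0 : (0 < b)%N by apply: leq_ltn_trans sb.
have kn : (k < n)%N.
  have /card_gt0P[A0] := d0; rewrite !inE => /andP[_ /eqP cA].
  by rewrite -cA -[leqRHS]card_ord max_card.
have memb : bounded b 29 [:: n; k; nat_of_bool clique].
  have nlt : (n < 2 ^ b)%N.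
    by apply: leq_ltn_trans (ltn_expl b (ltnSn 1)); apply: leq_trans nb; rewrite leq_addr.
  by rewrite /bounded /= nlt (ltn_trans kn nlt) (bool_lt b0).
have sp := @betti_cmd_spec R E b W M c k clique L g'.+1 s n2 nb kn L0 (ltn0Sn g') (ltn0Sn s')
  LP gP sP Lb gb sb mb Ntb NFb NQb Nb.
have [fuel [hout hpr]] := spec_outcome
  (fun mem => `|memory_output R mem - (betti R K k)%:R / #|faces K k|%:R| <= epsilon)
  b0 sp (leqnn _) memb.
exists fuel; split.
  move=> p o /hout[st [-> ht hs]]; exists st; split=> //.
    have tl Y := @time_le R E c clique L g'.+1 s n2 L0 (ltn0Sn g') (ltn0Sn s') M A W Y LM sA mA.
    apply: (@le_trans _ _ (program_steps E c clique L g'.+1 s * step_cost E b W)%:R).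
      by rewrite ler_nat.
    case: clique Kcl tl {Ntb NFb NQb Nb memb sp hout hpr ht} => _ tl.
      apply: (@clique_time_bound R C Kc (5 + A + c) Cm n m _ lambda gamma epsilon L%:R) => //.
      - by apply: ltnW.
      - by apply: leq_trans hCm; rewrite leq_mul2r (leq_trans _ (leq_addl _ 15)) ?orbT.
      - apply: ltW; apply: le_lt_trans Lgt; rewrite ler_peMl // ltW //.
      - by move=> Y Y1 hY; apply: tl => //; rewrite /slots muln1.
    by apply: (@general_time_bound R C Kc (5 + A + c) Cm n m _ gamma epsilon L%:R) => //;
      rewrite ler1n.
  apply: (@space_bound_le R C Ks A Cm n m) => //; first exact: ltnW.
  apply: leq_trans hs _.
  have sc := @step_cost_le R E c L g'.+1 s n2 L0 (ltn0Sn g') (ltn0Sn s') M A W LM sA mA.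
  have bp := @bit_budget_poly R E c L g'.+1 s n2 L0 (ltn0Sn g') (ltn0Sn s') M LM.
  rewrite /space_cost /Ks mulnDl; apply: leq_add; last exact: sc.
  have nA : (1 <= n ^ A)%N by rewrite expn_gt0 ltnW.
  have P3 : (1 <= (n + m) ^ 3)%N by rewrite expn_gt0 addn_gt0 ltnW.
  apply: (@leq_trans (29 * (B * (n + m) ^ 3).+1)); first by rewrite leq_mul2l ltnS.
  clear -nA P3; move: B ((n + m) ^ 3)%N (n ^ A)%N nA P3 => B p a a1 p1.
  have h1 : (B * p <= B * (p * a))%N by rewrite leq_mul2l leq_pmulr ?orbT.
  have h2 : (1 <= p * a)%N by rewrite muln_gt0 p1.
  have -> : ((29 * B + 29) * (p * a) = 29 * (B * (p * a)) + 29 * (p * a))%N by ring.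
  by move: (B * p)%N (B * (p * a))%N (p * a)%N h1 h2; lia.
rewrite hpr.
apply: (@accuracy R E c clique L g'.+1 s lambda_max gap epsilon) => //.
- have h2 : M%:R <= (g'.+1 * g'.+1)%:R * gamma by rewrite -gP.
  (* L <= M lambda + 1 <= 2 M lambda, and M <= g^2 gamma turns this into 2 g (g + 1) gamma lambda,
     at most D times the gap. *)
  apply: (@le_trans _ _ (2 * (M%:R * lambda))); first by apply: le_trans Lle _; lra.
  apply: (@le_trans _ _ (gamma * lambda * (2 * g'.+1 * g'.+2)%:R)).
    rewrite -mulnA natrM; have h3 : (g'.+1 * g'.+1)%:R <= (g'.+1 * g'.+2)%:R :> R.
      by rewrite ler_nat leq_mul2l leqnSn.
    have h4 : M%:R <= (g'.+1 * g'.+2)%:R * gamma by apply: le_trans h2 _; rewrite ler_wpM2r // ltW.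
    have h5 := ler_wpM2r (ltW lam0) h4.
    move: h5; rewrite [leLHS]mulrC -mulrA; move: (_%:R : R) => z h5.
    by clear -h5; lra.
  by apply: ler_wpM2r.
by rewrite -sP.
Qed.

(** The program stops after four steps, with cells of at most 4 bits: 145 = 29 * 5 is the size of
    the memory. *)
Lemma single_vertex_case (R : realType) (M c A C : nat) (K : {set {set 'I_1}}) (k : nat)
    (clique : bool) (sample_cost member_cost : nat) (gap lambda gamma epsilon : R) :
  (4 * (12 * cmd_weight (betti_cmd M c) + 2 * A + 5) + 145 <= C)%N ->
  (0 < #|faces K k|)%N -> (sample_cost <= A)%N -> (member_cost <= A)%N ->
  is_spectral_gap (laplacian R K k) gap -> 0 < gamma -> 0 < epsilon ->
  exists fuel : nat,
    let E := @Environment R 1 K k sample_cost member_cost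
               (parameters lambda gamma epsilon) in
    let D := exec E fuel (betti_cmd M c) (init_state [:: 1%N; k; nat_of_bool clique]) in
    (forall (p : R) (o : option state), (p, o) \in D ->
       exists s : state,
         [/\ o = Some s,
             (run_time s)%:R <= (if clique
                             then time_clique C 1 lambda gamma epsilon
                             else time_general C 1 gamma epsilon) &
             (peak_space s)%:R <= space_bound C 1 gamma epsilon]) /\
    Pr (fun o : option state =>
            if o is Some s then
              `|output R s - (betti R K k)%:R / #|faces K k|%:R| <= epsilon
            else false) D = 1.
Proof.
set W := cmd_weight _ => hC d0 sA mA gapP g0 e0.
have [b0 k0] := betti_single_vertex d0 gapP.
pose E := @Environment R 1 K k sample_cost member_cost (parameters lambda gamma epsilon).
have memb : bounded 4 29 [:: 1%N; k; nat_of_bool clique] by rewrite k0; case: clique.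
have sp := @trivial_spec R E 4 W M c k clique isT isT.
have [fuel [hout hpr]] := spec_outcome
  (fun mem => `|memory_output R mem - (betti R K k)%:R / #|faces K k|%:R| <= epsilon)
  (isT : (0 < 4)%N) sp (leqnn _) memb.
have C0 : (0 < C)%N by apply: leq_trans hC; rewrite addn_gt0 orbT.
have stepC : (step_cost E 4 W <= 12 * W + 2 * A + 5)%N by rewrite /step_cost /=; lia.
exists fuel; split.
  move=> p o /hout[st [-> ht hs]]; exists st; split=> //.
    have tC : (run_time st)%:R <= C%:R :> R by rewrite ler_nat; move: ht stepC hC; lia.
    case: clique {memb sp hout hpr}.
      rewrite /time_clique expr1n mulr1; apply: le_trans tC _; rewrite ler_peMl //.
      rewrite -[X in X <= _](@powRr0 _ (Num.max 2 (1 / lambda))) ler_powR //.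
        by rewrite le_max ler1n.
      by rewrite mulr_ge0 ?degree_bound_ge0.
    by rewrite /time_general powR1 mulr1.
  have sC : (peak_space st)%:R <= C%:R :> R.
    by rewrite ler_nat; move: hs stepC hC; rewrite /space_cost; lia.
  rewrite /space_bound; apply: le_trans sC _; rewrite ler_peMr // exprn_ege1 //.
  by rewrite -addrA lerDl addr_ge0 ?invr_ge0 ?(ltW g0) ?log_inv_ge0.
rewrite hpr PrE /dret /Ex big_seq1 /= /memory_output /= b0 !mul0r subr0 normr0 (ltW e0).
by rewrite mulr1.
Qed.

Theorem theorem1p1 (R : realType) (a b : R) (c : nat) :
  0 < a -> a <= b ->
  exists alg : cmd, forall A : nat, exists C : nat,
  forall (n : nat) (K : {set {set 'I_n}}) (k : nat) (clique : bool)
    (sample_cost member_cost : nat)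
    (lambda_max gap lambda gamma epsilon : R),
  simplicial_complex K ->
  (0 < #|faces K k|)%N ->
  (clique -> is_clique_complex K) ->
  (sample_cost <= A * n ^ A)%N ->
  (member_cost <= A * n ^ A)%N ->
  is_largest_eigenvalue (laplacian R K k) lambda_max ->
  is_spectral_gap (laplacian R K k) gap ->
  a * lambda_max <= lambda -> lambda <= b * lambda_max ->
  0 < gamma -> gamma * lambda <= gap ->
  0 < epsilon ->
  exists fuel : nat,
    let E := @Environment R n K k sample_cost member_cost
               (parameters lambda gamma epsilon) in
    let D := exec E fuel alg (init_state [:: n; k; nat_of_bool clique]) in
    (forall (p : R) (o : option state), (p, o) \in D ->
       exists s : state,
         [/\ o = Some s,
             (run_time s)%:R <= (if clique
                             then time_clique C n lambda gamma epsilon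
                             else time_general C n gamma epsilon) &
             (peak_space s)%:R <= space_bound C n gamma epsilon]) /\
    1 - (n.+1%:R ^+ c)^-1 <=
      Pr (fun o : option state =>
            if o is Some s then
              `|output R s - (betti R K k)%:R / #|faces K k|%:R| <= epsilon
            else false) D.
Proof.
move=> a0 ab.
have summand (x1 x2 x3 x4 x5 x6 : nat) : let x := (x1 + x2 + x3 + x4 + x5 + x6)%N in
    [/\ x1 <= x, x2 <= x, x3 <= x, x4 <= x & x5 <= x]%N by split; lia.
(* One integer above both 1 / a and b: lambda_max and lambda bound each other up to the factor M,
   which the program can use as a literal. *)
pose M := (Num.truncn (a^-1 + b)).+1.
have b0 : 0 < b by exact: lt_le_trans ab.
have ia0 : 0 < a^-1 by rewrite invr_gt0.
have Mab : a^-1 + b <= M%:R by apply: ltW; exact: truncnS_gt.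
exists (betti_cmd M c) => A.
pose W := cmd_weight (betti_cmd M c).
pose B := (12 * M ^ 2 + c + 90)%N.
pose Ks := (29 * B + 29 + ((3 * W + 1) * B + 2 * A + 1))%N.
pose C1 := (4 * 2 ^ c * cost_constant c M A W)%N.
pose C2 := ((5 + A + c + 15) * (48 * M))%N.
pose C3 := (Ks * (1 + 48 * M) ^ 3)%N.
pose C4 := (4 * (12 * W + 2 * A + 5) + 145)%N.
exists (C1 + (5 + A + c) + C2 + C3 + (6 + A) + C4)%N.
set C := (_ + C4)%N => n K k clique sc mc lmax gap lambda gamma epsilon.
move=> Kcx d0 Kcl sA mA lmaxP gapP la lb g0 ggap e0.
have lmax1 := laplacian_largest_ge1 Kcx d0 lmaxP.
(* There is no k-face for n = 0, as faces of dimension k >= 0 are nonempty; n = 1 is the shortcut of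
   the program. *)
case: n K Kcx d0 Kcl sA mA lmaxP gapP => [|[|n]] K Kcx d0 Kcl sA mA lmaxP gapP.
- have /card_gt0P[F] := d0; rewrite !inE => /andP[_ /eqP cF].
  by have := max_card (mem F); rewrite cF card_ord.
- rewrite exp1n muln1 in sA; rewrite exp1n muln1 in mA.
  have [|fuel [h1 h2]] := @single_vertex_case R M c A C K k clique sc mc gap lambda gamma
    epsilon _ d0 sA mA gapP g0 e0; first by rewrite leq_addl.
  exists fuel; split; first exact: h1.
  by rewrite h2 gerBl invr_ge0 exprn_ge0.
have [hC1 hC2 hC3 hC4 hC5] := summand C1 (5 + A + c)%N C2 C3 (6 + A)%N C4.
apply: (@betti_cmd_correct R M c A n.+2 K k clique sc mc lmax gap lambda gamma epsilon C) => //.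
- have h : lmax <= a^-1 * lambda by rewrite mulrC ler_pdivlMr // mulrC.
  apply: le_trans h _; apply: ler_wpM2r; last by lra.
  by apply: le_trans la; rewrite mulr_ge0 ?(ltW a0) //; lra.
apply: le_trans lb _; apply: ler_wpM2r; lra.
Qed.
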